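(* Let $0<\alpha<r$. (1) If $\lambda_n=\lambda_0\log(n)$ for every $n$, with $\lambda_0$ a large enough constant, then $$MS(\hat s^{(st)}_{\hat m},\rho_\alpha)\subsetneq MS(\hat s^{(ht)}_{\tilde m},\rho_\alpha)\subsetneq MS(\hat s^{(l)}_{\hat m},\rho_\alpha).$$ (2) If $\lambda_n=\lambda_0$ for every $n$, with $\lambda_0$ a large enough constant, then $$MS(\hat s^{(st)}_{\hat m},\rho_\alpha)\subsetneq MS(\hat s^{(ht)}_{\tilde m},\rho_\alpha).$$
   Context: Gaussian white noise model on $[0,1]$: $s\in\mathbb{L}_2([0,1])$ is unknown, $\|\cdot\|$ is the $\mathbb{L}_2([0,1])$ norm, and for $n\in\mathbb{N}^*=\{1,2,\dots\}$ one observes, for all $u\in\mathbb{L}_2([0,1])$, $Y_n(u)=\int_0^1u(t)s(t)\,dt+\frac{1}{\sqrt n}W_u$, where $(W_u)$ is a centered Gaussian process with $\mathbb{E}[W_uW_{u'}]=\int_0^1u(t)u'(t)\,dt$. When $\lambda_n=\lambda_0\log n$, only $n\ge2$ is considered (so that $\lambda_n>0$). Wavelets: $\phi,\psi$ are a compactly supported scaling function and wavelet whose dilates/translates $\phi_{jk}(x)=2^{j/2}\phi(2^jx-k)$, $\psi_{jk}(x)=2^{j/2}\psi(2^jx-k)$, once periodized, give an orthonormal basis $\{\phi_{00},\psi_{jk}:j\ge0,\ 0\le k\le2^j-1\}$ of $\mathbb{L}_2([0,1])$; the associated multiresolution analysis is $r$-regular (in the sense of Meyer) with $r\ge1$. For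 a model (finite-dimensional subspace) $m$ of dimension $D_m$, $\hat s_m$ minimizes $\gamma_n(u)=-2Y_n(u)+\|u\|^2$ over $u\in m$. The maximal resolution level $j_0(n)$, non-decreasing in $n$, is given by $2^{j_0(n)}\le n\lambda_n^{-1}<2^{j_0(n)+1}$. $\mathbb{N}=\{0,1,\dots\}$, $\mathcal{I}=\{(j,k):j\ge0,0\le k\le2^j-1\}$. Estimators: - $\hat s^{(st)}_{\hat m}=\hat s_{\hat m}$ with $\hat m=\arg\min_{m\in\mathcal{M}^{(s)}_n}\{\gamma_n(\hat s_m)+\frac{\lambda_n}{n}D_m\}$, where $\mathcal{M}^{(s)}_n=\{\mathrm{span}\{\phi_{00},\psi_{jk}:j<N,\ 0\le k<2^j\}:N\in\mathbb{N},\ N<j_0(n)\}$ (values of $n$ for which this is empty are ignored). - $\hat s^{(l)}_{\hat m}=\hat s_{\hat m}$ with $\hat m=\arg\min_{m\in\mathcal{M}^{(l)}_n}\{\gamma_n(\hat s_m)+\frac{\lambda_n}{n}D_m\}$, where $\mathcal{M}^{(l)}_n=\{\mathrm{span}\{\phi_{00},\psi_{jk}:(j,k)\in\mathcal{I}_m\}:\mathcal{I}_m\subset\{(j,k)\in\mathcal{I}:j<j_0(n)\}\}$. - Fix $\theta>2$. For $J\in\mathbb{N}$, $\mathcal{P}_J(\mathcal{I})$ is the set of subsets of $\mathcal{I}$ of the form $\{(j,k):0\le j<J,0\le k<2^j\}\cup\bigcup_{j\ge J}\{(j,k):k\in A_j\}$ with $|A_j|=\lfloor2^J(j-J+1)^{-\theta}\rfloor$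 ($\lfloor\cdot\rfloor$ the integer part), and $D_J$ is the common dimension of the spaces $\mathrm{span}\{\phi_{00},\psi_{jk}:(j,k)\in\mathcal{I}_m\}$, $\mathcal{I}_m\in\mathcal{P}_J(\mathcal{I})$. $\mathcal{M}^{(h)}_n=\{\mathrm{span}\{\phi_{00},\psi_{jk}:(j,k)\in\mathcal{I}_m,j<j_0(n)\}:J\in\mathbb{N},\mathcal{I}_m\in\mathcal{P}_J(\mathcal{I})\}$, and $\hat s^{(ht)}_{\tilde m}=\hat s_{\tilde m}$ with $\tilde m=\arg\min_{m\in\mathcal{M}^{(h)}_n}\{\gamma_n(\hat s_m)+\frac{\lambda_n}{n}D_J\}$, where $J$ is such that $m$ is obtained from $\mathcal{P}_J(\mathcal{I})$ (the smallest possible $D_J$ if several). Maxisets: $\rho_\alpha=(\rho_{n,\alpha})_n$, $\rho_{n,\alpha}=\left(\frac{\lambda_n}{n}\right)^{\frac{\alpha}{1+2\alpha}}$, and for an estimator $\hat s$, $MS(\hat s,\rho_\alpha)=\{s\in\mathbb{L}_2([0,1]):\sup_n\{\rho_{n,\alpha}^{-2}\mathbb{E}[\|\hat s-s\|^2]\}<\infty\}$. *)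

(* Defs.v *)
From HB Require Import structures.
From mathcomp Require Import all_boot all_order all_algebra.
From mathcomp Require Import all_classical all_reals all_analysis.

Set Implicit Arguments.
Unset Strict Implicit.
Unset Printing Implicit Defensive.
Import Order.TTheory GRing.Theory Num.Theory.
Import numFieldNormedType.Exports.

Local Open Scope classical_set_scope.
Local Open Scope ring_scope.

(* Elements of L2 are handled through representatives: functions R -> R, with
   the L2 structure given by a measure on R (Lebesgue measure for L2(R), its
   restriction to [0, 1] for L2([0, 1])). *)

Definition mu01 (R : realType) : {measure set (measurableTypeR R) -> \bar R} :=
  mrestr (@lebesgue_measure R) (measurable_itv `[0, 1]).

Definition L2 (R : realType)
    (mu : {measure set (measurableTypeR R) -> \bar R}) : set (R -> R) :=
  [set f | f \in Lfun mu 2%:E].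

Definition inner (R : realType)
    (mu : {measure set (measurableTypeR R) -> \bar R}) (u v : R -> R) : R :=
  \int[mu]_x (u x * v x).

Definition norm2 (R : realType)
    (mu : {measure set (measurableTypeR R) -> \bar R}) (u : R -> R) : R :=
  fine ('N[mu]_2%:E[EFin \o u]).

Definition lin_span (R : realType) (F : set (R -> R)) : set (R -> R) :=
  [set v | exists (n : nat) (c : 'I_n -> R) (f : 'I_n -> R -> R),
     (forall i, F (f i)) /\ v = \sum_(i < n) c i *: f i].

Definition free_family (R : realType) (n : nat) (b : 'I_n -> R -> R) : Prop :=
  forall c : 'I_n -> R, \sum_(i < n) c i *: b i = 0 -> forall i, c i = 0.

(* 0 for a space which is not finite-dimensional. The spaces of interest are
   spanned by orthonormal functions, so that linear independence of functions
   and of their classes modulo a.e. equality coincide. *)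
Definition dimension (R : realType) (m : set (R -> R)) : nat :=
  xget 0%N [set D | exists b : 'I_D -> R -> R,
    free_family b /\ m = lin_span (range b)].

Definition closed_subspace (R : realType)
    (mu : {measure set (measurableTypeR R) -> \bar R})
    (V : set (R -> R)) : Prop :=
  [/\ V `<=` L2 mu, V 0,
      forall (a : R) u v, V u -> V v -> V (a *: u + v) &
      forall u, L2 mu u ->
        (forall e : R, 0 < e -> exists2 v, V v & norm2 mu (u - v) < e) -> V u].

Definition dense_span (R : realType)
    (mu : {measure set (measurableTypeR R) -> \bar R})
    (V F : set (R -> R)) : Prop :=
  forall v, V v -> forall e : R, 0 < e ->
    exists2 u, lin_span F u & norm2 mu (v - u) < e.

Definition orthonormal_basis (R : realType)
    (mu : {measure set (measurableTypeR R) -> \bar R})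
    (V : set (R -> R)) (I : eqType) (D : set I) (e : I -> R -> R) : Prop :=
  [/\ forall i, D i -> V (e i),
      forall i j, D i -> D j -> inner mu (e i) (e j) = (i == j)%:R &
      dense_span mu V (e @` D)].

Definition translate (R : realType) (f : R -> R) (k : int) : R -> R :=
  fun x => f (x - k%:~R).

Definition riesz_basis (R : realType)
    (mu : {measure set (measurableTypeR R) -> \bar R})
    (V : set (R -> R)) (e : int -> R -> R) : Prop :=
  [/\ forall k, V (e k),
      dense_span mu V (range e) &
      exists A B : R, [/\ 0 < A, 0 < B &
        forall (s : seq int) (c : int -> R), uniq s ->
          A * (\sum_(k <- s) c k ^+ 2)
            <= norm2 mu (\sum_(k <- s) c k *: e k) ^+ 2
            <= B * (\sum_(k <- s) c k ^+ 2)]].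

Record multiresolution_analysis (R : realType) (V : int -> set (R -> R)) :
    Prop := MultiresolutionAnalysis {
  mra_closed : forall j, closed_subspace (@lebesgue_measure R) (V j) ;
  mra_nested : forall j, V j `<=` V (j + 1) ;
  mra_inter : forall f, (forall j, V j f) ->
    f = cst 0 %[ae (@lebesgue_measure R)] ;
  mra_dense : forall f, L2 (@lebesgue_measure R) f -> forall e : R, 0 < e ->
    exists j, exists2 g, V j g & norm2 (@lebesgue_measure R) (f - g) < e ;
  mra_dilate : forall j f, V j f <-> V (j + 1) (fun x => f (2 * x)) ;
  mra_translate : forall k f, V 0 f <-> V 0 (translate f k) ;
  mra_riesz : exists g, riesz_basis (@lebesgue_measure R) (V 0) (translate g)
}.

(* r-regularity in the sense of Meyer: G i is the i-th derivative of the
   generator g; as in the sense of distributions, the last one, G r, is only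
   an almost everywhere derivative of G r.-1. *)
Definition regular_mra (R : realType) (r : nat) (V : int -> set (R -> R)) :
    Prop :=
  exists g, riesz_basis (@lebesgue_measure R) (V 0) (translate g) /\
    exists G : nat -> R -> R,
      [/\ G 0%N = g,
          forall i, (i <= r)%N -> measurable_fun setT (G i),
          forall i, (i < r)%N -> forall x y : R, x <= y ->
            G i y - G i x = \int[lebesgue_measure]_(t in `[x, y]) G i.+1 t &
          forall i, (i <= r)%N -> forall N : nat, exists C : R,
            forall x, `|G i x| <= C * (1 + `|x|) ^- N].

Definition wavelet_space (R : realType) (V : int -> set (R -> R)) :
    set (R -> R) :=
  [set f | V 1 f /\ forall g, V 0 g -> inner (@lebesgue_measure R) f g = 0].

Definition compactly_supported (R : realType) (f : R -> R) : Prop :=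
  exists K : R, forall x, K < `|x| -> f x = 0.

Definition dilated (R : realType) (f : R -> R) (j k : nat) : R -> R :=
  fun x => 2 `^ (j%:R / 2) * f (2 ^+ j * x - k%:R).

(* A finitely supported sum at every x when f is compactly supported. *)
Definition periodized (R : realType) (f : R -> R) : R -> R :=
  fun x => \sum_(l \in [set: int]) f (x + l%:~R).

(* The index None stands for phi_00, Some (j, k) for psi_jk. *)
Definition wavelet (R : realType) (phi psi : R -> R)
    (i : option (nat * nat)) : R -> R :=
  if i is Some (j, k) then periodized (dilated psi j k)
  else periodized (dilated phi 0 0).

Definition dyadic : set (nat * nat) := [set jk | (jk.2 < 2 ^ jk.1)%N].

Definition with_scaling (S : set (nat * nat)) : set (option (nat * nat)) :=
  None |` (Some @` S).

Record wavelet_system (R : realType) (r : nat) (V : int -> set (R -> R))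
    (phi psi : R -> R) : Prop := WaveletSystem {
  ws_mra : multiresolution_analysis V ;
  ws_regular : regular_mra r V ;
  ws_phi_support : compactly_supported phi ;
  ws_psi_support : compactly_supported psi ;
  ws_phi : orthonormal_basis (@lebesgue_measure R) (V 0) [set: int]
    (translate phi) ;
  ws_psi : orthonormal_basis (@lebesgue_measure R) (wavelet_space V)
    [set: int] (translate psi) ;
  ws_basis : orthonormal_basis (@mu01 R) (L2 (@mu01 R)) (with_scaling dyadic)
    (wavelet phi psi)
}.

(* The library's normal_prob requires a nonzero standard deviation; constant
   variables are added as degenerate Gaussian variables. *)
Definition gaussian (R : realType) (d : measure_display)
    (T : measurableType d) (P : probability T R) (X : T -> R) : Prop :=
  exists m sigma : R, 0 <= sigma /\
    forall A : set (measurableTypeR R), measurable A ->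
      P (X @^-1` A) = if sigma == 0 then \d_m A else normal_prob m sigma A.

Definition linear_on_L2 (R : realType) (y : (R -> R) -> R) : Prop :=
  forall (a : R) u v, L2 (@mu01 R) u -> L2 (@mu01 R) v ->
    y (a *: u + v) = a * y u + y v.

(* The covariance only yields the linearity of W up to a null set depending on
   the arguments; wn_linear selects a version with linear sample paths, without
   which minimizing the contrast over a subspace would depend on the version. *)
Record white_noise (R : realType) (d : measure_display)
    (T : measurableType d) (P : probability T R)
    (W : (R -> R) -> T -> R) : Prop := WhiteNoise {
  wn_measurable : forall u, L2 (@mu01 R) u ->
    measurable_fun setT (W u : T -> measurableTypeR R) ;
  wn_gaussian : forall (n : nat) (a : 'I_n -> R) (u : 'I_n -> R -> R),
    (forall i, L2 (@mu01 R) (u i)) ->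
    gaussian P (fun w => \sum_(i < n) a i * W (u i) w) ;
  wn_centered : forall u, L2 (@mu01 R) u -> ('E_P[W u] = 0)%E ;
  wn_covariance : forall u v, L2 (@mu01 R) u -> L2 (@mu01 R) v ->
    ('E_P[fun w => (W u w * W v w)%R] = (inner (@mu01 R) u v)%:E)%E ;
  wn_linear : {ae P, forall w, linear_on_L2 (W^~ w)}
}.

Definition observation (R : realType) (T : Type) (W : (R -> R) -> T -> R)
    (n : nat) (s : R -> R) (w : T) : (R -> R) -> R :=
  fun u => inner (@mu01 R) u s + (Num.sqrt n%:R)^-1 * W u w.

Definition contrast (R : realType) (y : (R -> R) -> R) (u : R -> R) : R :=
  - 2 * y u + norm2 (@mu01 R) u ^+ 2.

Definition minimum_contrast (R : realType) (y : (R -> R) -> R)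
    (m : set (R -> R)) (sh : R -> R) : Prop :=
  m sh /\ forall u, m u -> contrast y sh <= contrast y u.

Definition penalized_selection (R : realType) (M : set (set (R -> R)))
    (pen : set (R -> R) -> R) (y : (R -> R) -> R) (sh : R -> R) : Prop :=
  exists2 m, M m & minimum_contrast y m sh /\
    forall m' sh', M m' -> minimum_contrast y m' sh' ->
      contrast y sh + pen m <= contrast y sh' + pen m'.

(* An estimator maps a sample size and the observed process to a function. *)
Definition estimator (R : realType) := nat -> ((R -> R) -> R) -> (R -> R).

Definition cylinders (R : realType) : set (set ((R -> R) -> R)) :=
  [set C | exists u (B : set (measurableTypeR R)),
     [/\ L2 (@mu01 R) u, measurable B & C = [set y | B (y u)]]].

Definition measurable_estimator (R : realType) (sh : estimator R) : Prop :=
  forall n, (forall y, L2 (@mu01 R) (sh n y)) /\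
    forall v (B : set (measurableTypeR R)), L2 (@mu01 R) v -> measurable B ->
      <<s @cylinders R >> [set y | B (inner (@mu01 R) (sh n y) v)].

Definition nonempty_sizes (R : realType) (N : set nat)
    (M : nat -> set (set (R -> R))) : set nat :=
  [set n | N n /\ M n !=set0].

(* Sample sizes range over N; those with no model are ignored. *)
Definition penalized_estimator (R : realType) (N : set nat)
    (M : nat -> set (set (R -> R))) (D : nat -> set (R -> R) -> R)
    (lambda : nat -> R) (sh : estimator R) : Prop :=
  measurable_estimator sh /\
  forall n y, nonempty_sizes N M n -> linear_on_L2 y ->
    penalized_selection (M n) (fun m => lambda n / n%:R * D n m) y (sh n y).

Definition maximal_level (R : realType) (N : set nat) (lambda : nat -> R)
    (j0 : nat -> int) : Prop :=
  forall n, N n -> (2 : R) ^ j0 n <= n%:R / lambda n < (2 : R) ^ (j0 n + 1).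

Definition wavelet_span (R : realType) (phi psi : R -> R)
    (S : set (nat * nat)) : set (R -> R) :=
  lin_span (wavelet phi psi @` with_scaling S).

Definition below_level (j0 : int) : set (nat * nat) :=
  [set jk | jk.1%:Z < j0].

Definition sieve_models (R : realType) (phi psi : R -> R) (j0 : nat -> int)
    (n : nat) : set (set (R -> R)) :=
  [set m | exists N : nat, N%:Z < j0 n /\
     m = wavelet_span phi psi (dyadic `&` [set jk | (jk.1 < N)%N])].

Definition large_models (R : realType) (phi psi : R -> R) (j0 : nat -> int)
    (n : nat) : set (set (R -> R)) :=
  [set m | exists S, S `<=` dyadic `&` below_level (j0 n) /\
     m = wavelet_span phi psi S].

Definition hybrid_card (R : realType) (theta : R) (J j : nat) : nat :=
  Num.truncn (2 ^+ J * (j - J + 1)%:R `^ (- theta)).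

Definition hybrid_sets (R : realType) (theta : R) (J : nat) :
    set (set (nat * nat)) :=
  [set S | exists A : nat -> set nat,
     (forall j, (J <= j)%N ->
        A j `<=` `I_(2 ^ j) /\ (A j #= `I_(hybrid_card theta J j))%card) /\
     S = (dyadic `&` [set jk | (jk.1 < J)%N]) `|`
         \bigcup_(j in [set j | (J <= j)%N]) [set (j, k) | k in A j]].

Definition hybrid_models (R : realType) (theta : R) (phi psi : R -> R)
    (j0 : nat -> int) (n : nat) : set (set (R -> R)) :=
  [set m | exists J S, hybrid_sets theta J S /\
     m = wavelet_span phi psi (S `&` below_level (j0 n))].

(* The smallest dimension D_J, before truncation at the maximal level, among
   the J from which m is obtained. *)
Definition hybrid_dimension (R : realType) (theta : R) (phi psi : R -> R)
    (j0 : nat -> int) (n : nat) (m : set (R -> R)) : R :=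
  inf [set D : R | exists J S, [/\ hybrid_sets theta J S,
     m = wavelet_span phi psi (S `&` below_level (j0 n)) &
     D = (dimension (wavelet_span phi psi S))%:R]].

Definition model_dimension (R : realType) (n : nat) (m : set (R -> R)) : R :=
  (dimension m)%:R.

Definition sieve_estimator (R : realType) (phi psi : R -> R) (N : set nat)
    (lambda : nat -> R) (j0 : nat -> int) (sh : estimator R) : Prop :=
  penalized_estimator N (sieve_models phi psi j0) (@model_dimension R)
    lambda sh.

Definition large_estimator (R : realType) (phi psi : R -> R) (N : set nat)
    (lambda : nat -> R) (j0 : nat -> int) (sh : estimator R) : Prop :=
  penalized_estimator N (large_models phi psi j0) (@model_dimension R)
    lambda sh.

Definition hybrid_estimator (R : realType) (theta : R) (phi psi : R -> R)
    (N : set nat) (lambda : nat -> R) (j0 : nat -> int) (sh : estimator R) :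
    Prop :=
  penalized_estimator N (hybrid_models theta phi psi j0)
    (hybrid_dimension theta phi psi j0) lambda sh.

Definition risk (R : realType) (d : measure_display) (T : measurableType d)
    (P : probability T R) (W : (R -> R) -> T -> R) (sh : estimator R)
    (n : nat) (s : R -> R) : \bar R :=
  ('E_P[fun w => (norm2 (@mu01 R) (sh n (observation W n s w) - s) ^+ 2)%R])%E.

Definition rate (R : realType) (lambda : nat -> R) (alpha : R) (n : nat) : R :=
  (lambda n / n%:R) `^ (alpha / (1 + 2 * alpha)).

Definition maxiset (R : realType) (d : measure_display) (T : measurableType d)
    (P : probability T R) (W : (R -> R) -> T -> R) (N : set nat)
    (sh : estimator R) (rho : nat -> R) : set (R -> R) :=
  [set s | L2 (@mu01 R) s /\
    (ereal_sup [set (rho n ^- 2)%:E * risk P W sh n s | n in N] < +oo)%E].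

(* Main.v *)
Require Import Defs.
From HB Require Import structures.
From mathcomp Require Import all_boot all_order all_algebra finmap.
From mathcomp Require Import all_classical all_reals all_analysis.
From mathcomp Require Import measurable_realfun ring lra zify.

Set Implicit Arguments.
Unset Strict Implicit.
Unset Printing Implicit Defensive.
Import Order.TTheory GRing.Theory Num.Theory.
Import numFieldNormedType.Exports.

Local Open Scope classical_set_scope.
Local Open Scope ring_scope.

(** Why the theorem holds.  In the orthonormal wavelet basis every estimator of
    the statement keeps the observed coefficients with indices in a set [A],
    which minimizes a penalized criterion over a family of pairs [(A, D)] of an
    index set and a penalized dimension.  Its loss splits into the energy [bias]
    of the coefficients of [s] outside [A] and the energy [noise_energy] of the
    noise on [A].  Write [p = lambda n / n]; the squared rate is [p `^ gamma]
    with [gamma = 2 alpha / (1 + 2 alpha)].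

    The first step replaces the probabilistic maxisets by deterministic
    approximation classes: [s] is [approximated] by a family when at every
    sample size some [(A, D)] has [bias + p D] of the order of the squared rate.
    - Approximated functions belong to the maxiset.  This is an oracle
      inequality ([risk_upper]), provided that the noise is below a fraction of
      the penalty for all models at once, up to an error of small expectation.
      For sieve and hybrid models a constant [lambda] is enough
      ([profile_noise]): beyond its base level [J] a hybrid model has
      about [2 ^ J * l `^ (- theta)] coefficients at the level [J + l], so that
      thresholds which grow linearly with [l] have a sum of order [2 ^ J], while
      the excesses over them have exponentially small expectation.  For the
      large family every single coefficient must be thresholded, which takes a
      logarithmic [lambda] ([large_noise]).
    - Functions of the sieve and hybrid maxisets are approximated.  With
      probability 1/2 the noise is below a fraction of the penalty for all
      models; the risk bound then controls the bias of the model which is best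
      for the smaller penalty [p / 16] ([risk_lower]), because distinct
      dimensions differ by a factor of two at least.  A bound on this
      bias at each sample size yields a bound on the penalized bias, by
      induction along sample sizes divided by four
      ([penalized_bias_of_bias]).

    The inclusions between the approximation classes are immediate: the hybrid
    models contain the sieve models with comparable dimension, and the large
    family contains the truncated hybrid models.

    Strictness is shown by two functions whose level [j] carries the energy
    [2 `^ (- gamma j)], spread over [M j] coefficients; they exist by a version of
    the Riesz-Fischer theorem ([Lfun2_series], [sparse_exists]).  Let [L] be the
    maximal level, so that [2 ^ L] is of order [1 / p]; at the rate, models may
    have dimension of order [(2 ^ L) `^ a], where [a = 1 - gamma], and miss at most
    the energy of order [2 `^ (- gamma L)].
    - If [M j = 1], hybrid models of dimension [(2 ^ L) `^ a] contain the
      coefficients of all levels up to [L - O(1)], since from the base level [J]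
      they reach exponentially many levels, whereas a sieve would need dimension
      [2 ^ (L - O(1))] ([sieve_separation]).
    - If [M j] is about [2 ^ (a j)], all these coefficients up to the level [L]
      form a large model of the right dimension, whereas a hybrid model must keep
      half of the coefficients at a level [L - O(1)], which bounds the
      distance of its base level to [L] and makes its dimension of order [2 ^ L]
      ([hybrid_separation]). *)

Local Notation coef_index := (option (nat * nat)).
Local Notation sieve_set N := (dyadic `&` [set jk | (jk.1 < N)%N]).
Local Notation wavelet_basis phi psi :=
  (orthonormal_basis (mu01 _) (L2 (mu01 _)) (with_scaling dyadic)
    (wavelet phi psi)).

(** * Square-integrable functions *)

Section square_integrable.
Context d (T : measurableType d) (R : realType).
Variable mu : {measure set T -> \bar R}.
Implicit Types f g h : T -> R.

(** The inner product of [L2] for an arbitrary measure: it serves both for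
    functions on [0, 1] and for random variables. *)
Definition dotf f g : R := \int[mu]_x (f x * g x).

Local Notation L2f f := (f \in Lfun mu 2%:E).

Lemma Lfun2_meas f : L2f f -> measurable_fun setT f.
Proof. by rewrite inE => /andP[]; rewrite inE. Qed.

Lemma Lfun2D f g : L2f f -> L2f g -> L2f (f + g).
Proof.
move=> hf hg.
have p1 : (1 <= 2%:E :> \bar R)%E by rewrite lee_fin ler1n.
by have [_ h] := Lfun_addr_closed mu p1; exact: h.
Qed.

Lemma Lfun2Z (a : R) f : L2f f -> L2f (a *: f).
Proof.
move=> hf; have -> : a *: f = a \o* f.
  by apply/funext => x /=; rewrite mulrC.
by apply: Lfun_scale => //; rewrite ler1n.
Qed.

Lemma Lfun2_0 : L2f 0.
Proof.
have p1 : (1 <= 2%:E :> \bar R)%E by rewrite lee_fin ler1n.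
by have [h _] := Lfun_addr_closed mu p1.
Qed.

Lemma Lfun2_sum (I : Type) (r : seq I) (Q : pred I) (F : I -> T -> R) :
  (forall i, Q i -> L2f (F i)) -> L2f (\sum_(i <- r | Q i) F i).
Proof.
move=> h; elim/big_rec : _ => [|i x Qi hx]; first exact: Lfun2_0.
by apply: Lfun2D => //; exact: h.
Qed.

Lemma Lfun2B f g : L2f f -> L2f g -> L2f (f - g).
Proof.
by move=> hf hg; apply: Lfun2D => //; rewrite -scaleN1r; exact: Lfun2Z.
Qed.

Lemma Lfun2P f : L2f f <->
  measurable_fun setT f /\ (\int[mu]_x ((f x) ^+ 2)%:E < +oo)%E.
Proof.
have E : (\int[mu]_x `|(EFin \o f) x| `^ 2 = \int[mu]_x ((f x) ^+ 2)%:E)%E.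
  apply: eq_integral => x _ /=.
  by rewrite powR_mulrn// -normrX ger0_norm ?sqr_ge0.
rewrite inE; split => [/andP[]|[mf fi]].
  rewrite !inE /= /finite_norm unlock => mf; rewrite E => h; split=> //.
  by apply: (@lty_poweRy _ _ 2^-1).
apply/andP; rewrite !inE; split => //=.
by rewrite /finite_norm unlock E poweR_lty.
Qed.

Lemma dotf_integrable f g : L2f f -> L2f g ->
  mu.-integrable setT (EFin \o (fun x => f x * g x)).
Proof. by move=> hf hg; apply/Lfun1_integrable; exact: Lfun2_mul_Lfun1. Qed.

Lemma dotfC f g : dotf f g = dotf g f.
Proof. by apply: eq_Rintegral => x _; rewrite mulrC. Qed.

Lemma dotfDl f g h : L2f f -> L2f g -> L2f h ->
  dotf (f + g) h = dotf f h + dotf g h.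
Proof.
move=> hf hg hh; rewrite -RintegralD//; try exact: dotf_integrable.
by apply: eq_Rintegral => x _; rewrite mulrDl.
Qed.

Lemma dotfZl a f h : L2f f -> L2f h -> dotf (a *: f) h = a * dotf f h.
Proof.
move=> hf hh; rewrite -RintegralZl//; last exact: dotf_integrable.
by apply: eq_Rintegral => x _; rewrite mulrA.
Qed.

Lemma dotf0l h : dotf 0 h = 0.
Proof.
rewrite /dotf /Rintegral integral0_eq// => x _; by rewrite mul0r.
Qed.

Lemma dotf_suml (I : Type) (r : seq I) (Q : pred I) (F : I -> T -> R) h :
  (forall i, Q i -> L2f (F i)) -> L2f h ->
  dotf (\sum_(i <- r | Q i) F i) h = \sum_(i <- r | Q i) dotf (F i) h.
Proof.
move=> hF hh; elim: r => [|i r IH]; first by rewrite !big_nil dotf0l.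
rewrite !big_cons; case: ifP => // Qi.
by rewrite dotfDl ?IH//; [exact: hF|exact: Lfun2_sum].
Qed.

Lemma dotfDr f g h : L2f f -> L2f g -> L2f h ->
  dotf h (f + g) = dotf h f + dotf h g.
Proof. by move=> ? ? ?; rewrite !(dotfC h) dotfDl. Qed.

Lemma dotfZr a f h : L2f f -> L2f h -> dotf h (a *: f) = a * dotf h f.
Proof. by move=> ? ?; rewrite !(dotfC h) dotfZl. Qed.

Lemma dotf_sumr (I : Type) (r : seq I) (Q : pred I) (F : I -> T -> R) h :
  (forall i, Q i -> L2f (F i)) -> L2f h ->
  dotf h (\sum_(i <- r | Q i) F i) = \sum_(i <- r | Q i) dotf h (F i).
Proof.
by move=> ? ?; rewrite dotfC dotf_suml//; apply: eq_bigr => i _; rewrite dotfC.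
Qed.

Lemma dotf_ge0 f : 0 <= dotf f f.
Proof. by apply: Rintegral_ge0 => x _; rewrite -expr2 sqr_ge0. Qed.

Lemma dotf_sqrE f : L2f f -> (\int[mu]_x ((f x) ^+ 2)%:E = (dotf f f)%:E)%E.
Proof.
move=> hf; have/Lfun2_integrable_sqr hi := hf.
rewrite /dotf /Rintegral fineK; first by apply: eq_integral => x _; rewrite expr2.
by apply: integrable_fin_num => //; exact: dotf_integrable.
Qed.

Lemma dotfBB f g : L2f f -> L2f g ->
  dotf (f - g) (f - g) = dotf f f - 2 * dotf f g + dotf g g.
Proof.
move=> hf hg; have hN : L2f (- g) by rewrite -scaleN1r; exact: Lfun2Z.
rewrite dotfDl//; last exact: Lfun2D.
rewrite !dotfDr//; rewrite -scaleN1r in hN *.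
rewrite !dotfZr// !dotfZl// (dotfC g f); ring.
Qed.

End square_integrable.

Section orthogonal.
Context d (T : measurableType d) (R : realType).
Variable mu : {measure set T -> \bar R}.
Variables (I : eqType) (q : seq I) (e : I -> T -> R).
Hypothesis uq : uniq q.
Hypothesis he : forall i, i \in q -> e i \in Lfun mu 2%:E.

Lemma dotf_orthogonal (c c' : I -> R) :
  (forall i j, i \in q -> j \in q -> i != j -> dotf mu (e i) (e j) = 0) ->
  dotf mu (\sum_(i <- q) c i *: e i) (\sum_(i <- q) c' i *: e i) =
  \sum_(i <- q) c i * c' i * dotf mu (e i) (e i).
Proof.
move=> ho.
have hc (b : I -> R) i : i \in q -> b i *: e i \in Lfun mu 2%:E.
  by move=> iq; apply: Lfun2Z; exact: he.
rewrite big_seq [X in dotf mu _ X]big_seq.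
rewrite dotf_suml//; [|exact: hc|by apply: Lfun2_sum => i; exact: hc].
rewrite [RHS]big_seq; apply: eq_bigr => i iq.
rewrite dotf_sumr//; [|exact: hc|exact: hc].
rewrite -big_seq (bigD1_seq i)//= big_seq_cond big1 ?addr0.
  by rewrite dotfZl ?he// ?dotfZr ?he// ?hc// mulrA.
move=> j /andP[jq ji]; rewrite dotfZl ?he ?hc// dotfZr ?he//.
by rewrite ho ?mulr0// eq_sym.
Qed.

Lemma dotf_orthonormal (c c' : I -> R) :
  (forall i j, i \in q -> j \in q -> dotf mu (e i) (e j) = (i == j)%:R) ->
  dotf mu (\sum_(i <- q) c i *: e i) (\sum_(i <- q) c' i *: e i) =
  \sum_(i <- q) c i * c' i.
Proof.
move=> ho; rewrite dotf_orthogonal.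
  by apply: eq_big_seq => i iq; rewrite ho// eqxx mulr1.
by move=> i j iq jq ij; rewrite ho// (negbTE ij).
Qed.

End orthogonal.

(** * Exponential moments of Gaussian variables *)

(** The Radon-Nikodym derivative of the Gaussian law is its density almost
    everywhere. *)
Lemma ge0_integral_normal_prob (R : realType) (m s : R) (f : R -> \bar R) :
  (forall x, (0 <= f x)%E) -> measurable_fun setT f ->
  (\int[normal_prob m s]_x f x =
   \int[lebesgue_measure]_x (f x * (normal_pdf m s x)%:E))%E.
Proof.
move=> f0 mf.
have dom := normal_prob_dominates m s.
rewrite -(Radon_Nikodym_SigmaFinite.change_of_variables dom f0 measurableT mf).
have mpdf : measurable_fun setT (fun x => (normal_pdf m s x)%:E).
  by apply/measurable_EFinP; exact: measurable_normal_pdf.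
have iRN := Radon_Nikodym_SigmaFinite.f_integrable dom.
apply: ae_eq_integral => //.
- by apply: emeasurable_funM => //; exact: measurable_int iRN.
- exact: emeasurable_funM.
apply: ae_eqe_mul2l => /=.
apply: integral_ae_eq => //= E _ mE.
by rewrite -Radon_Nikodym_SigmaFinite.f_integral.
Qed.

(** Completing the square: an exponential tilt translates the Gaussian law, which
    yields its Laplace transform. *)
Lemma normal_pdf_tilt (R : realType) (m s t x : R) : s != 0 ->
  expR (t * x) * normal_pdf m s x =
  expR (m * t + s ^+ 2 * t ^+ 2 / 2) * normal_pdf (m + s ^+ 2 * t) s x.
Proof.
move=> s0; rewrite !normal_pdfE// /normal_fun !mulrA [_ * normal_peak s]mulrC.
rewrite [X in _ = X * _]mulrC -!mulrA; congr (_ * _).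
rewrite -!expRD; congr expR; field; exact: s0.
Qed.

Section exponential_bounds.
Variable R : realType.
Implicit Types x y t : R.

Lemma expR_ge3 y : 0 <= y -> 1 + y + y ^+ 2 / 2 <= expR y.
Proof.
move=> y0; have -> : 1 + y + y ^+ 2 / 2 = series (exp_coeff y) 3%N.
  rewrite /series/= !big_nat_recr//= big_nil /exp_coeff /= add0r.
  by rewrite expr0 expr1 fact0 !divr1.
apply: nondecreasing_cvgn_le; last exact: is_cvg_series_exp_coeff.
by apply: nondecreasing_series => n _ _; rewrite /exp_coeff/= divr_ge0// exprn_ge0.
Qed.

Lemma expR_subN_ge y : 0 <= y -> 2 * y <= expR y - expR (- y).
Proof.
move=> y0; have h := expR_ge3 y0; set q := 1 + y + y ^+ 2 / 2 in h.
have q0 : 0 < q by rewrite /q; nra.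
have hN : expR (- y) <= q^-1 by rewrite expRN lef_pV2 ?posrE ?expR_gt0.
have : 2 * y <= q - q^-1.
  rewrite -(ler_pM2r q0) mulrBl mulVf ?gt_eqF// /q.
  have : 0 <= y ^+ 4 by rewrite exprn_ge0.
  rewrite -subr_ge0 => ?; rewrite -subr_ge0.
  by apply: le_trans (_ : y ^+ 4 / 4 <= _); [lra|lra].
lra.
Qed.

(** Twice the hyperbolic cosine: a smooth function which dominates the square and
    has explicit Gaussian moments. *)
Definition exp2 t x := expR (t * x) + expR (- (t * x)).

Lemma exp2_gt0 t x : 0 < exp2 t x.
Proof. by rewrite addr_gt0// expR_gt0. Qed.

Lemma exp2_sqr t x :
  exp2 t x = 2 + (expR (t * x / 2) - expR (- (t * x / 2))) ^+ 2.
Proof.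
rewrite /exp2 {1}(splitr (t * x)) [in X in _ + X](splitr (t * x)) opprD !expRD.
have ab : expR (t * x / 2) * expR (- (t * x / 2)) = 1 by rewrite -expRD addrN expR0.
by lra.
Qed.

Lemma exp2_ge t x : 2 + t ^+ 2 * x ^+ 2 <= exp2 t x.
Proof.
rewrite exp2_sqr lerD2l -exprMn; set u := t * x.
wlog u0 : u / 0 <= u => [h|].
  have [|u0] := leP 0 u; first exact: h.
  have := h (- u); rewrite oppr_ge0 (ltW u0) sqrrN => /(_ isT).
  by rewrite mulNr opprK -[leRHS]sqrrN opprB.
have u2 : 0 <= u / 2 by rewrite divr_ge0.
have := expR_subN_ge u2; rewrite mulrCA divff// mulr1 => h.
by rewrite lerXn2r ?nnegrE// (le_trans u0).
Qed.

Lemma exp2_norm t x : 0 <= t -> expR (t * `|x|) <= exp2 t x.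
Proof.
move=> t0; have [x0|x0] := leP 0 x.
  by rewrite ger0_norm// lerDl expR_ge0.
by rewrite ltr0_norm// mulrN lerDr expR_ge0.
Qed.

(** Sharp as [t] tends to 0: this identifies the variance of a centered
    Gaussian variable from its Laplace transform. *)
Lemma exp2_le t x : 0 <= t <= 1 ->
  exp2 t x <= 2 + t ^+ 2 * x ^+ 2 + 6 * t ^+ 3 * exp2 2 x.
Proof.
move=> /andP[t0 t1]; rewrite exp2_sqr -[leRHS]addrA lerD2l.
pose u := `|x|; have u0 : 0 <= u by rewrite normr_ge0.
have -> : (expR (t * x / 2) - expR (- (t * x / 2))) ^+ 2 =
    (expR (t * u / 2) - expR (- (t * u / 2))) ^+ 2.
  rewrite /u; have [x0|x0] := leP 0 x; first by rewrite ger0_norm.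
  by rewrite ltr0_norm// !mulrN !mulNr opprK -[RHS]sqrrN opprB.
have -> : x ^+ 2 = u ^+ 2 by rewrite real_normK// num_real.
have tu0 : 0 <= t * u by rewrite mulr_ge0.
have ho y : 1 - expR (- y) <= y by have := expR_ge1Dx (- y); lra.
have h1 : expR (t * u / 2) - expR (- (t * u / 2)) <= t * u * expR (t * u / 2).
  have -> : expR (- (t * u / 2)) = expR (t * u / 2) * expR (- (t * u)).
    by rewrite -expRD; congr expR; field.
  by rewrite -{1}[expR (t * u / 2)]mulr1 -mulrBr mulrC ler_wpM2r ?expR_ge0.
have h0 : 0 <= expR (t * u / 2) - expR (- (t * u / 2)).
  by rewrite subr_ge0 ler_expR; nra.
have h2 : (expR (t * u / 2) - expR (- (t * u / 2))) ^+ 2 <=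
    (t * u) ^+ 2 * expR (t * u).
  have -> : (t * u) ^+ 2 * expR (t * u) = (t * u * expR (t * u / 2)) ^+ 2.
    by rewrite [RHS]exprMn [expR (_ / 2) ^+ 2]expr2 -expRD -splitr.
  by rewrite lerXn2r ?nnegrE// mulr_ge0// expR_ge0.
apply: le_trans h2 _.
have h3 : expR (t * u) <= 1 + t * u * expR u.
  have : expR (t * u) - 1 <= t * u * expR (t * u).
    have := ho (t * u); rewrite -(ler_pM2l (expR_gt0 (t * u))) mulrBr -expRD.
    by rewrite addrN expR0; lra.
  have : expR (t * u) <= expR u by rewrite ler_expR; nra.
  move=> hle; have := ler_wpM2l tu0 hle; lra.
have h4 : u ^+ 3 <= 6 * expR u.
  have := @expR_ge1Dxn _ u 2 u0; rewrite (_ : (3`!)%:R = 6 :> R)//; lra.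
have h5 : expR (2 * u) <= exp2 2 x by apply: exp2_norm.
have e0 := expR_gt0 u.
apply: (@le_trans _ _ ((t * u) ^+ 2 * (1 + t * u * expR u))).
  by rewrite ler_wpM2l// sqr_ge0.
have -> : (t * u) ^+ 2 * (1 + t * u * expR u) =
  t ^+ 2 * u ^+ 2 + t ^+ 3 * (u ^+ 3 * expR u) by ring.
rewrite lerD2l (_ : 6 * t ^+ 3 * _ = t ^+ 3 * (6 * exp2 2 x)); last by ring.
rewrite ler_wpM2l ?exprn_ge0//.
apply: le_trans (_ : 6 * expR u * expR u <= _).
  by rewrite ler_wpM2r// ltW.
by rewrite -mulrA ler_wpM2l// -expRD (_ : u + u = 2 * u)//; ring.
Qed.

(** The part of [x ^ 2] above the threshold [4 t ^ 2] has an exponentially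
    small expectation under the Gaussian law. *)
Lemma sqr_le_exp2 t x : 1 <= t ->
  x ^+ 2 <= 4 * t ^+ 2 + 6 * expR (- 2 * t ^+ 2) * exp2 t x.
Proof.
move=> t1; have t0 : 0 <= t by lra.
have [le|lt] := leP `|x| (2 * t).
  apply: (@le_trans _ _ (4 * t ^+ 2)).
    rewrite -[x ^+ 2]real_normK ?num_real//.
    have -> : 4 * t ^+ 2 = (2 * t) ^+ 2 by ring.
    by rewrite lerXn2r ?nnegrE// mulr_ge0.
  by rewrite lerDl mulr_ge0 ?(ltW (exp2_gt0 _ _))// mulr_ge0// expR_ge0.
pose u := `|x| - 2 * t; have u0 : 0 <= u by rewrite subr_ge0 ltW.
have tu0 : 0 <= t * u by rewrite mulr_ge0.
have := expR_ge3 tu0.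
have h : expR (t * u) <= expR (- 2 * t ^+ 2) * exp2 t x.
  have -> : expR (t * u) = expR (- 2 * t ^+ 2) * expR (t * `|x|).
    by rewrite -expRD; congr expR; rewrite /u; ring.
  by rewrite ler_wpM2l ?expR_ge0// exp2_norm.
have -> : x ^+ 2 = 4 * t ^+ 2 + 4 * (t * u) + u ^+ 2.
  by rewrite -[x ^+ 2]real_normK ?num_real// /u; ring.
have : u ^+ 2 <= (t * u) ^+ 2.
  by rewrite lerXn2r ?nnegrE//; nra.
rewrite -[6 * _ * _]mulrA; move: h tu0; move: (expR (t * u)) (expR _ * exp2 t x).
move: (t * u) (sqr_ge0 u) => v u2 E X *; clearbody u; lra.
Qed.

(** If [2 E cosh (t X) = 2 exp (S t ^ 2 / 2)] has the expansion
    [2 + t ^ 2 v + O(t ^ 3)] then [v = S]; [v < S] and [S < v] are each refuted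
    at one small [t]. *)
Lemma laplace_variance (S v K : R) : 0 <= S -> 0 <= v -> 0 < K ->
  (forall t, 2 + t ^+ 2 * v <= 2 * expR (S * t ^+ 2 / 2)) ->
  (forall t, 0 <= t <= 1 -> 2 * expR (S * t ^+ 2 / 2) <=
    2 + t ^+ 2 * v + 6 * t ^+ 3 * (2 * K)) -> v = S.
Proof.
move=> S0 v0 K0 lo up.
apply/eqP; rewrite eq_le; apply/andP; split; rewrite leNgt; apply/negP => lt.
  pose q := S * v + S + v + 1; have q1 : 1 <= q by rewrite /q; nra.
  have q0 : 0 < q by lra.
  pose T2 := (v - S) / q; have T0 : 0 < T2 by rewrite divr_gt0// subr_gt0.
  have := lo (Num.sqrt T2); rewrite (sqr_sqrtr (ltW T0)) => h.
  have T2q : T2 * q = v - S by rewrite divfK// gt_eqF.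
  have h1 : 0 < 1 - S * T2 / 2 by rewrite /q in T2q; nra.
  have h2 : expR (S * T2 / 2) <= (1 - S * T2 / 2)^-1.
    rewrite -[leLHS]invrK -expRN lef_pV2 ?posrE ?expR_gt0//.
    exact: expR_ge1Dx.
  have h3 : (1 + T2 * v / 2) * (1 - S * T2 / 2) <= 1.
    rewrite -ler_pdivlMr// div1r; apply: (le_trans _ h2); lra.
  rewrite /q in T2q; nra.
pose t := (S - v) / (13 * (K + S + 1)).
have d0 : 0 < 13 * (K + S + 1) by rewrite mulr_gt0//; lra.
have t0 : 0 < t by rewrite divr_gt0// subr_gt0.
have tE : t * (13 * (K + S + 1)) = S - v by rewrite divfK// gt_eqF.
have t1 : t <= 1 by rewrite ler_pdivrMr// mul1r; lra.
have := up t; rewrite (ltW t0) t1 => /(_ isT) h.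
have h1 := expR_ge1Dx (S * t ^+ 2 / 2).
have t20 : 0 < t ^+ 2 by rewrite exprn_gt0.
have h2 : t ^+ 2 * S <= t ^+ 2 * (v + 12 * t * K) by clearbody t; lra.
rewrite ler_pM2l// in h2; clearbody t; nra.
Qed.

End exponential_bounds.

Section gaussian.
Context (R : realType) d (T : measurableType d) (P : probability T R).
Implicit Types X : T -> R.

Lemma gaussian_exp X : measurable_fun setT X -> gaussian P X ->
  exists m s : R, forall t : R,
    (\int[P]_w (expR (t * X w))%:E = (expR (m * t + s ^+ 2 * t ^+ 2 / 2))%:E)%E.
Proof.
move=> mX [m [s [s0 hP]]]; exists m, s => t.
have mX' : measurable_fun setT (X : T -> measurableTypeR R) by [].
pose f (x : R) := (expR (t * x))%:E.
have mf : measurable_fun setT f.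
  apply/measurable_EFinP; exact: measurableT_comp.
have f0 x : (0 <= f x)%E by rewrite lee_fin expR_ge0.
transitivity (\int[pushforward P (X : T -> measurableTypeR R)]_x f x)%E.
  by rewrite ge0_integral_pushforward.
have [s00|sN0] := eqVneq s 0.
  rewrite s00 expr0n/= !mul0r addr0 [m * t]mulrC.
  transitivity (\int[dirac (m : measurableTypeR R)]_x f x)%E; last first.
    by rewrite integral_dirac// diracT mul1e.
  apply: eq_measure_integral.
  by move=> A mA _; have := hP A mA; rewrite s00 eqxx.
transitivity (\int[normal_prob m s]_x f x)%E.
  apply: eq_measure_integral.
  by move=> A mA _; have := hP A mA; rewrite (negbTE sN0).
rewrite ge0_integral_normal_prob//.
under eq_integral => x _ do rewrite -EFinM normal_pdf_tilt// EFinM.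
rewrite ge0_integralZl ?lee_fin ?expR_ge0//; last first.
- by move=> x _; rewrite lee_fin normal_pdf_ge0.
- by apply/measurable_EFinP; exact: measurable_normal_pdf.
by rewrite integral_normal_pdf mule1.
Qed.

Lemma measurable_expR_lin X t : measurable_fun setT X ->
  measurable_fun setT (fun w => (expR (t * X w))%:E).
Proof.
move=> mX; apply/measurable_EFinP; apply: measurableT_comp => //.
exact: measurable_funM.
Qed.

Lemma measurable_exp2 X t : measurable_fun setT X ->
  measurable_fun setT (fun w => exp2 t (X w)).
Proof.
move=> mX; apply: measurable_funD.
  by apply/measurable_EFinP; exact: measurable_expR_lin.
have -> : (fun w => expR (- (t * X w))) = (fun w => expR (- t * X w)).
  by apply/funext => w; rewrite mulNr.
by apply/measurable_EFinP; exact: measurable_expR_lin.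
Qed.

Lemma integral_exp2 X (f : R -> R) t : measurable_fun setT X ->
  (forall u, \int[P]_w (expR (u * X w))%:E = (f u)%:E)%E ->
  (\int[P]_w (exp2 t (X w))%:E = (f t + f (- t))%:E)%E.
Proof.
move=> mX hf; rewrite EFinD -!hf -ge0_integralD//=; try exact: measurable_expR_lin.
by apply: eq_integral => w _; rewrite /exp2 EFinD mulNr.
Qed.

(** The parameters of a Gaussian law are recovered from its first two moments by
    means of the Laplace transform, without computing Gaussian integrals of
    polynomials. *)
Lemma centered_gaussian_exp X (v : R) : measurable_fun setT X ->
  gaussian P X -> ('E_P[X] = 0)%E -> ('E_P[fun w => (X w * X w)%R] = v%:E)%E ->
  forall t, (\int[P]_w (expR (t * X w))%:E = (expR (t ^+ 2 * v / 2))%:E)%E.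
Proof.
move=> mX gX EX VX; have [m [s hms]] := gaussian_exp mX gX.
have mX2 : measurable_fun setT (fun w => (X w ^+ 2)%:E).
  by apply/measurable_EFinP; exact: measurable_funX.
have EX2 : (\int[P]_w (X w ^+ 2)%:E = v%:E)%E.
  by rewrite -VX unlock; apply: eq_integral => w _; rewrite expr2.
have v0 : 0 <= v.
  by rewrite -lee_fin -EX2 integral_ge0// => w _; rewrite lee_fin sqr_ge0.
have iX : P.-integrable setT (EFin \o X).
  have : X \in Lfun P 2%:E by apply/Lfun2P; rewrite EX2 ltry.
  move=> X2; apply/Lfun1_integrable; have := Lfun2_mul_Lfun1 X2 (Lfun_cst P 1 2).
  by rewrite (_ : X \* cst 1 = X)//; apply/funext => w /=; rewrite mulr1.
(* The Laplace transform is at least [1 + t E X = 1] for both signs of t. *)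
have hm t : 0 <= m * t + s ^+ 2 * t ^+ 2 / 2.
  rewrite -ler_expR expR0 -lee_fin -hms.
  have <- : (\int[P]_w (1 + t * X w)%:E = 1)%E.
    under eq_integral => w _ do rewrite EFinD EFinM.
    rewrite integralD//=; last 2 first.
    - exact: finite_measure_integrable_cst.
    - exact: integrableZl.
    rewrite integral_cst//= probability_setT mule1 integralZl//.
    by rewrite unlock in EX; rewrite EX mule0 adde0.
  apply: le_integral => //.
  - apply: (@integrableD _ _ _ P setT measurableT (cst 1%E) (fun w => (t * X w)%:E)) => //.
      exact: finite_measure_integrable_cst.
    by under eq_fun => w do rewrite EFinM; exact: integrableZl.
  - apply/integrableP; split; first exact: measurable_expR_lin.
    under eq_integral => w _ do rewrite gee0_abs ?lee_fin ?expR_ge0//.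
    by rewrite hms ltry.
  - by move=> w _; rewrite lee_fin expR_ge1Dx.
have m0 : m = 0.
  apply/eqP; apply/negPn/negP => mN0.
  have s1 : 0 < s ^+ 2 + 1 by rewrite ltr_wpDl// sqr_ge0.
  have := hm (- m / (s ^+ 2 + 1)).
  have -> : m * (- m / (s ^+ 2 + 1)) + s ^+ 2 * (- m / (s ^+ 2 + 1)) ^+ 2 / 2 =
     - (m ^+ 2 * (s ^+ 2 + 2)) / (2 * (s ^+ 2 + 1) ^+ 2).
    by field; rewrite gt_eqF.
  rewrite mulNr oppr_ge0 leNgt divr_gt0//; last first.
    by rewrite mulr_gt0// exprn_gt0.
  rewrite mulr_gt0//; last by rewrite ltr_wpDl// sqr_ge0.
  by rewrite lt_neqAle eq_sym sqrf_eq0 mN0 sqr_ge0.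
have c2 t : (\int[P]_w (exp2 t (X w))%:E = (2 * expR (s ^+ 2 * t ^+ 2 / 2))%:E)%E.
  rewrite (integral_exp2 _ mX hms) m0 !mul0r !add0r sqrrN.
  by rewrite mulr_natl mulr2n.
have int2 (t a : R) : 0 <= a ->
    (\int[P]_w (2 + t ^+ 2 * X w ^+ 2 + a * exp2 2 (X w))%:E =
     (2 + t ^+ 2 * v + a * (2 * expR (s ^+ 2 * 2 ^+ 2 / 2)))%:E)%E.
  move=> a0; under eq_integral => w _ do rewrite EFinD EFinD EFinM (EFinM a).
  rewrite ge0_integralD//; last 4 first.
  - by move=> w _; rewrite adde_ge0// mule_ge0// lee_fin ?sqr_ge0.
  - by apply: emeasurable_funD => //; exact: measurable_funeM.
  - by move=> w _; rewrite mule_ge0// lee_fin ltW ?exp2_gt0.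
  - by apply: measurable_funeM; apply/measurable_EFinP; exact: measurable_exp2.
  rewrite ge0_integralD//; last 2 first.
  - by move=> w _; rewrite mule_ge0// lee_fin sqr_ge0.
  - exact: measurable_funeM.
  rewrite integral_cst//= probability_setT mule1.
  rewrite ge0_integralZl ?lee_fin ?sqr_ge0//; last first.
    by move=> w _; rewrite lee_fin sqr_ge0.
  rewrite ge0_integralZl ?lee_fin//; last 2 first.
    by apply/measurable_EFinP; exact: measurable_exp2.
    by move=> w _; rewrite lee_fin ltW ?exp2_gt0.
  by rewrite EX2 c2.
have mc t : measurable_fun setT (fun w => (exp2 t (X w))%:E).
  by apply/measurable_EFinP; exact: measurable_exp2.
have m2 (t a : R) : measurable_fun setT
    (fun w => (2 + t ^+ 2 * X w ^+ 2 + a * exp2 2 (X w))%:E).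
  apply/measurable_EFinP; apply: measurable_funD.
    apply: measurable_funD; first exact: measurable_cst.
    apply: measurable_funM; first exact: measurable_cst.
    exact: measurable_funX.
  by apply: measurable_funM; [exact: measurable_cst|exact: measurable_exp2].
have lo t : 2 + t ^+ 2 * v <= 2 * expR (s ^+ 2 * t ^+ 2 / 2).
  rewrite -lee_fin -c2; have := int2 t 0 (lexx _); rewrite mul0r addr0 => <-.
  apply: ge0_le_integral => //.
  - move=> w _; rewrite lee_fin mul0r addr0.
    by have := sqr_ge0 (t * X w); rewrite exprMn; lra.
  - by move=> w _; rewrite lee_fin mul0r addr0 exp2_ge.
have up (t : R) : 0 <= t <= 1 -> 2 * expR (s ^+ 2 * t ^+ 2 / 2) <=
    2 + t ^+ 2 * v + 6 * t ^+ 3 * (2 * expR (s ^+ 2 * 2 ^+ 2 / 2)).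
  move=> t01; have t30 : 0 <= 6 * t ^+ 3 by case/andP: t01 => ? _; rewrite mulr_ge0// exprn_ge0.
  rewrite -lee_fin -c2 -int2//; apply: ge0_le_integral => //.
  - by move=> w _; rewrite lee_fin ltW ?exp2_gt0.
  - by move=> w _; rewrite lee_fin exp2_le.
suff vs : v = s ^+ 2 by move=> t; rewrite hms m0 mul0r add0r vs [s ^+ 2 * _]mulrC.
by apply: (@laplace_variance _ _ _ (expR (s ^+ 2 * 2 ^+ 2 / 2))); rewrite ?sqr_ge0 ?expR_gt0.
Qed.

End gaussian.

(** * Coordinates of the white noise *)

Section white_noise_coordinates.
Context (R : realType) d (T : measurableType d) (P : probability T R).
Variables (W : (R -> R) -> T -> R) (I : eqType) (D : set I) (e : I -> R -> R).
Hypothesis hW : white_noise P W.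
Hypothesis eL2 : forall i, D i -> L2 (mu01 R) (e i).
Hypothesis eo : forall i j, D i -> D j -> inner (mu01 R) (e i) (e j) = (i == j)%:R.

Let w_ i := W (e i).

Lemma wn_coord_meas i : D i -> measurable_fun setT (w_ i).
Proof. by move=> Di; exact: (wn_measurable hW (eL2 Di)). Qed.

Lemma wn_coord_cov i j : D i -> D j ->
  ('E_P[fun w => (w_ i w * w_ j w)%R] = ((i == j)%:R)%:E)%E.
Proof. by move=> Di Dj; rewrite (wn_covariance hW) ?eo//; exact: eL2. Qed.

Lemma wn_coord_L2 i : D i -> w_ i \in Lfun P 2%:E.
Proof.
move=> Di; apply/Lfun2P; split; first exact: wn_coord_meas.
have := wn_coord_cov Di Di; rewrite unlock eqxx => h.
under eq_integral => w _ do rewrite expr2.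
by rewrite h ltry.
Qed.

Lemma wn_coord_dot i j : D i -> D j -> dotf P (w_ i) (w_ j) = (i == j)%:R.
Proof.
move=> Di Dj; have := wn_coord_cov Di Dj.
by rewrite unlock /dotf /Rintegral => ->.
Qed.

Lemma wn_coord_mean i : D i -> ('E_P[w_ i] = 0)%E.
Proof. by move=> Di; apply: (wn_centered hW); exact: eL2. Qed.

(** Orthogonality and joint Gaussianity: the variance of the combination is
    [a ^ 2 + b ^ 2], so that the joint Laplace transform factors. *)
Lemma wn_pair_exp i j (a b : R) : D i -> D j -> i != j ->
  (\int[P]_w (expR (a * w_ i w + b * w_ j w))%:E =
   (expR ((a ^+ 2 + b ^+ 2) / 2))%:E)%E.
Proof.
move=> Di Dj ij; pose X := a *: w_ i + b *: w_ j.
have Xi := wn_coord_L2 Di; have Xj := wn_coord_L2 Dj.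
have aXi : a *: w_ i \in Lfun P 2%:E by exact: Lfun2Z.
have bXj : b *: w_ j \in Lfun P 2%:E by exact: Lfun2Z.
have X2 : X \in Lfun P 2%:E by exact: Lfun2D.
have gX : gaussian P X.
  have := @wn_gaussian _ _ _ _ _ hW 2 (fun k => if k == ord0 then a else b)
     (fun k => if k == ord0 then e i else e j).
  have -> : (fun w => \sum_(k < 2) (if k == ord0 then a else b) *
     W (if k == ord0 then e i else e j) w) = X.
    by apply/funext => w; rewrite !big_ord_recl big_ord0 /= addr0.
  by apply=> k; case: ifP => _; exact: eL2.
have EX : ('E_P[X] = 0)%E.
  rewrite expectationD; last 2 first.
    by apply: (Lfun_subset12 (fin_num_measure _ _ _)).
    by apply: (Lfun_subset12 (fin_num_measure _ _ _)).
  have E1 c k : D k -> ('E_P[c *: w_ k] = 0)%E.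
    move=> Dk; have -> : c *: w_ k = c \o* w_ k.
      by apply/funext => w /=; rewrite mulrC.
    rewrite expectationZl ?wn_coord_mean ?mule0//.
    by apply: (Lfun_subset12 (fin_num_measure _ _ _)) => //; exact: wn_coord_L2.
  by rewrite !E1// adde0.
have VX : ('E_P[fun w => (X w * X w)%R] = (a ^+ 2 + b ^+ 2)%:E)%E.
  rewrite unlock; have -> : a ^+ 2 + b ^+ 2 = dotf P X X.
    rewrite dotfDl// !dotfDr// !dotfZl// !dotfZr// !wn_coord_dot// !eqxx.
    have ji := ij; rewrite eq_sym in ji.
    by rewrite (negbTE ij) (negbTE ji) /=; ring.
  by rewrite -dotf_sqrE.
have := centered_gaussian_exp (Lfun2_meas X2) gX EX VX 1.
by rewrite expr1n mul1r; under eq_integral => w _ do rewrite mul1r.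
Qed.

Lemma wn_coord_exp i (a : R) : D i ->
  (\int[P]_w (expR (a * w_ i w))%:E = (expR (a ^+ 2 / 2))%:E)%E.
Proof.
move=> Di; have gX : gaussian P (w_ i).
  have := @wn_gaussian _ _ _ _ _ hW 1 (fun k => 1) (fun k => e i).
  have -> : (fun w => \sum_(k < 1) 1 * W (e i) w) = w_ i.
    by apply/funext => w; rewrite !big_ord_recl big_ord0 /= addr0 mul1r.
  by apply=> k; exact: eL2.
have := centered_gaussian_exp (wn_coord_meas Di) gX (wn_coord_mean Di)
  (wn_coord_cov Di Di) a.
by rewrite eqxx mulr1.
Qed.

Lemma wn_coord_exp2 i (a : R) : D i ->
  (\int[P]_w (exp2 a (w_ i w))%:E = (2 * expR (a ^+ 2 / 2))%:E)%E.
Proof.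
move=> Di; rewrite (@integral_exp2 _ _ _ _ _ (fun a => expR (a ^+ 2 / 2))).
- by rewrite sqrrN mulr_natl mulr2n.
- exact: wn_coord_meas.
- by move=> u; exact: wn_coord_exp.
Qed.

Let integral_exp2_sqr i a : D i -> (\int[P]_w (exp2 a (w_ i w) ^+ 2)%:E =
  (2 + 2 * expR (2 * a ^+ 2))%:E)%E.
Proof.
move=> Di; transitivity (\int[P]_w ((2%:E + (exp2 (2 * a) (w_ i w))%:E)))%E.
  apply: eq_integral => w _; rewrite -EFinD; congr (_%:E).
  rewrite /exp2 sqrrD -!expRM_natl -expRD subrr expR0 mulrN !mulrA.
  by rewrite addrAC addrC.
rewrite ge0_integralD//=; last 2 first.
- by move=> w _; rewrite lee_fin ltW// exp2_gt0.
- by apply/measurable_EFinP; apply: measurable_exp2; exact: wn_coord_meas.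
rewrite integral_cst//= probability_setT mule1 wn_coord_exp2// -EFinD.
by congr (_ + _ * expR _)%:E; field.
Qed.

Lemma wn_exp2_L2 i a : D i -> (fun w => exp2 a (w_ i w)) \in Lfun P 2%:E.
Proof.
move=> Di; apply/Lfun2P; rewrite integral_exp2_sqr// ltry; split=> //.
by apply: measurable_exp2; exact: wn_coord_meas.
Qed.

Lemma wn_exp2_dot i a : D i ->
  dotf P (fun w => exp2 a (w_ i w)) (fun w => exp2 a (w_ i w)) =
  2 + 2 * expR (2 * a ^+ 2).
Proof.
move=> Di; apply: EFin_inj; rewrite -dotf_sqrE ?integral_exp2_sqr//.
exact: wn_exp2_L2.
Qed.

Lemma wn_exp2_dot_neq i j a b : D i -> D j -> i != j ->
  dotf P (fun w => exp2 a (w_ i w)) (fun w => exp2 b (w_ j w)) =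
  (2 * expR (a ^+ 2 / 2)) * (2 * expR (b ^+ 2 / 2)).
Proof.
move=> Di Dj ij.
have mi := wn_coord_meas Di; have mj := wn_coord_meas Dj.
have mE u v : measurable_fun setT (fun w => (expR (u * w_ i w + v * w_ j w))%:E).
  apply/measurable_EFinP; apply: measurableT_comp => //.
  by apply: measurable_funD; apply: measurable_funM.
have E0 u v w : setT w -> (0 <= (expR (u * w_ i w + v * w_ j w))%:E)%E.
  by move=> _; rewrite lee_fin expR_ge0.
rewrite /dotf /Rintegral.
have -> : (\int[P]_w (exp2 a (w_ i w) * exp2 b (w_ j w))%:E =
  \int[P]_w ((expR (a * w_ i w + b * w_ j w))%:E +
   ((expR (- a * w_ i w + b * w_ j w))%:E +
   ((expR (a * w_ i w + - b * w_ j w))%:E +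
    (expR (- a * w_ i w + - b * w_ j w))%:E))))%E.
  apply: eq_integral => w _; rewrite -!EFinD; congr (_%:E).
  by rewrite /exp2 !expRD !mulNr; ring.
rewrite !ge0_integralD//=; try by [move=> w _; rewrite ?adde_ge0 ?E0|];
  try by do ?apply: emeasurable_funD.
rewrite !wn_pair_exp// -!EFinD /= !sqrrN mulrDl expRD; ring.
Qed.

Definition centered_exp2 (t : I -> R) i : T -> R :=
  (fun w => exp2 (t i) (w_ i w)) - cst (2 * expR (t i ^+ 2 / 2)).

Lemma centered_exp2_L2 t i : D i -> centered_exp2 t i \in Lfun P 2%:E.
Proof. by move=> Di; apply: Lfun2B; [exact: wn_exp2_L2|exact: Lfun_cst]. Qed.

Lemma dotf_exp2_cst i a c : D i ->
  dotf P (fun w => exp2 a (w_ i w)) (cst c) = c * (2 * expR (a ^+ 2 / 2)).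
Proof.
move=> Di; rewrite /dotf; under eq_Rintegral => w _ do rewrite mulrC.
rewrite RintegralZl//; first by rewrite /Rintegral wn_coord_exp2.
apply/integrableP; split.
  by apply/measurable_EFinP; apply: measurable_exp2; exact: wn_coord_meas.
under eq_integral => w _ do rewrite /= ger0_norm ?ltW ?exp2_gt0//.
by rewrite wn_coord_exp2// ltry.
Qed.

Lemma dotf_cst c c' : dotf P (cst c) (cst c' : T -> R) = c * c'.
Proof.
have := @Rintegral_cst _ _ _ P setT measurableT (c * c').
by rewrite [X in fine X](@probability_setT _ _ _ P) /= mulr1.
Qed.

Lemma centered_exp2_dot t i j : D i -> D j -> i != j ->
  dotf P (centered_exp2 t i) (centered_exp2 t j) = 0.
Proof.
move=> Di Dj ij; rewrite /centered_exp2.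
set f := (fun w : T => exp2 (t i) _); set g := (fun w : T => exp2 (t j) _).
set ci := 2 * _; set cj := 2 * _.
have fL : f \in Lfun P 2%:E by exact: wn_exp2_L2.
have gL : g \in Lfun P 2%:E by exact: wn_exp2_L2.
have cL c : cst c \in Lfun P 2%:E by exact: Lfun_cst.
have NE c : - cst c = cst (- c) :> (T -> R) by [].
have fg : dotf P f g = ci * cj by exact: wn_exp2_dot_neq.
have fc c : dotf P f (cst c) = c * ci by exact: dotf_exp2_cst.
have gc c : dotf P (cst c) g = c * cj by rewrite dotfC; exact: dotf_exp2_cst.
rewrite !NE dotfDl//; last exact: Lfun2D.
rewrite (dotfDr gL (cL _) fL) (dotfDr gL (cL _) (cL _)) fg fc gc dotf_cst; ring.
Qed.

Lemma centered_exp2_sqr t i : D i ->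
  dotf P (centered_exp2 t i) (centered_exp2 t i) <= 4 * expR (2 * t i ^+ 2).
Proof.
move=> Di; rewrite /centered_exp2.
rewrite dotfBB; [|exact: wn_exp2_L2|exact: Lfun_cst].
rewrite wn_exp2_dot// dotf_exp2_cst// dotf_cst.
have := expR_ge1Dx (2 * t i ^+ 2); have := sqr_ge0 (t i).
have := sqr_ge0 (2 * expR (t i ^+ 2 / 2)).
move: (expR _) (2 * expR _) => E c; nra.
Qed.

(** Distinct coordinates are uncorrelated, even after application of the
    functions [exp2 t], because all the exponential moments factor. *)
Lemma noise_variance (q : seq I) (a t : I -> R) : uniq q ->
  (forall i, i \in q -> D i) ->
  let X := \sum_(i <- q) a i *: centered_exp2 t i in
  X \in Lfun P 2%:E /\
  (\int[P]_w (X w ^+ 2)%:E <=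
     (\sum_(i <- q) 4 * (a i ^+ 2 * expR (2 * t i ^+ 2)))%:E)%E.
Proof.
move=> uq qD X; have XL : X \in Lfun P 2%:E.
  rewrite /X big_seq; apply: Lfun2_sum => i /qD Di.
  by apply: Lfun2Z; exact: centered_exp2_L2.
split=> //; rewrite dotf_sqrE// lee_fin /X dotf_orthogonal//.
- rewrite big_seq [leRHS]big_seq; apply: ler_sum => i iq.
  rewrite mulrCA -expr2 ler_wpM2l ?sqr_ge0//.
  by apply: centered_exp2_sqr; exact: qD.
- by move=> i /qD; exact: centered_exp2_L2.
- by move=> i j /qD Di /qD Dj; exact: centered_exp2_dot.
Qed.

End white_noise_coordinates.

(** * Wavelet indices by levels *)

Section levels.

Definition levels (L : nat) : seq coef_index :=
  None :: [seq Some (j, k) | j <- iota 0 L, k <- iota 0 (2 ^ j)].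

Lemma mem_levels L i : (i \in levels L) =
  if i is Some (j, k) then (j < L)%N && (k < 2 ^ j)%N else true.
Proof.
case: i => [[j k]|]; rewrite /levels inE//=.
apply/allpairsPdep/idP => [[j' [k' []]]|/andP[jL k2]].
  by rewrite !mem_iota /= !add0n => j'L k'2 [-> ->]; rewrite j'L.
by exists j, k; rewrite !mem_iota /= !add0n.
Qed.

Lemma levels_uniq L : uniq (levels L).
Proof.
rewrite /levels /=; apply/andP; split.
  by apply/negP => /allpairsPdep[j [k []]].
apply: allpairs_uniq_dep; first exact: iota_uniq.
  by move=> j _; exact: iota_uniq.
by move=> [j k] [j' k'] _ _ /= [-> ->].
Qed.

Lemma levels_dyadic L i : i \in levels L -> with_scaling dyadic i.
Proof.
rewrite mem_levels; case: i => [[j k]|_]; last by left.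
by move=> /andP[_ k2]; right; exists (j, k).
Qed.

Lemma big_levels (V : nmodType) L (Q : pred coef_index) F :
  \sum_(i <- levels L | Q i) F i = (if Q None then F None else 0) +
   \sum_(0 <= j < L) \sum_(0 <= k < 2 ^ j | Q (Some (j, k))) F (Some (j, k)) :> V.
Proof.
rewrite /levels big_cons big_mkcond /= big_allpairs_dep /=.
rewrite /index_iota subn0 [in RHS](eq_bigr (fun j =>
  \sum_(k <- iota 0 (2 ^ j)) if Q (Some (j, k)) then F (Some (j, k)) else 0)).
  by case: ifP => // _; rewrite add0r.
by move=> j _; rewrite subn0 big_mkcond.
Qed.

End levels.

Section series_bounds.
Variable R : realType.

(** Comparison with the integral of the power, in the form of a telescoping
    bound. *)
Lemma sum_powR_bounded (p : R) : 1 < p ->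
  forall n, \sum_(0 <= l < n) l.+1%:R `^ (- p) <= 1 + (p - 1)^-1.
Proof.
move=> p1; have p10 : 0 < p - 1 by rewrite subr_gt0.
have step n : n.+2%:R `^ (- p) <=
    (n.+1%:R `^ (1 - p) - n.+2%:R `^ (1 - p)) / (p - 1) :> R.
  rewrite ler_pdivlMr// lerBrDl.
  pose x : R := n.+1%:R / n.+2%:R; have x0 : 0 < x by rewrite divr_gt0.
  have -> : n.+1%:R `^ (1 - p) = n.+2%:R `^ (1 - p) * x `^ (1 - p) :> R.
    by rewrite -powRM ?(ltW x0)// mulrC /x divfK// pnatr_eq0.
  have -> : n.+2%:R `^ (- p) = n.+2%:R `^ (1 - p) / n.+2%:R :> R.
    rewrite powRD; last by rewrite pnatr_eq0 implybT.
    by rewrite powRr1// mulrAC divff ?mul1r.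
  rewrite -mulrA -[X in X + _]mulr1 -mulrDr ler_wpM2l ?powR_ge0//.
  rewrite /powR gt_eqF//; apply: le_trans (expR_ge1Dx _); rewrite lerD2l.
  have : ln x <= - n.+2%:R^-1.
    have -> : x = 1 + - n.+2%:R^-1.
      have n2 : n.+2%:R != 0 :> R by rewrite pnatr_eq0.
      apply: (mulIf n2); rewrite divfK// mulrDl mulNr mulVf// mul1r.
      by rewrite -[n.+2%:R]natr1 addrK.
    apply: le_ln1Dx; rewrite ltrN2 invf_lt1// ?ltr1n//.
  by move: (ln x) (n.+2%:R^-1) => y z h; nra.
have claim n : \sum_(0 <= l < n.+1) l.+1%:R `^ (- p) <=
    1 + (1 - n.+1%:R `^ (1 - p)) / (p - 1).
  elim: n => [|n IH]; first by rewrite big_nat1 !powR1 subrr mul0r addr0.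
  rewrite big_nat_recr//=; apply: le_trans (lerD IH (step n)) _.
  by rewrite -addrA -mulrDl addrA subrK.
case=> [|n]; first by rewrite big_nil addr_ge0// invr_ge0 ltW.
apply: (le_trans (claim n)).
by rewrite lerD2l ler_pdivrMr// mulVf ?gt_eqF// gerBl powR_ge0.
Qed.

(** Energies of level-dependent weights which decrease like [4 ^- l] beyond the
    level [J], while the number of coefficients per level grows like [2 ^ l]. *)
Lemma sum_levels_geometric L J (M : R) (g : coef_index -> R) : 0 <= M ->
  g None <= M ->
  (forall j k, (j < J)%N -> g (Some (j, k)) <= M) ->
  (forall j k, (J <= j)%N -> g (Some (j, k)) <= M * 4 ^- (j - J).+1) ->
  \sum_(i <- levels L) g i <= 2 * M * 2 ^+ J.
Proof.
move=> M0 gN g1 g2.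
pose h j : R := if (j < J)%N then 2 ^+ j else 2 ^+ j * 4 ^- (j - J).+1.
have hsum : 1 + \sum_(0 <= j < L) h j <= 2 * 2 ^+ J.
  have low l : (l <= J)%N -> 1 + \sum_(0 <= j < l) h j = 2 ^+ l.
    elim: l => [|l IH] lJ; first by rewrite big_nil addr0 expr0.
    rewrite big_nat_recr//= addrA IH ?(ltnW lJ)// /h lJ exprS.
    by rewrite mulr_natl mulr2n.
  have high m : 1 + \sum_(0 <= j < J + m) h j = 2 ^+ J * (1 + (1 - 2 ^- m) / 2).
    elim: m => [|m IH].
      by rewrite addn0 low// expr0 invr1 subrr mul0r addr0 mulr1.
    rewrite addnS big_nat_recr//= addrA IH /h ltnNge leq_addr /= addKn.
    have -> : 4 = 2 ^+ 2 :> R by ring.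
    rewrite -exprM exprD mul2n -addnn exprD !exprS.
    by field; rewrite expf_neq0.
  have [LJ|/ltnW JL] := leqP L J.
    rewrite low//; apply: (@le_trans _ _ (2 ^+ J)).
      by rewrite ler_weXn2l// ler1n.
    by rewrite ler_peMl ?exprn_ge0// ler1n.
  rewrite -(subnKC JL) high mulrC ler_wpM2r ?exprn_ge0//.
  have : 0 <= 2 ^- (L - J) :> R by rewrite invr_ge0 exprn_ge0.
  lra.
rewrite big_levels /= (_ : 2 * M * 2 ^+ J = M * (2 * 2 ^+ J)); last by ring.
apply: le_trans (_ : M * (1 + \sum_(0 <= j < L) h j) <= _); last exact: ler_wpM2l.
rewrite mulrDr mulr1 lerD// mulr_sumr ler_sum_nat// => j _.
apply: (@le_trans _ _ (\sum_(0 <= k < 2 ^ j)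
   (M * (if (j < J)%N then 1 else 4 ^- (j - J).+1)))).
  apply: ler_sum => k _; case: ltnP => jJ; last exact: g2.
  by rewrite mulr1 g1.
rewrite sumr_const_nat subn0 /h -[_ *+ (2 ^ j)%N]mulr_natr natrX -mulrA.
by case: ifP => _; rewrite ?mul1r// [_ * 2 ^+ j]mulrC.
Qed.

End series_bounds.

(** * Noise of the hybrid models *)

Section hybrid_noise.
Variable R : realType.

Definition level_card (A : set coef_index) (j : nat) : R :=
  \sum_(0 <= k < 2 ^ j | Some (j, k) \in A) 1.

(** Beyond the level [J] a squared coefficient [x ^ 2] is bounded by a threshold
    [hybrid_thr] plus an excess [hybrid_amp * exp2 hybrid_temp x].  The
    threshold grows only linearly with the distance to [J], yet the expectation
    of the excess decays faster than the number of coefficients per level grows: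
    with [hybrid_temp ^ 2 = 2 l] the amplitude [exp (- 4 l)] beats the moment
    [exp l] of [exp2].  Below the level [J], with only [2 ^ J] coefficients, the
    threshold is 0. *)
Definition hybrid_temp (J : nat) (i : coef_index) : R :=
  if i is Some (j, _) then
    if (J <= j)%N then Num.sqrt (2 * (j - J).+1%:R) else 1
  else 1.

Definition hybrid_amp (J : nat) (i : coef_index) : R :=
  if i is Some (j, _) then
    if (J <= j)%N then 6 * expR (- 4 * (j - J).+1%:R) else 1
  else 1.

Definition hybrid_thr (J : nat) (i : coef_index) : R :=
  if i is Some (j, _) then
    if (J <= j)%N then 8 * (j - J).+1%:R else 0
  else 0.

Lemma hybrid_amp_ge0 J i : 0 <= hybrid_amp J i.
Proof.
by case: i => [[j k]|]//=; case: ifP => // _; rewrite mulr_ge0 ?expR_ge0.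
Qed.

Lemma sqr_le_hybrid J i (x : R) :
  x ^+ 2 <= hybrid_thr J i + hybrid_amp J i * exp2 (hybrid_temp J i) x.
Proof.
have base : x ^+ 2 <= 0 + 1 * exp2 1 x.
  by have := exp2_ge 1 x; rewrite add0r mul1r expr1n mul1r; lra.
case: i => [[j k]|] //=; case: ifP => // Jj.
set l : R := (j - J).+1%:R; have l1 : 1 <= l by rewrite ler1n.
have t2 : Num.sqrt (2 * l) ^+ 2 = 2 * l by rewrite sqr_sqrtr//; lra.
have t1 : 1 <= Num.sqrt (2 * l) by rewrite -[leLHS]sqrtr1 ler_sqrt//; lra.
have := sqr_le_exp2 x t1; rewrite t2.
have -> : 4 * (2 * l) = 8 * l by ring.
by have -> : - 2 * (2 * l) = - 4 * l by ring.
Qed.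

Lemma expRN_le4 (a : R) l : 3 <= a -> expR (- a * l.+1%:R) <= 4 ^- l.+1.
Proof.
move=> a3; rewrite mulrC expRM_natl -exprVn lerXn2r ?nnegrE ?expR_ge0 ?invr_ge0//.
rewrite expRN lef_pV2 ?posrE ?expR_gt0//; apply: le_trans (expR_ge1Dx _).
lra.
Qed.

Lemma hybrid_mean_le L J :
  \sum_(i <- levels L) hybrid_amp J i * (2 * expR (hybrid_temp J i ^+ 2 / 2))
    <= 2 * (12 + 2 * expR 1) * 2 ^+ J :> R.
Proof.
have e0 := expR_gt0 (1 : R).
have he : 1 * (2 * expR (1 ^+ 2 / 2)) <= 12 + 2 * expR 1 :> R.
  have : expR (1 ^+ 2 / 2) <= expR 1 :> R by rewrite ler_expR expr1n; lra.
  lra.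
have M0 : 0 <= 12 + 2 * expR 1 :> R by lra.
apply: sum_levels_geometric; [exact: M0|exact: he| |] => j k.
  by move=> jJ; rewrite /= leqNgt jJ.
move=> Jj; rewrite /= Jj sqr_sqrtr; last by rewrite mulr_ge0.
set l : R := (j - J).+1%:R.
have -> : 6 * expR (- 4 * l) * (2 * expR (2 * l / 2)) = 12 * expR (- 3 * l).
  have -> : - 3 * l = - 4 * l + 2 * l / 2 by field.
  by rewrite expRD; ring.
by apply: ler_pM; rewrite ?expR_ge0 ?expRN_le4//; lra.
Qed.

Lemma hybrid_variance_le L J :
  \sum_(i <- levels L)
      4 * (hybrid_amp J i ^+ 2 * expR (2 * hybrid_temp J i ^+ 2))
    <= 2 * (144 + 4 * expR 2) * 2 ^+ J :> R.
Proof.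
have e0 := expR_gt0 (2 : R).
have he : 4 * (1 ^+ 2 * expR (2 * 1 ^+ 2)) <= 144 + 4 * expR 2 :> R.
  by rewrite !expr1n mul1r mulr1; lra.
have M0 : 0 <= 144 + 4 * expR 2 :> R by lra.
apply: sum_levels_geometric; [exact: M0|exact: he| |] => j k.
  by move=> jJ; rewrite /= leqNgt jJ.
move=> Jj; rewrite /= Jj sqr_sqrtr; last by rewrite mulr_ge0.
set l : R := (j - J).+1%:R.
have -> : 4 * ((6 * expR (- 4 * l)) ^+ 2 * expR (2 * (2 * l))) =
    144 * expR (- 4 * l).
  have -> : expR (2 * (2 * l)) = (expR (- 4 * l))^-1.
    by rewrite -expRN; congr expR; ring.
  by field; rewrite gt_eqF ?expR_gt0.
by apply: ler_pM; rewrite ?expR_ge0 ?expRN_le4//; lra.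
Qed.

(** The exponent [2 < theta] makes the thresholds, which grow linearly with the
    level, summable against the cardinalities of a hybrid model: the size of
    the family of models costs no logarithmic factor. *)
Lemma hybrid_thr_sum_le (theta : R) L J (A : set coef_index) :
  2 < theta ->
  (forall j, (J <= j < L)%N ->
    level_card A j <= 2 ^+ J * (j - J + 1)%:R `^ (- theta)) ->
  \sum_(i <- levels L | i \in A) hybrid_thr J i
    <= 8 * (1 + (theta - 2)^-1) * 2 ^+ J.
Proof.
move=> th2 hA; rewrite big_levels /= if_same add0r.
pose Z : R := 1 + (theta - 2)^-1.
have Z0 : 0 <= Z by rewrite addr_ge0// invr_ge0; lra.
have lev j : (J <= j < L)%N ->
    \sum_(0 <= k < 2 ^ j | Some (j, k) \in A) hybrid_thr J (Some (j, k)) <=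
    8 * 2 ^+ J * (j - J).+1%:R `^ (- (theta - 1)).
  move=> JjL; have := hA j JjL; case/andP: JjL => Jj _.
  rewrite /= Jj -[8 * _]mulr1 -mulr_sumr -/(level_card A j) addn1.
  set l : R := (j - J).+1%:R => h.
  have l0 : 0 < l by rewrite ltr0n.
  have -> : l `^ (- (theta - 1)) = l * l `^ (- theta).
    rewrite opprB powRD; last by rewrite (gt_eqF l0) implybT.
    by rewrite powRr1// ltW.
  have -> : 8 * 2 ^+ J * (l * l `^ (- theta)) = 8 * l * (2 ^+ J * l `^ (- theta)).
    by ring.
  by rewrite ler_wpM2l// mulr_ge0// ltW.
have low l : (l <= J)%N -> \sum_(0 <= j < l)
    \sum_(0 <= k < 2 ^ j | Some (j, k) \in A) hybrid_thr J (Some (j, k)) = 0.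
  move=> lJ; rewrite big_nat big1// => j /andP[_ jl].
  by rewrite /= leqNgt (leq_trans jl lJ)/= big1.
have [LJ|/ltnW JL] := leqP L J.
  by rewrite low// mulr_ge0 ?exprn_ge0// mulr_ge0.
rewrite (@big_cat_nat _ _ _ J)//= low// add0r.
apply: le_trans (_ : \sum_(J <= j < L)
   8 * 2 ^+ J * (j - J).+1%:R `^ (- (theta - 1)) <= _).
  by apply: ler_sum_nat => j; exact: lev.
rewrite -mulr_sumr -[X in \sum_(X <= _ < _) _]add0n big_addn.
under eq_bigr => j _ do rewrite addnK.
rewrite [leRHS]mulrAC ler_wpM2l ?mulr_ge0 ?exprn_ge0//.
rewrite (_ : theta - 2 = (theta - 1) - 1); last by ring.
by apply: sum_powR_bounded; lra.
Qed.

End hybrid_noise.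

(** A uniform bound for the noise of all the hybrid models at the level [J]: up
    to a constant multiple of their dimension it is dominated by one random
    variable whose variance is of the order of this dimension. *)
Lemma hybrid_noise (R : realType) (theta : R) : 2 < theta ->
  exists2 C : R, 0 < C & forall d (T : measurableType d) (P : probability T R)
    (W : (R -> R) -> T -> R) (e : coef_index -> R -> R),
  white_noise P W ->
  (forall i, with_scaling dyadic i -> L2 (mu01 R) (e i)) ->
  (forall i j, with_scaling dyadic i -> with_scaling dyadic j ->
     inner (mu01 R) (e i) (e j) = (i == j)%:R) ->
  forall L J, exists X : T -> R,
    [/\ measurable_fun setT X,
      (\int[P]_w (X w ^+ 2)%:E <= (C * 2 ^+ J)%:E)%E &
      forall (A : set coef_index) w,
        (forall j, (J <= j < L)%N ->
          level_card R A j <= 2 ^+ J * (j - J + 1)%:R `^ (- theta)) ->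
        \sum_(i <- levels L | i \in A) W (e i) w ^+ 2 <= C * 2 ^+ J + X w].
Proof.
move=> th2.
pose c1 : R := 8 * (1 + (theta - 2)^-1).
pose c2 : R := 2 * (12 + 2 * expR 1).
pose c3 : R := 2 * (144 + 4 * expR 2).
have c10 : 0 < c1 by rewrite mulr_gt0// addr_gt0// invr_gt0; lra.
have c20 : 0 < c2 by have := expR_gt0 (1 : R); rewrite /c2; lra.
have c30 : 0 < c3 by have := expR_gt0 (2 : R); rewrite /c3; lra.
exists (c1 + c2 + c3); first by rewrite !addr_gt0.
move=> d T P W e hW eL2 eo L J.
have lD i : i \in levels L -> with_scaling dyadic i by exact: levels_dyadic.
have [XL XV] := noise_variance hW eL2 eo (hybrid_amp R J) (hybrid_temp R J)
  (levels_uniq L) lD.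
set X := \sum_(i <- levels L) _ in XL XV; exists X; split.
- exact: Lfun2_meas XL.
- apply: le_trans XV _; rewrite lee_fin.
  apply: (le_trans (hybrid_variance_le R L J)).
  by rewrite ler_wpM2r ?exprn_ge0// -/c3 lerDr addr_ge0// ltW.
move=> A w hA.
have -> : X w = \sum_(i <- levels L) hybrid_amp R J i *
      exp2 (hybrid_temp R J i) (W (e i) w) -
    \sum_(i <- levels L) hybrid_amp R J i * (2 * expR (hybrid_temp R J i ^+ 2 / 2)).
  rewrite -sumrB /X fct_sumE; apply: eq_bigr => i _.
  by rewrite -mulrBr.
have h1 : \sum_(i <- levels L | i \in A) W (e i) w ^+ 2 <=
    \sum_(i <- levels L | i \in A) hybrid_thr R J i +
    \sum_(i <- levels L | i \in A) hybrid_amp R J i *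
      exp2 (hybrid_temp R J i) (W (e i) w).
  by rewrite -big_split/=; apply: ler_sum => i _; exact: sqr_le_hybrid.
have h2 : \sum_(i <- levels L | i \in A) hybrid_amp R J i *
      exp2 (hybrid_temp R J i) (W (e i) w) <=
    \sum_(i <- levels L) hybrid_amp R J i *
      exp2 (hybrid_temp R J i) (W (e i) w).
  rewrite big_mkcond /=; apply: ler_sum => i _; case: ifP => // _.
  by rewrite mulr_ge0 ?hybrid_amp_ge0// ltW// exp2_gt0.
have h3 := hybrid_mean_le R L J; have h4 := hybrid_thr_sum_le th2 hA.
have p0 : 0 < 2 ^+ J :> R by rewrite exprn_gt0.
rewrite -/c1 -/c2 in h3 h4 *; have := mulr_gt0 c30 p0.
rewrite !mulrDl; lra.
Qed.

(** * Oracle inequalities *)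

Section oracle.
Variables (R : realType) (I : eqType) (q : seq I) (beta eps : I -> R).
Variables (S2 p : R) (a b : pred I) (Da Db : R).
Hypothesis bessel : \sum_(i <- q) beta i ^+ 2 <= S2.
Hypothesis p0 : 0 <= p.
Hypothesis Da0 : 0 <= Da.
Hypothesis Db0 : 0 <= Db.

(* [a] is selected, [b] is any other model *)
Hypothesis sel :
  \sum_(i <- q | b i) (beta i + eps i) ^+ 2 - p * Db <=
  \sum_(i <- q | a i) (beta i + eps i) ^+ 2 - p * Da.

Let sum_sqr_ge0 (c : pred I) (x : I -> R) : 0 <= \sum_(i <- q | c i) x i ^+ 2.
Proof. by apply: sumr_ge0 => i _; exact: sqr_ge0. Qed.

Let splitab (x : I -> R) :
  \sum_(i <- q | a i) x i ^+ 2 = \sum_(i <- q | a i && b i) x i ^+ 2 +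
  \sum_(i <- q | a i && ~~ b i) x i ^+ 2.
Proof. by rewrite (bigID b). Qed.

Let splitba (x : I -> R) :
  \sum_(i <- q | b i) x i ^+ 2 = \sum_(i <- q | a i && b i) x i ^+ 2 +
  \sum_(i <- q | b i && ~~ a i) x i ^+ 2.
Proof.
by rewrite (bigID a); congr (_ + _); apply: eq_bigl => i; rewrite andbC.
Qed.

Let bessel3 : \sum_(i <- q | a i && b i) beta i ^+ 2 +
  \sum_(i <- q | a i && ~~ b i) beta i ^+ 2 +
  \sum_(i <- q | b i && ~~ a i) beta i ^+ 2 <= S2.
Proof.
rewrite -splitab; apply: le_trans bessel; rewrite [leRHS](bigID a)/= lerD2l.
rewrite [leRHS](bigID b)/= (eq_bigl (fun i => ~~ a i && b i)); last first.
  by move=> i; rewrite andbC.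
by rewrite lerDl sum_sqr_ge0.
Qed.

(** Only the noise on the symmetric difference of [a] and [b] matters, and it
    is absorbed by the penalties because their fraction [1 / 12] is small. *)
Lemma oracle_upper (Z : R) :
  \sum_(i <- q | a i) eps i ^+ 2 <= p * Da / 12 + Z ->
  \sum_(i <- q | b i) eps i ^+ 2 <= p * Db / 12 + Z ->
  S2 - \sum_(i <- q | a i) beta i ^+ 2 + \sum_(i <- q | a i) eps i ^+ 2 <=
  2 * (S2 - \sum_(i <- q | b i) beta i ^+ 2 + p * Db) + 13 * Z.
Proof.
have h1 : \sum_(i <- q | a i && ~~ b i) (beta i + eps i) ^+ 2 <=
    5 / 4 * \sum_(i <- q | a i && ~~ b i) beta i ^+ 2 +
    5 * \sum_(i <- q | a i && ~~ b i) eps i ^+ 2.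
  rewrite !mulr_sumr -big_split /=; apply: ler_sum => i _.
  have := sqr_ge0 (beta i / 2 - 2 * eps i); lra.
have h2 : 3 / 4 * \sum_(i <- q | b i && ~~ a i) beta i ^+ 2 <=
    \sum_(i <- q | b i && ~~ a i) (beta i + eps i) ^+ 2 +
    3 * \sum_(i <- q | b i && ~~ a i) eps i ^+ 2.
  rewrite !mulr_sumr -big_split /=; apply: ler_sum => i _.
  have := sqr_ge0 (beta i / 2 + 2 * eps i); lra.
move: sel bessel3.
rewrite !(splitab (fun i => _ i + _ i)) !(splitba (fun i => _ i + _ i)).
rewrite !(splitab beta) !(splitba beta) !(splitab eps) !(splitba eps).
have := sum_sqr_ge0 (fun i => a i && b i) eps.
have := sum_sqr_ge0 (fun i => a i && ~~ b i) eps.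
have := sum_sqr_ge0 (fun i => b i && ~~ a i) eps.
have := sum_sqr_ge0 (fun i => a i && b i) beta.
have := sum_sqr_ge0 (fun i => a i && ~~ b i) beta.
have := sum_sqr_ge0 (fun i => b i && ~~ a i) beta.
have := mulr_ge0 p0 Da0; have := mulr_ge0 p0 Db0.
move: h1 h2 => /=; lra.
Qed.

(** A selected model whose dimension exceeds twice that of [b] has a
    penalty which the bias of [b] must compensate, unless the noise is large;
    since [b] nearly minimizes the criterion with a smaller penalty, it is then
    not much worse than the selected model. *)
Lemma oracle_lower (eta : R) :
  Da <= Db \/ 2 * Db <= Da ->
  \sum_(i <- q | a i) eps i ^+ 2 <= p * Da / 12 -> 0 <= eta ->
  S2 - \sum_(i <- q | b i) beta i ^+ 2 + p / 16 * Db <=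
    S2 - \sum_(i <- q | a i) beta i ^+ 2 + p / 16 * Da + eta ->
  S2 - \sum_(i <- q | b i) beta i ^+ 2 <=
    2 * (S2 - \sum_(i <- q | a i) beta i ^+ 2) + 2 * eta.
Proof.
move=> hD.
have h1 : \sum_(i <- q | a i && ~~ b i) (beta i + eps i) ^+ 2 <=
    2 * \sum_(i <- q | a i && ~~ b i) beta i ^+ 2 +
    2 * \sum_(i <- q | a i && ~~ b i) eps i ^+ 2.
  rewrite !mulr_sumr -big_split /=; apply: ler_sum => i _.
  have := sqr_ge0 (beta i - eps i); lra.
move: sel bessel3.
rewrite !(splitab (fun i => _ i + _ i)) !(splitba (fun i => _ i + _ i)).
rewrite !(splitab beta) !(splitba beta) !(splitab eps).
have := sum_sqr_ge0 (fun i => a i && b i) eps.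
have := sum_sqr_ge0 (fun i => b i && ~~ a i) (fun i => beta i + eps i).
have := sum_sqr_ge0 (fun i => a i && ~~ b i) beta.
have := sum_sqr_ge0 (fun i => b i && ~~ a i) beta.
have pa := mulr_ge0 p0 Da0; have pb := mulr_ge0 p0 Db0.
case: hD => hD; first by have := ler_wpM2l p0 hD; move: h1 => /=; lra.
have := ler_wpM2l p0 hD; rewrite mulrCA; move: h1 => /=; lra.
Qed.

End oracle.

Section expansion.
Variables (R : realType) (I : eqType) (q : seq I) (e : I -> R -> R).
Hypothesis uq : uniq q.
Hypothesis eL2 : forall i, i \in q -> L2 (mu01 R) (e i).
Hypothesis eo : forall i j, i \in q -> j \in q ->
  inner (mu01 R) (e i) (e j) = (i == j)%:R.

Lemma norm2_sqr (f : R -> R) : L2 (mu01 R) f ->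
  norm2 (mu01 R) f ^+ 2 = inner (mu01 R) f f.
Proof.
move=> hf; have hf' : f \in Lfun (mu01 R) 2%:E by [].
have E : ('N[@mu01 R]_2%:E[EFin \o f] `^ 2 = (inner (mu01 R) f f)%:E)%E.
  rewrite powR_Lnorm ?pnatr_eq0// -[inner _ _ _]/(dotf (mu01 R) f f) -dotf_sqrE//.
  apply: eq_integral => x _ /=.
  by rewrite powR_mulrn// -normrX ger0_norm ?sqr_ge0.
have N0 : (0 <= 'N[@mu01 R]_2%:E[EFin \o f])%E by exact: Lnorm_ge0.
rewrite /norm2; move: ('N[_]_ _[_])%E E N0 => [r| |]//=.
- by rewrite lee_fin => -[<-] r0; rewrite powR_mulrn.
- by rewrite pnatr_eq0.
Qed.

(** Parseval in the finite orthonormal family: the loss is the squared bias plus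
    the squared error on the coefficients which are kept. *)
Lemma expansion_loss (s : R -> R) (a : pred I) (y : I -> R) :
  L2 (mu01 R) s ->
  norm2 (mu01 R) (\sum_(i <- q | a i) y i *: e i - s) ^+ 2 =
  inner (mu01 R) s s - \sum_(i <- q | a i) inner (mu01 R) (e i) s ^+ 2 +
  \sum_(i <- q | a i) (y i - inner (mu01 R) (e i) s) ^+ 2.
Proof.
move=> sL; rewrite -big_filter; set qa := [seq i <- q | a i].
have sub i : i \in qa -> i \in q by rewrite mem_filter => /andP[].
have uqa : uniq qa by rewrite filter_uniq.
have ea i : i \in qa -> e i \in Lfun (mu01 R) 2%:E by move=> /sub /eL2.
have eL : \sum_(i <- qa) y i *: e i \in Lfun (mu01 R) 2%:E.
  by rewrite big_seq; apply: Lfun2_sum => i iq; apply: Lfun2Z; exact: ea.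
have Es : dotf (mu01 R) (\sum_(i <- qa) y i *: e i) s =
    \sum_(i <- qa) y i * inner (mu01 R) (e i) s.
  rewrite big_seq dotf_suml//; last by move=> i iq; apply: Lfun2Z; exact: ea.
  rewrite [RHS]big_seq; apply: eq_bigr => i iq; rewrite dotfZl//; exact: ea.
rewrite norm2_sqr; last exact: Lfun2B.
rewrite -[LHS]/(dotf (mu01 R) _ _) dotfBB// Es.
rewrite dotf_orthonormal//; last by move=> i j /sub iq /sub jq; exact: eo.
rewrite -!(big_filter q) -/qa.
have -> : \sum_(i <- qa) (y i - inner (mu01 R) (e i) s) ^+ 2 =
    \sum_(i <- qa) y i * y i - 2 * \sum_(i <- qa) y i * inner (mu01 R) (e i) s
    + \sum_(i <- qa) inner (mu01 R) (e i) s ^+ 2.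
  rewrite mulr_sumr -sumrB -big_split /=; apply: eq_bigr => i _; ring.
rewrite -[dotf (mu01 R) s s]/(inner (mu01 R) s s); ring.
Qed.

Lemma expansion_bessel (s : R -> R) : L2 (mu01 R) s ->
  \sum_(i <- q) inner (mu01 R) (e i) s ^+ 2 <= inner (mu01 R) s s.
Proof.
move=> sL.
have := expansion_loss xpredT (fun i => inner (mu01 R) (e i) s) sL.
rewrite [X in _ = _ + X]big1 ?addr0; last by move=> i _; rewrite subrr expr0n.
by rewrite -subr_ge0 => <-; exact: sqr_ge0.
Qed.

End expansion.

(** * Projections on spans of orthonormal functions *)

Section dimension.
Variable R : realType.

Lemma lin_span_gen n (b : 'I_n -> R -> R) (v : R -> R) :
  lin_span (range b) v -> exists c : 'I_n -> R, v = \sum_(i < n) c i *: b i.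
Proof.
move=> [m [c [g [hg ->]]]].
have /choice[k hk] : forall i : 'I_m, exists k, b k = g i.
  by move=> i; have [k _ <-] := hg i; exists k.
exists (fun j => \sum_(i < m | k i == j) c i).
under [RHS]eq_bigr => j _ do rewrite scaler_suml.
rewrite (exchange_big_dep predT)//=; apply: eq_bigr => i _.
by rewrite (big_pred1 (k i)) ?hk// => j /=; rewrite eq_sym.
Qed.

Lemma mem_lin_span (F : set (R -> R)) v : F v -> lin_span F v.
Proof.
move=> Fv; exists 1%N, (fun _ => 1), (fun _ => v); split => //.
by rewrite big_ord_recl big_ord0 addr0 scale1r.
Qed.

(** Steinitz: a matrix with more rows than columns has a nonzero row kernel. *)
Lemma free_family_le n m (b : 'I_n -> R -> R) (c : 'I_m -> R -> R) :
  free_family b -> (forall i, lin_span (range c) (b i)) -> (n <= m)%N.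
Proof.
move=> fb hb.
have /choice[M hM] : forall i, exists a : 'I_m -> R,
    b i = \sum_(j < m) a j *: c j by move=> i; exact: lin_span_gen.
pose A : 'M[R]_(n, m) := \matrix_(i, j) M i j.
rewrite leqNgt; apply/negP => mn.
have : kermx A != 0.
  by rewrite -mxrank_eq0 mxrank_ker -lt0n subn_gt0 (leq_ltn_trans (rank_leq_col A)).
move=> /rowV0Pn[u /sub_kermxP uA] /negP; apply; apply/eqP/rowP => i.
rewrite mxE; apply: (fb (fun i => u 0 i)).
under eq_bigr => j _ do rewrite hM scaler_sumr.
rewrite exchange_big /= big1// => j _.
under eq_bigr => k _ do rewrite scalerA.
rewrite -scaler_suml; have := congr1 (fun B : 'rV_m => B 0 j) uA.
by rewrite !mxE => h; under eq_bigr => k _ do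
  (rewrite (_ : M k j = A k j); last by rewrite mxE); rewrite h scale0r.
Qed.

Lemma dimension_free n (b : 'I_n -> R -> R) :
  free_family b -> dimension (lin_span (range b)) = n.
Proof.
move=> fb; rewrite /dimension; case: xgetP => [D _ [c [fc cb]]|].
  have sub k l (x : 'I_k -> R -> R) (y : 'I_l -> R -> R) i :
      lin_span (range x) = lin_span (range y) -> lin_span (range y) (x i).
    by move=> <-; apply: mem_lin_span; exists i.
  apply/eqP; rewrite eqn_leq; apply/andP; split.
    by apply: (free_family_le fc) => i; exact: (sub _ _ _ _ _ (esym cb)).
  by apply: (free_family_le fb) => i; exact: (sub _ _ _ _ _ cb).
by move=> /(_ n) []; exists b.
Qed.

End dimension.

Section orthonormal_span.
Variables (R : realType) (I : choiceType) (q : seq I) (e : I -> R -> R).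
Hypothesis uq : uniq q.
Hypothesis eL2 : forall i, i \in q -> L2 (mu01 R) (e i).
Hypothesis eo : forall i j, i \in q -> j \in q ->
  inner (mu01 R) (e i) (e j) = (i == j)%:R.

Let b (k : 'I_(size q)) : R -> R := e (tnth (in_tuple q) k).

Let range_b : e @` [set` q] = range b.
Proof.
apply/seteqP; split=> f.
  move=> [i iq <-]; have := iq; rewrite -[q]/(tval (in_tuple q)) => /tnthP[k ik].
  by exists k => //; rewrite /b -ik.
by move=> [k _ <-]; exists (tnth (in_tuple q) k) => //=; exact: mem_tnth.
Qed.

Lemma lin_span_seqP (f : R -> R) : lin_span (e @` [set` q]) f <->
  exists c : I -> R, f = \sum_(i <- q) c i *: e i.
Proof.
split=> [|[c ->]].
  case E : q => [|i0 q0].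
    move=> [n [c [g [hg ->]]]]; exists (fun=> 0); rewrite big_nil big1// => i _.
    by have [] := hg i.
  rewrite -E range_b => /lin_span_gen[c ->].
  exists (fun i => if insub (index i q) is Some k then c k else 0).
  rewrite [in RHS](big_nth i0) big_mkord; apply: eq_bigr => k _.
  rewrite index_uniq// insubT//= => h; rewrite /b (tnth_nth i0).
  by congr (c _ *: _); exact: val_inj.
exists (size q), (fun k => c (tnth (in_tuple q) k)), b; split.
  by move=> k; rewrite range_b; exists k.
by rewrite big_tnth.
Qed.

Lemma orthonormal_free : free_family b.
Proof.
move=> c h k; pose i := tnth (in_tuple q) k.
have iq : i \in q by exact: mem_tnth.
have := dotf0l (mu01 R) (e i); rewrite -h dotf_suml; last 2 first.
- by move=> l _; apply: Lfun2Z; apply: eL2; exact: mem_tnth.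
- exact: eL2.
rewrite (bigD1 k)//= big1 ?addr0.
  rewrite dotfZl; [|exact: eL2|exact: eL2].
  by rewrite -[dotf _ _ _]/(inner (mu01 R) (e i) (e i)) eo// eqxx mulr1.
move=> l lk; have lq : tnth (in_tuple q) l \in q by exact: mem_tnth.
rewrite dotfZl; [|exact: eL2|exact: eL2].
rewrite -[dotf _ _ _]/(inner (mu01 R) (b l) (e i)) eo//.
case: eqP => [E|_]; last by rewrite mulr0.
case/negP: lk; apply/eqP/val_inj => /=.
apply/eqP; rewrite -(nth_uniq i _ _ uq) ?ltn_ord//.
have El : tnth (in_tuple q) l = nth i q l by exact: tnth_nth.
have Ek : tnth (in_tuple q) k = nth i q k by exact: tnth_nth.
by rewrite -El -Ek; apply/eqP.
Qed.

Lemma dimension_orthonormal : dimension (lin_span (e @` [set` q])) = size q.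
Proof. by rewrite range_b dimension_free//; exact: orthonormal_free. Qed.

Section contrast.
Variable y : (R -> R) -> R.
Hypothesis ly : linear_on_L2 y.

Lemma linear_on_L2_sum (c : I -> R) (r : seq I) : {subset r <= q} ->
  y (\sum_(i <- r) c i *: e i) = \sum_(i <- r) c i * y (e i).
Proof.
elim: r => [|i r IH] rq.
  have L0 : L2 (mu01 R) 0 by exact: Lfun2_0.
  rewrite !big_nil; have := ly 1 L0 L0; rewrite scaler0 addr0 mul1r => h.
  by apply: (addrI (y 0)); rewrite addr0 -h.
rewrite !big_cons ly; first last.
- rewrite big_seq; apply: Lfun2_sum => j jr; apply: Lfun2Z; apply: eL2.
  by apply: rq; rewrite inE jr orbT.
- by apply: eL2; apply: rq; rewrite mem_head.
by rewrite IH// => j jr; apply: rq; rewrite inE jr orbT.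
Qed.

(** The contrast separates into the coefficients, up to a constant; hence the
    minimum contrast estimator keeps the observed coefficients. *)
Lemma contrast_span (c : I -> R) :
  contrast y (\sum_(i <- q) c i *: e i) =
  \sum_(i <- q) (c i - y (e i)) ^+ 2 - \sum_(i <- q) y (e i) ^+ 2.
Proof.
rewrite /contrast linear_on_L2_sum// norm2_sqr; last first.
  by rewrite big_seq; apply: Lfun2_sum => i iq; apply: Lfun2Z; exact: eL2.
rewrite -[inner _ _ _]/(dotf (mu01 R) _ _) dotf_orthonormal//.
rewrite mulr_sumr -big_split -sumrB /=; apply: eq_bigr => i _; ring.
Qed.

Lemma minimum_contrast_proj :
  minimum_contrast y (lin_span (e @` [set` q])) (\sum_(i <- q) y (e i) *: e i).
Proof.
split; first by apply/lin_span_seqP; exists (fun i => y (e i)).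
move=> u /lin_span_seqP[c ->]; rewrite !contrast_span lerD2r.
rewrite big1 ?sumr_ge0// => i _; last by rewrite subrr expr0n.
exact: sqr_ge0.
Qed.

Lemma minimum_contrastE (f : R -> R) :
  minimum_contrast y (lin_span (e @` [set` q])) f ->
  f = \sum_(i <- q) y (e i) *: e i.
Proof.
move=> [/lin_span_seqP[c ->]] /(_ _ (proj1 minimum_contrast_proj)).
rewrite !contrast_span lerD2r [leRHS]big1; last by move=> i _; rewrite subrr expr0n.
move=> h; have /eqP : \sum_(i <- q) (c i - y (e i)) ^+ 2 = 0.
  by apply: le_anti; rewrite h sumr_ge0// => i _; exact: sqr_ge0.
rewrite psumr_eq0; last by move=> i _; exact: sqr_ge0.
move=> /allP hz; apply: eq_big_seq => i /hz /=.
by rewrite sqrf_eq0 subr_eq0 => /eqP ->.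
Qed.

Lemma contrast_proj :
  contrast y (\sum_(i <- q) y (e i) *: e i) = - \sum_(i <- q) y (e i) ^+ 2.
Proof.
by rewrite contrast_span big1 ?add0r// => i _; rewrite subrr expr0n.
Qed.

End contrast.

End orthonormal_span.

(** * Index sets and dimensions of the models *)

Section models.

Definition coefs L (A : set coef_index) :=
  [seq i <- levels L | i \in A].

(** Models are truncated at the maximal level, which may be negative; then only
    the scaling function remains. *)
Definition top_level (j0 : int) : nat := if j0 is Posz l then l else 0%N.

Lemma below_levelE j0 : below_level j0 = [set jk | (jk.1 < top_level j0)%N].
Proof.
apply/seteqP; split=> -[j k]; rewrite /below_level /top_level /=;
  by case: j0 => l /=; rewrite ?ltz_nat.
Qed.

Lemma coefs_uniq L A : uniq (coefs L A).
Proof. by rewrite filter_uniq// levels_uniq. Qed.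

Lemma coefs_dyadic L A i : i \in coefs L A -> with_scaling dyadic i.
Proof. by rewrite mem_filter => /andP[_ /levels_dyadic]. Qed.

Lemma coefs_set (S : set (nat * nat)) L : S `<=` dyadic ->
  [set` coefs L (with_scaling S)] =
  with_scaling (S `&` [set jk | (jk.1 < L)%N]).
Proof.
move=> Sd; apply/seteqP; split=> -[[j k]|] /=.
- rewrite mem_filter mem_levels => /andP[/set_mem[//|[[j' k'] Sjk [jj' kk']]]].
  by move=> /andP[jL _]; subst j' k'; right; exists (j, k).
- by move=> _; left.
- move=> [//|[[j' k'] [Sjk /= jL] [jj' kk']]]; subst j' k'.
  rewrite mem_filter mem_levels jL; apply/andP; split; last exact: (Sd _ Sjk).
  by apply/mem_set; right; exists (j, k).
- by move=> _; rewrite mem_filter mem_levels andbT; apply/mem_set; left.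
Qed.

Lemma size_coefs L A : size (coefs L A) = (\sum_(i <- levels L | i \in A) 1)%N.
Proof. by rewrite -sum1_size big_filter. Qed.

Lemma card_nat_seq (B : set nat) n c : B `<=` `I_n -> (B #= `I_c)%card ->
  (\sum_(0 <= k < n | k \in B) 1)%N = c.
Proof.
move=> Bn Bc; pose s := [seq k <- iota 0 n | k \in B].
have -> : (\sum_(0 <= k < n | k \in B) 1)%N = size s.
  by rewrite /s -sum1_size big_filter /index_iota subn0.
have us : uniq s by rewrite filter_uniq// iota_uniq.
have BE : B = [set` [fset x in s]%fset].
  apply/seteqP; split=> k /=; rewrite !inE mem_filter mem_iota add0n /=.
    by move=> Bk; apply/andP; split; [exact/mem_set|exact: Bn].
  by move=> /andP[/set_mem].
move: Bc; rewrite {1}BE => /card_eq_fsetP.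
by rewrite card_fseq undup_id.
Qed.

End models.

Section hybrid_dimension.
Variables (R : realType) (theta : R).
Hypothesis th2 : 2 < theta.

(** The dimension of the hybrid models before truncation: the [2 ^ J] functions
    below the level [J], and those of the levels [J + l].  From [l = 2 ^ J] on
    the levels are empty. *)
Definition hybrid_size (J : nat) : nat :=
  (2 ^ J + \sum_(0 <= l < 2 ^ J) hybrid_card theta J (J + l))%N.

Lemma hybrid_card_le J j :
  (hybrid_card theta J j)%:R <= 2 ^+ J * (j - J + 1)%:R `^ (- theta).
Proof. by rewrite truncn_le. Qed.

Lemma hybrid_card_eq0 J l : (2 ^ J <= l)%N -> hybrid_card theta J (J + l) = 0%N.
Proof.
move=> lJ; apply/eqP; rewrite -leqn0 truncn_le_nat addKn addn1.
rewrite powRN ltr_pdivrMr ?powR_gt0 ?ltr0n// mul1r.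
apply: (@lt_le_trans _ _ (l.+1%:R)); first by rewrite -natrX ltr_nat ltnS.
apply: le1r_powR; first by rewrite ler1n.
by have := th2; lra.
Qed.

Lemma hybrid_card_succ J l :
  (2 * hybrid_card theta J (J + l) <= hybrid_card theta J.+1 (J.+1 + l))%N.
Proof.
rewrite truncn_ge_nat// natrM !addKn exprS -mulrA ler_wpM2l//.
by have := hybrid_card_le J (J + l); rewrite addKn.
Qed.

Lemma hybrid_size_ge J : (2 ^ J <= hybrid_size J)%N.
Proof. exact: leq_addr. Qed.

Lemma hybrid_size_double J : (2 * hybrid_size J <= hybrid_size J.+1)%N.
Proof.
rewrite /hybrid_size mulnDr -expnS leq_add2l big_distrr /=.
apply: (@leq_trans (\sum_(0 <= l < 2 ^ J) hybrid_card theta J.+1 (J.+1 + l))).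
  by apply: leq_sum => l _; exact: hybrid_card_succ.
have h : (2 ^ J <= 2 ^ J.+1)%N by rewrite leq_exp2l.
by rewrite (@big_cat_nat _ _ _ (2 ^ J) _ (2 ^ J.+1))//= leq_addr.
Qed.

(** Distinct penalties differ by a factor of two at least. *)
Lemma hybrid_size_gap J J' :
  (hybrid_size J' <= hybrid_size J \/ 2 * hybrid_size J <= hybrid_size J')%N.
Proof.
have mono i m : (hybrid_size i <= hybrid_size (i + m))%N.
  elim: m => [|m IH]; first by rewrite addn0.
  rewrite addnS (leq_trans IH)// (leq_trans _ (hybrid_size_double _))//.
  by rewrite leq_pmull.
have [le|lt] := leqP J' J; first by left; rewrite -(subnKC le).
right; rewrite (leq_trans (hybrid_size_double _))// -(subnKC lt); exact: mono.
Qed.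

Lemma hybrid_size_le J :
  (hybrid_size J)%:R <= (2 + (theta - 1)^-1) * 2 ^+ J :> R.
Proof.
rewrite natrD natrX -[2 + _]addrA mulrDl mul1r lerD2l natr_sum.
apply: le_trans (_ : \sum_(0 <= l < 2 ^ J) 2 ^+ J * l.+1%:R `^ (- theta) <= _).
  apply: ler_sum => l _; have := hybrid_card_le J (J + l).
  by rewrite addKn addn1.
rewrite -mulr_sumr mulrC ler_wpM2r ?exprn_ge0//.
by apply: sum_powR_bounded; have := th2; lra.
Qed.

Lemma hybrid_sets_dyadic J S : hybrid_sets theta J S -> S `<=` dyadic.
Proof.
move=> [A [hA ->]] [j k] [[]//|[j' /= Jj' [k' Ak' [<- <-]]]].
by have [/(_ _ Ak')] := hA _ Jj'.
Qed.

Lemma hybrid_sets_card J S j : hybrid_sets theta J S -> (J <= j)%N ->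
  (\sum_(0 <= k < 2 ^ j | Some (j, k) \in with_scaling S) 1)%N =
  hybrid_card theta J j.
Proof.
move=> [A [hA ->]] Jj; have [Aj Ac] := hA _ Jj.
rewrite -(card_nat_seq Aj Ac); apply: eq_bigl => k.
apply/idP/idP => /set_mem.
  move=> [//|[[j1 k1] [[_ /= jJ]|[j' /= Jj' [k' Ak' [? ?]]]] [? ?]]]; subst.
    by move: jJ; rewrite ltnNge Jj.
  exact/mem_set.
move=> Ak; apply/mem_set; right; exists (j, k) => //; right.
by exists j => //; exists k.
Qed.

Lemma size_coefs_hybrid J S L : hybrid_sets theta J S ->
  (J + 2 ^ J <= L)%N -> size (coefs L (with_scaling S)) = hybrid_size J.
Proof.
move=> hS LJ; transitivity (1 + \sum_(0 <= j < L)
    \sum_(0 <= k < 2 ^ j | Some (j, k) \in with_scaling S) 1)%N.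
  by rewrite size_coefs (big_levels _ _ (fun=> 1%N)) mem_set//; left.
have low l : (l <= J)%N -> (1 + \sum_(0 <= j < l)
    \sum_(0 <= k < 2 ^ j | Some (j, k) \in with_scaling S) 1 = 2 ^ l)%N.
  elim: l => [|l IH] lJ; first by rewrite big_nil.
  rewrite big_nat_recr//= addnA IH 1?ltnW// expnS mul2n -addnn; congr addn.
  rewrite -[RHS]subn0 -[RHS]muln1 -sum_nat_const_nat.
  rewrite big_nat_cond [RHS]big_nat; apply: eq_bigl => k.
  rewrite andbC; apply/andb_idl => /andP[_ k2]; apply/mem_set; right.
  by exists (l, k) => //; move: hS => [A [_ ->]]; left.
rewrite (@big_cat_nat _ _ _ J)//= ?(leq_trans (leq_addr _ _) LJ)// addnA low//.
rewrite (@big_cat_nat _ _ _ (J + 2 ^ J) J L)//= ?leq_addr//.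
rewrite [X in (_ + (_ + X))%N]big_nat [X in (_ + (_ + X))%N]big1 ?addn0; last first.
  move=> j /andP[Jj _]; have JJ := leq_trans (leq_addr _ _) Jj.
  by rewrite (hybrid_sets_card hS JJ) -(subnKC JJ) hybrid_card_eq0// leq_subRL.
rewrite /hybrid_size; congr addn.
rewrite -[X in (\sum_(X <= _ < _) _)%N = _]add0n big_addn addKn; apply: eq_bigr => l _.
by rewrite (hybrid_sets_card hS) ?leq_addl// addnC.
Qed.

End hybrid_dimension.

(** * Penalized selection of coefficients *)

Section selection.
Variables (R : realType) (phi psi : R -> R).
Hypothesis hb : wavelet_basis phi psi.

Let e := wavelet phi psi.

Lemma wavelet_L2 i : with_scaling dyadic i -> L2 (mu01 R) (e i).
Proof. by have [h _ _] := hb; exact: h. Qed.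

Lemma wavelet_orthonormal i j : with_scaling dyadic i -> with_scaling dyadic j ->
  inner (mu01 R) (e i) (e j) = (i == j)%:R.
Proof. by have [_ h _] := hb; exact: h. Qed.

Definition coefs_span L A : set (R -> R) := lin_span (e @` [set` coefs L A]).

Lemma wavelet_span_below (S : set (nat * nat)) j0 : S `<=` dyadic ->
  wavelet_span phi psi (S `&` below_level j0) =
  coefs_span (top_level j0) (with_scaling S).
Proof. by move=> Sd; rewrite /coefs_span coefs_set// below_levelE. Qed.

Lemma dimension_coefs_span L A : dimension (coefs_span L A) = size (coefs L A).
Proof.
apply: dimension_orthonormal; first exact: coefs_uniq.
  by move=> i /coefs_dyadic; exact: wavelet_L2.
by move=> i j /coefs_dyadic Di /coefs_dyadic Dj; exact: wavelet_orthonormal.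
Qed.

Lemma dimension_hybrid (theta : R) J S : 2 < theta -> hybrid_sets theta J S ->
  dimension (wavelet_span phi psi S) = hybrid_size theta J.
Proof.
move=> th2 hS; pose L := (J + 2 ^ J)%N.
have Sd := hybrid_sets_dyadic hS.
have <- : S `&` below_level L%:Z = S.
  apply/setIidl => -[j k] Sjk; rewrite below_levelE /=.
  rewrite ltnNge; apply/negP => Lj.
  have Jj := leq_trans (leq_addr _ _) Lj.
  have := hybrid_sets_card hS Jj; rewrite
    -[X in hybrid_card _ _ X](subnKC Jj) hybrid_card_eq0//; last first.
    by rewrite leq_subRL.
  move/eqP; rewrite sum_nat_seq_eq0 => /allP/(_ k).
  rewrite mem_index_iota /= (Sd _ Sjk) => /(_ isT).
  by rewrite mem_set//; right; exists (j, k).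
by rewrite wavelet_span_below// dimension_coefs_span (size_coefs_hybrid th2 hS).
Qed.

Definition coefs_energy L (A : set coef_index) (x : coef_index -> R) : R :=
  \sum_(i <- levels L | i \in A) x i ^+ 2.

(** Among the models [Lab], given by their index sets and dimensions, [A] is
    chosen by the penalized criterion with observed coefficients [x]. *)
Definition selected L (Lab : set coef_index -> R -> Prop) (p : R)
    (x : coef_index -> R) A D :=
  Lab A D /\ forall A' D', Lab A' D' ->
    coefs_energy L A' x - p * D' <= coefs_energy L A x - p * D.

(** A label may overestimate the penalty of its span, as long as each model has
    a label with the exact penalty: a hybrid model arises from several base levels
    [J], and is penalized for the smallest dimension. *)
Lemma penalized_selection_coefs (M : set (set (R -> R))) pen y sh L Lab p :
  linear_on_L2 y -> penalized_selection M pen y sh ->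
  (forall A D, Lab A D -> M (coefs_span L A) /\ pen (coefs_span L A) <= p * D) ->
  (forall m, M m -> exists A D, [/\ Lab A D, m = coefs_span L A & pen m = p * D]) ->
  exists A D, selected L Lab p (y \o e) A D /\
    sh = \sum_(i <- levels L | i \in A) y (e i) *: e i.
Proof.
move=> ly [m Mm [hmin hsel]] hLab hM.
have eL A i : i \in coefs L A -> L2 (mu01 R) (e i).
  by move=> /coefs_dyadic; exact: wavelet_L2.
have eo A i j : i \in coefs L A -> j \in coefs L A ->
    inner (mu01 R) (e i) (e j) = (i == j)%:R.
  by move=> /coefs_dyadic Di /coefs_dyadic Dj; exact: wavelet_orthonormal.
have [A [D [hA mE pE]]] := hM _ Mm; exists A, D.
rewrite mE in hmin.
have shE := minimum_contrastE (coefs_uniq L A) (@eL A) (@eo A) ly hmin.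
split; last by rewrite shE /coefs big_filter.
split=> // A' D' hA'; have [MA' pA'] := hLab _ _ hA'.
have := hsel _ _ MA' (minimum_contrast_proj (coefs_uniq L A') (@eL A') (@eo A') ly).
rewrite shE !(contrast_proj (coefs_uniq L _) (@eL _) (@eo _) ly) pE.
rewrite /coefs !big_filter -/(coefs_energy L A (y \o e)) => h.
rewrite -/(coefs_energy L A' (y \o e)) in h; lra.
Qed.

Definition sieve_label (j0 : int) (A : set coef_index) (D : R) :=
  exists N : nat, [/\ N%:Z < j0,
    A = with_scaling (sieve_set N) & D = 2 ^+ N].

Definition hybrid_label (theta : R) (A : set coef_index) (D : R) :=
  exists J S, [/\ hybrid_sets theta J S, A = with_scaling S &
    D = (hybrid_size theta J)%:R].

Definition large_label (j0 : int) (A : set coef_index) (D : R) :=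
  exists S, [/\ S `<=` dyadic `&` below_level j0, A = with_scaling S &
    D = (size (coefs (top_level j0) A))%:R].

Lemma size_coefs_sieve N L : (N <= L)%N ->
  size (coefs L (with_scaling (sieve_set N))) = (2 ^ N)%N.
Proof.
set A := with_scaling _ => NL.
have AN : None \in A by apply/mem_set; left.
have Ajk j k : (k < 2 ^ j)%N -> (Some (j, k) \in A) = (j < N)%N.
  move=> k2; apply/idP/idP => [/set_mem[//|[[j' k'] [_ /= ?] [<- _]]]//|jN].
  by apply/mem_set; right; exists (j, k).
transitivity (1 + \sum_(0 <= j < L) \sum_(0 <= k < 2 ^ j | Some (j, k) \in A) 1)%N.
  by rewrite size_coefs (big_levels _ _ (fun=> 1%N)) AN.
have inner_sum j : (\sum_(0 <= k < 2 ^ j | Some (j, k) \in A) 1 =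
    if (j < N)%N then 2 ^ j else 0)%N.
  rewrite big_nat_cond (eq_bigl (fun k => (0 <= k < 2 ^ j)%N && (j < N)%N)); last first.
    by move=> k; case: (ltnP k (2 ^ j)) => k2; rewrite ?andbF//= Ajk.
  rewrite -big_nat_cond; case: ifP => _; last by rewrite big_pred0.
  by rewrite sum_nat_const_nat muln1 subn0.
rewrite (@big_cat_nat _ _ _ N)//= [X in (_ + (_ + X))%N]big_nat.
rewrite [X in (_ + (_ + X))%N]big1 ?addn0; last first.
  by move=> j /andP[Nj _]; rewrite inner_sum ltnNge Nj.
have low l : (l <= N)%N -> (1 + \sum_(0 <= j < l)
    \sum_(0 <= k < 2 ^ j | Some (j, k) \in A) 1 = 2 ^ l)%N.
  elim: l => [|l IH] lN; first by rewrite big_nil.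
  by rewrite big_nat_recr//= addnA IH 1?ltnW// inner_sum lN expnS mul2n -addnn.
exact: low.
Qed.

End selection.

Section estimators.
Variables (R : realType) (phi psi : R -> R).
Hypothesis hb : wavelet_basis phi psi.
Variables (N : set nat) (lambda : nat -> R) (j0 : nat -> int).

Let e := wavelet phi psi.
Let span L A := coefs_span phi psi L A.

Lemma nonempty_sieve n :
  nonempty_sizes N (sieve_models phi psi j0) n <-> N n /\ 0 < j0 n.
Proof.
split=> [[Nn [m [k [kj _]]]]|[Nn jn]].
  by split=> //; apply: le_lt_trans kj.
by split=> //; exists (wavelet_span phi psi (sieve_set 0)), 0%N.
Qed.

Lemma sieve_span n k : k%:Z < j0 n ->
  wavelet_span phi psi (sieve_set k) =
  span (top_level (j0 n)) (with_scaling (sieve_set k)).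
Proof.
move=> kj; rewrite /span -wavelet_span_below; last by move=> jk [].
congr (wavelet_span phi psi _); apply/esym/setIidl => jk [_ /= jkk].
by rewrite /below_level /=; apply: lt_trans kj; rewrite ltz_nat.
Qed.

Lemma sieve_selected sh n y :
  sieve_estimator phi psi N lambda j0 sh -> N n -> 0 < j0 n -> linear_on_L2 y ->
  exists A D, selected (top_level (j0 n)) (sieve_label (j0 n)) (lambda n / n%:R)
      (y \o e) A D /\
    sh n y = \sum_(i <- levels (top_level (j0 n)) | i \in A) y (e i) *: e i.
Proof.
move=> [_ hsh] Nn jn ly.
have := hsh n y ((nonempty_sieve n).2 (conj Nn jn)) ly.
have dimE k : k%:Z < j0 n -> model_dimension n
    (span (top_level (j0 n)) (with_scaling (sieve_set k))) =
    2 ^+ k.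
  move=> kj; rewrite /model_dimension dimension_coefs_span// size_coefs_sieve ?natrX//.
  by case: (j0 n) kj => // l; rewrite ltz_nat => /ltnW.
move=> hsel; apply: (penalized_selection_coefs hb ly hsel).
  move=> A D [k [kj -> ->]]; split; last by rewrite dimE.
  by exists k; split=> //; exact/esym/sieve_span.
move=> m [k [kj ->]]; exists (with_scaling (sieve_set k)), (2 ^+ k).
by rewrite (sieve_span kj); split=> //; [exists k|rewrite dimE].
Qed.

Lemma large_selected sh n y :
  large_estimator phi psi N lambda j0 sh -> N n -> linear_on_L2 y ->
  exists A D, selected (top_level (j0 n)) (large_label (j0 n)) (lambda n / n%:R)
      (y \o e) A D /\
    sh n y = \sum_(i <- levels (top_level (j0 n)) | i \in A) y (e i) *: e i.
Proof.
move=> [_ hsh] Nn ly.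
have ne : nonempty_sizes N (large_models phi psi j0) n.
  by split=> //; exists (wavelet_span phi psi set0), set0.
have spanE S : S `<=` dyadic `&` below_level (j0 n) -> wavelet_span phi psi S =
    span (top_level (j0 n)) (with_scaling S).
  move=> Sb; rewrite /span -wavelet_span_below; last by move=> jk /Sb[].
  by congr (wavelet_span phi psi _); apply/esym/setIidl => jk /Sb[].
apply: (penalized_selection_coefs hb ly (hsh n y ne ly)).
  move=> A D [S [Sb -> ->]]; split; first by exists S; rewrite spanE.
  by rewrite /model_dimension dimension_coefs_span.
move=> m [S [Sb ->]]; exists (with_scaling S).
exists (size (coefs (top_level (j0 n)) (with_scaling S)))%:R.
rewrite spanE//; split=> //; first by exists S.
by rewrite /model_dimension dimension_coefs_span.
Qed.

(** The infimum in the penalized dimension runs over natural numbers, hence it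
    is attained. *)
Lemma hybrid_dimensionP (theta : R) n J S : 2 < theta -> hybrid_sets theta J S ->
  let m := wavelet_span phi psi (S `&` below_level (j0 n)) in
  hybrid_dimension theta phi psi j0 n m <= (hybrid_size theta J)%:R /\
  exists J' S', [/\ hybrid_sets theta J' S',
    m = wavelet_span phi psi (S' `&` below_level (j0 n)) &
    hybrid_dimension theta phi psi j0 n m = (hybrid_size theta J')%:R].
Proof.
move=> th2 hS m.
pose Q k := `[< exists J' S', [/\ hybrid_sets theta J' S',
  m = wavelet_span phi psi (S' `&` below_level (j0 n)) & k = hybrid_size theta J'] >].
have exQ : exists k, Q k.
  by exists (hybrid_size theta J); apply/asboolP; exists J, S.
case: (ex_minnP exQ) => k /asboolP[J' [S' [hS' mE kE]]] kmin.
have dE : hybrid_dimension theta phi psi j0 n m = k%:R.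
  rewrite /hybrid_dimension; set E := [set D | _].
  have lb : lbound E k%:R.
    move=> D [J1 [S1 [hS1 mE1 ->]]]; rewrite ler_nat kmin//; apply/asboolP.
    by exists J1, S1; rewrite (dimension_hybrid hb th2 hS1).
  have Ek : E k%:R.
    by exists J', S'; rewrite (dimension_hybrid hb th2 hS') -kE.
  apply: le_anti; rewrite ge_inf//=; last by exists k%:R.
  by apply: lb_le_inf => //; exists k%:R.
split; last by exists J', S'; rewrite dE kE.
by rewrite dE ler_nat kmin//; apply/asboolP; exists J, S.
Qed.

Lemma hybrid_selected (theta : R) sh n y : 2 < theta ->
  hybrid_estimator theta phi psi N lambda j0 sh -> N n ->
  0 <= lambda n / n%:R -> linear_on_L2 y ->
  exists A D, selected (top_level (j0 n)) (hybrid_label theta) (lambda n / n%:R)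
      (y \o e) A D /\
    sh n y = \sum_(i <- levels (top_level (j0 n)) | i \in A) y (e i) *: e i.
Proof.
move=> th2 [_ hsh] Nn p0 ly.
have ne : nonempty_sizes N (hybrid_models theta phi psi j0) n.
  split=> //; pose A j := `I_(hybrid_card theta 0 j).
  exists (wavelet_span phi psi (((sieve_set 0) `|`
    \bigcup_(j in [set j | (0 <= j)%N]) [set (j, k) | k in A j]) `&` below_level (j0 n))).
  exists 0%N; eexists; split; last by reflexivity.
  exists A; split=> // j _; split; last exact: card_eqxx.
  move=> k /= hk; apply: (leq_trans hk).
  have : (hybrid_card theta 0 j)%:R <= 1 :> R.
    apply: (le_trans (hybrid_card_le _ _ _)); rewrite expr0 mul1r subn0 addn1.
    rewrite powRN invf_le1 ?powR_gt0// -[leLHS](powRr0 (j.+1%:R)).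
    by rewrite ler_powR ?ler1n//; lra.
  by rewrite lern1 => /leq_trans -> //; rewrite expn_gt0.
have spanE J S : hybrid_sets theta J S ->
    wavelet_span phi psi (S `&` below_level (j0 n)) =
    span (top_level (j0 n)) (with_scaling S).
  by move=> /hybrid_sets_dyadic Sd; rewrite wavelet_span_below.
apply: (penalized_selection_coefs hb ly (hsh n y ne ly)).
  move=> A D [J [S [hS -> ->]]]; rewrite -[coefs_span _ _ _ _](spanE _ _ hS).
  split; first by exists J, S.
  by rewrite ler_wpM2l//; have [] := hybrid_dimensionP n th2 hS.
move=> m [J [S [hS ->]]].
have [_ [J' [S' [hS' mE ->]]]] := hybrid_dimensionP n th2 hS.
exists (with_scaling S'), (hybrid_size theta J')%:R.
split=> //; [by exists J', S'|by rewrite mE; exact: (spanE _ _ hS')].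
Qed.

End estimators.

(** * Risk and bias *)

Section monotone.
Context d (T : measurableType d) (R : realType).
Variable mu : {measure set T -> \bar R}.

Lemma integral_mono (f g : T -> \bar R) : (forall x, (0 <= f x)%E) ->
  (forall x, (f x <= g x)%E) -> (\int[mu]_x f x <= \int[mu]_x g x)%E.
Proof.
move=> f0 fg; have g0 x : (0 <= g x)%E by exact: le_trans (fg x).
rewrite !ge0_integralE// !patch_setT; apply: le_ereal_sup => _ [h hh <-].
by exists h => // x; exact: le_trans (fg x).
Qed.

(** Giving the larger function the value [+oo] on the exceptional null set makes
    the inequality hold everywhere, without changing the integral. *)
Lemma ae_integral_mono (f g : T -> \bar R) : measurable_fun setT g ->
  (forall x, (0 <= f x)%E) -> (forall x, (0 <= g x)%E) ->
  {ae mu, forall x, (f x <= g x)%E} -> (\int[mu]_x f x <= \int[mu]_x g x)%E.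
Proof.
move=> mg f0 g0 [N [mN N0 sN]].
pose g' x := (if x \in N then +oo else g x)%E.
have mg' : measurable_fun setT g'.
  apply: measurable_fun_if => //.
    by apply: (measurable_fun_bool true); rewrite setTI preimage_mem_true.
  exact: measurable_funTS.
have g'0 x : (0 <= g' x)%E by rewrite /g'; case: ifP.
apply: (@le_trans _ _ (\int[mu]_x g' x)%E).
  apply: integral_mono => // x; rewrite /g'; case: ifPn => [_|/negP xN].
    by rewrite leey.
  by apply: contrapT => h; apply: xN; apply/mem_set; exact: sN.
rewrite (ge0_ae_eq_integral _ mg' mg)//.
exists N; split => // x /= h; apply: contrapT => xN; apply: h => _.
by rewrite /g' memNset.
Qed.

End monotone.

Section risk.
Context (R : realType) d (T : measurableType d) (P : probability T R).
Variables (phi psi : R -> R) (W : (R -> R) -> T -> R).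
Hypothesis hb : wavelet_basis phi psi.
Hypothesis hW : white_noise P W.
Variables (s : R -> R) (n : nat).
Hypothesis sL : L2 (mu01 R) s.

Let e := wavelet phi psi.

Definition bias L (A : set coef_index) : R :=
  inner (mu01 R) s s - coefs_energy L A (fun i => inner (mu01 R) (e i) s).

Definition noise_energy L (A : set coef_index) (w : T) : R :=
  coefs_energy L A (fun i => (Num.sqrt n%:R)^-1 * W (e i) w).

Lemma observation_linear w : linear_on_L2 (W^~ w) ->
  linear_on_L2 (observation W n s w).
Proof.
move=> lW a u v uL vL; rewrite /observation lW//.
have -> : inner (mu01 R) (a *: u + v) s =
    a * inner (mu01 R) u s + inner (mu01 R) v s.
  have auL : a *: u \in Lfun (mu01 R) 2%:E by exact: Lfun2Z.
  by have := dotfDl auL vL sL; rewrite dotfZl.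
ring.
Qed.

Lemma observation_bessel L :
  \sum_(i <- levels L) inner (mu01 R) (e i) s ^+ 2 <= inner (mu01 R) s s.
Proof.
apply: expansion_bessel => //; first exact: levels_uniq.
  by move=> i /levels_dyadic; exact: wavelet_L2 hb _.
by move=> i j /levels_dyadic Di /levels_dyadic Dj; exact: wavelet_orthonormal hb _ _ _ _.
Qed.

Lemma bias_ge0 L A : 0 <= bias L A.
Proof.
rewrite subr_ge0; apply: le_trans (observation_bessel L).
rewrite /coefs_energy big_mkcond /=.
by apply: ler_sum => i _; case: ifP => // _; exact: sqr_ge0.
Qed.

Section selection.
Variables (L : nat) (Lab : set coef_index -> R -> Prop) (p : R).
Variable (sh : ((R -> R) -> R) -> R -> R).
Hypothesis p0 : 0 <= p.
Hypothesis Lab0 : forall A D, Lab A D -> 0 <= D.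
Hypothesis hsel : forall y, linear_on_L2 y ->
  exists A D, selected L Lab p (y \o e) A D /\
    sh y = \sum_(i <- levels L | i \in A) y (e i) *: e i.

Let loss w := norm2 (mu01 R) (sh (observation W n s w) - s) ^+ 2.

Let loss_selected w : linear_on_L2 (W^~ w) ->
  exists A D, selected L Lab p (observation W n s w \o e) A D /\
    loss w = bias L A + noise_energy L A w.
Proof.
move=> lW; have [A [D [hA shE]]] := hsel (observation_linear lW).
exists A, D; split=> //; rewrite /loss shE expansion_loss//; first last.
- by move=> i j /levels_dyadic Di /levels_dyadic Dj; exact: wavelet_orthonormal hb _ _ _ _.
- by move=> i /levels_dyadic; exact: wavelet_L2 hb _.
- exact: levels_uniq.
congr (_ + _); apply: eq_bigr => i _; congr (_ ^+ 2).
by rewrite /observation addrAC subrr add0r.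
Qed.

(** The expectation of [oracle_upper], which applies to almost every sample. *)
Lemma risk_upper (Z : T -> R) (z : R) : measurable_fun setT Z ->
  (forall w, 0 <= Z w) -> (\int[P]_w (Z w)%:E <= z%:E)%E ->
  (forall A D w, Lab A D -> noise_energy L A w <= p * D / 12 + Z w) ->
  forall A D, Lab A D ->
  (\int[P]_w (loss w)%:E <= (2 * (bias L A + p * D) + 13 * z)%:E)%E.
Proof.
move=> mZ Z0 Zz hZ A D hA; set c := 2 * _.
have c0 : 0 <= c by rewrite mulr_ge0// addr_ge0 ?bias_ge0// mulr_ge0// (Lab0 hA).
apply: (@le_trans _ _ (\int[P]_w (c + 13 * Z w)%:E)%E).
  apply: ae_integral_mono.
  - apply/measurable_EFinP; apply: measurable_funD => //.
    exact: measurable_funM.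
  - by move=> w; rewrite lee_fin sqr_ge0.
  - by move=> w; rewrite lee_fin addr_ge0// mulr_ge0.
  apply: filterS (wn_linear hW) => w lW; rewrite lee_fin.
  have [A' [D' [[hA' hmin] ->]]] := loss_selected lW.
  apply: (oracle_upper (observation_bessel L) p0 (Lab0 hA') (Lab0 hA)) => //.
  - exact: hmin.
  - exact: hZ.
  - exact: hZ.
under eq_integral => w _ do rewrite EFinD.
rewrite ge0_integralD//=; last 2 first.
- by move=> w _; rewrite lee_fin mulr_ge0.
- by apply/measurable_EFinP; exact: measurable_funM.
rewrite integral_cst//= probability_setT mule1.
under eq_integral => w _ do rewrite EFinM.
have mZe : measurable_fun setT (fun w => (Z w)%:E) by exact/measurable_EFinP.
have Z0e w : setT w -> (0 <= (Z w)%:E)%E by rewrite lee_fin.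
rewrite ge0_integralZl// ?lee_fin//.
rewrite (EFinD c) (EFinM 13); apply: leeD2l.
by rewrite lee_pmul2l// lte_fin.
Qed.

(** On an event of probability at least 1/2 the noise is dominated by the
    penalty; there [oracle_lower] bounds the loss from below by half the excess of
    the bias of the model [A], which is nearly optimal for the penalty [p / 16]. *)
Lemma risk_lower (E : set T) (A : set coef_index) (D eta r : R) :
  measurable E -> ((2^-1)%:E <= P E)%E ->
  (forall A D w, Lab A D -> E w -> noise_energy L A w <= p * D / 12) ->
  (forall A D A' D', Lab A D -> Lab A' D' -> D' <= D \/ 2 * D <= D') ->
  0 <= eta -> Lab A D ->
  (forall A' D', Lab A' D' -> bias L A + p / 16 * D <= bias L A' + p / 16 * D' + eta) ->
  (\int[P]_w (loss w)%:E <= r%:E)%E -> bias L A <= 4 * r + 2 * eta.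
Proof.
move=> mE hE hN hD eta0 hA hmin hr.
have r0 : 0 <= r.
  rewrite -lee_fin; apply: le_trans hr; apply: integral_ge0 => w _.
  by rewrite lee_fin sqr_ge0.
have [small|big] := leP (bias L A) (2 * eta); first lra.
have [N [mN N0 sN]] := wn_linear hW.
pose c := (bias L A - 2 * eta) / 2; have c0 : 0 < c by rewrite divr_gt0// subr_gt0.
have lossE w : (E `\` N) w -> c <= loss w.
  move=> [Ew Nw]; have lW : linear_on_L2 (W^~ w).
    by apply: contrapT => h; apply: Nw; exact: sN.
  have [A' [D' [[hA' hs] ->]]] := loss_selected lW.
  have := oracle_lower (observation_bessel L) p0 (Lab0 hA') (Lab0 hA) (hs _ _ hA)
     (hD _ _ _ _ hA hA') (hN _ _ w hA' Ew) eta0 (hmin _ _ hA').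
  rewrite -/(coefs_energy L A _) -/(coefs_energy L A' _) -/(bias L A) -/(bias L A') => h.
  have : 0 <= noise_energy L A' w by apply: sumr_ge0 => i _; exact: sqr_ge0.
  rewrite /c; lra.
have mEN : measurable (E `\` N) by exact: measurableD.
have hEN : ((2^-1)%:E <= P (E `\` N))%E.
  have PE : (P E = P (E `\` N) + P (E `&` N))%E by exact: measureDI.
  apply: (le_trans hE); rewrite PE.
  rewrite [X in (_ + X)%E](_ : _ = 0%E) ?adde0//.
  by apply: (subset_measure0 _ _ _ N0) => //; exact: measurableI.
have : ((c / 2)%:E <= r%:E)%E.
  apply: le_trans hr; apply: (@le_trans _ _ (\int[P]_w (c * \1_(E `\` N) w)%:E)%E).
    under eq_integral => w _ do rewrite EFinM.
    have mI : measurable_fun setT (fun w => (\1_(E `\` N) w)%:E : \bar R).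
      by apply/measurable_EFinP; exact: measurable_indic.
    rewrite ge0_integralZl// ?lee_fin ?(ltW c0)//.
    by rewrite integral_indic// setIT EFinM lee_pmul2l// lte_fin.
  apply: integral_mono => w; rewrite lee_fin.
    by rewrite mulr_ge0// ltW.
  rewrite indicE; case: (boolP (w \in _)) => [/set_mem /lossE h|_].
    by rewrite mulr1.
  by rewrite mulr0 sqr_ge0.
rewrite lee_fin /c; lra.
Qed.

End selection.

End risk.

(** * Noise of the three families *)

Lemma integral_weighted_sqr (R : realType) d (T : measurableType d)
    (P : {measure set T -> \bar R}) (X : nat -> T -> R) (c v : nat -> R) (m : nat) :
  (forall J, measurable_fun setT (X J)) -> (forall J, 0 <= c J) ->
  (forall J, (\int[P]_w (X J w ^+ 2)%:E <= (v J)%:E)%E) ->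
  let Z w := \sum_(0 <= J < m) c J * X J w ^+ 2 in
  measurable_fun setT Z /\
  (\int[P]_w (Z w)%:E <= (\sum_(0 <= J < m) c J * v J)%:E)%E.
Proof.
move=> mX c0 hv Z.
have mX2 J : measurable_fun setT (fun w => c J * X J w ^+ 2).
  by apply: measurable_funM => //; exact: measurable_funX.
split; first by apply: measurable_sum.
have mX2e J : measurable_fun setT (fun w => (c J * X J w ^+ 2)%:E).
  exact/measurable_EFinP.
have mXe J : measurable_fun setT (fun w => (X J w ^+ 2)%:E).
  by apply/measurable_EFinP; exact: measurable_funX.
under eq_integral => w _ do rewrite -sumEFin.
rewrite ge0_integral_sum//; last first.
  by move=> J w _; rewrite lee_fin mulr_ge0 ?sqr_ge0.
rewrite -sumEFin; apply: lee_sum => J _.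
under eq_integral => w _ do rewrite EFinM.
have X0 w : setT w -> (0 <= (X J w ^+ 2)%:E)%E by rewrite lee_fin sqr_ge0.
rewrite ge0_integralZl// ?lee_fin//.
by rewrite EFinM; apply: lee_wpmul2l; rewrite ?lee_fin.
Qed.

Lemma size_levels L : size (levels L) = (2 ^ L)%N.
Proof.
rewrite -sum1_size (big_levels _ xpredT (fun=> 1%N)).
elim: L => [|L IH]; first by rewrite big_nil.
rewrite big_nat_recr//= addrA IH sum_nat_const_nat muln1 subn0.
by rewrite expnS mul2n -addnn.
Qed.

Section noise_of_models.
Variables (R : realType) (phi psi : R -> R).
Hypothesis hb : wavelet_basis phi psi.

Let e := wavelet phi psi.

Lemma noise_energyE d (T : measurableType d) (W : (R -> R) -> T -> R) n L A w :
  noise_energy phi psi W n L A w =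
  n%:R^-1 * \sum_(i <- levels L | i \in A) W (e i) w ^+ 2.
Proof.
rewrite /noise_energy /coefs_energy mulr_sumr; apply: eq_bigr => i _.
by rewrite exprMn exprVn sqr_sqrtr.
Qed.

(** A model whose penalized dimension is at least [2 ^ J] and which is no
    larger than a hybrid model beyond the level [J]. *)
Definition hybrid_profile (theta : R) L (A : set coef_index) (D : R) :=
  exists2 J, 2 ^+ J <= D & forall j, (J <= j < L)%N ->
    level_card R A j <= 2 ^+ J * (j - J + 1)%:R `^ (- theta).

Lemma hybrid_label_profile theta L A D :
  hybrid_label theta A D -> hybrid_profile theta L A D.
Proof.
move=> [J [S [hS -> ->]]]; exists J.
  by rewrite -natrX ler_nat hybrid_size_ge.
move=> j /andP[Jj _]; apply: le_trans (hybrid_card_le _ _ _).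
by rewrite -(hybrid_sets_card hS Jj) natr_sum.
Qed.

Lemma sieve_label_profile theta L j0 A D :
  sieve_label j0 A D -> hybrid_profile theta L A D.
Proof.
move=> [N [_ -> ->]]; exists N => // j /andP[Nj _].
rewrite /level_card big_pred0 ?mulr_ge0 ?exprn_ge0 ?powR_ge0// => k.
apply/negP => /set_mem[//|[[j' k'] [_ /= jN] [jj' _]]].
by move: jN; rewrite jj' ltnNge Nj.
Qed.

(** Penalties [p D] with [p >= C / n] dominate the noise of all the models with a
    hybrid profile, in expectation and with probability at least 1/2. *)
Definition noise_constant (theta C : R) :=
  forall d (T : measurableType d) (P : probability T R) (W : (R -> R) -> T -> R)
    (n L : nat) (p : R) (Lab : set coef_index -> R -> Prop),
  white_noise P W -> (0 < n)%N -> C <= p * n%:R ->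
  (forall A D, Lab A D -> hybrid_profile theta L A D) ->
  (exists Z : T -> R, [/\ measurable_fun setT Z, forall w, 0 <= Z w,
     (\int[P]_w (Z w)%:E <= (C * L.+1%:R / n%:R)%:E)%E &
     forall A D w, Lab A D ->
       noise_energy phi psi W n L A w <= p * D / 12 + Z w]) /\
  (exists E : set T, [/\ measurable E, ((2^-1)%:E <= P E)%E &
     forall A D w, Lab A D -> E w ->
       noise_energy phi psi W n L A w <= p * D / 12]).
(** One random variable per base level [J <= L] bounds the noise of all the
    models with that base level; each has variance of order [2 ^ J] while the
    penalty allows for deviations of order [2 ^ J].  In expectation, the [L + 1]
    base levels contribute equally; for an event of probability at least 1/2,
    deviations are summable over all base levels. *)
Lemma profile_noise (theta : R) : 2 < theta ->
  exists2 C : R, 0 < C & noise_constant theta C.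
Proof.
move=> th2; have [C C0 hC] := hybrid_noise th2.
exists (12 * (2 * C + 1)); first by lra.
move=> d T P W n L p Lab hW n0 hp hLab.
have n1 : 0 < n%:R :> R by rewrite ltr0n.
have /choice[X hX] := hC d T P W e hW (@wavelet_L2 _ _ _ hb)
  (@wavelet_orthonormal _ _ _ hb) L.
have mX J : measurable_fun setT (X J) by have [] := hX J.
have p20 J : 0 < 2 ^+ J :> R by rewrite exprn_gt0.
have key A D w : Lab A D -> exists2 J, (J < L.+1)%N & 2 ^+ J <= D /\
    noise_energy phi psi W n L A w <= n%:R^-1 * (C * 2 ^+ J + X J w).
  (* for [J >= L] the profile only restricts levels beyond [L] *)
  move=> /hLab[J JD hJ]; exists (minn J L); first by rewrite ltnS geq_minr.
  split; first by rewrite (le_trans _ JD)// ler_weXn2l ?ler1n ?geq_minl.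
  rewrite noise_energyE ler_wpM2l ?invr_ge0 ?(ltW n1)//.
  have [_ _ h] := hX (minn J L); apply: h => j.
  have [JL|LJ] := leqP J L; first exact: hJ.
  by move=> /andP[/leq_ltn_trans h /h]; rewrite ltnn.
have pen J D : 2 ^+ J <= D -> n%:R^-1 * ((2 * C + 1) * 2 ^+ J) <= p * D / 12.
  move=> JD; have h : (2 * C + 1) / n%:R <= p / 12.
    by rewrite ler_pdivrMr//; lra.
  have D0 : 0 <= D by apply: le_trans JD; exact: ltW.
  rewrite mulrA [_ * (_ + _)]mulrC [leRHS]mulrAC ler_pM//.
  by rewrite divr_ge0 ?(ltW n1)//; lra.
have v J : (\int[P]_w (X J w ^+ 2)%:E <= (C * 2 ^+ J)%:E)%E by have [] := hX J.
split.
  (* [x <= y + x ^ 2 / y] with [y = 2 ^ J] *)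
  pose Z w := \sum_(0 <= J < L.+1) n%:R^-1 / 2 ^+ J * X J w ^+ 2.
  have c0 J : 0 <= n%:R^-1 / 2 ^+ J :> R.
    by rewrite divr_ge0 ?invr_ge0 ?ler0n// ltW.
  have [mZ hZ] := integral_weighted_sqr L.+1 mX c0 v.
  exists Z; split => //.
  - by move=> w; rewrite sumr_ge0// => J _; rewrite mulr_ge0 ?sqr_ge0.
  - apply: (le_trans hZ); rewrite lee_fin.
    rewrite (eq_bigr (fun=> n%:R^-1 * C)); last first.
      by move=> J _; field; rewrite ?gt_eqF.
    rewrite sumr_const_nat subn0 -[_ *+ L.+1]mulr_natr [n%:R^-1 * C]mulrC mulrAC.
    by rewrite ler_wpM2r ?invr_ge0 ?ler0n// ler_wpM2r//; lra.
  move=> A D w hA; have [J JL [JD hJ]] := key A D w hA.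
  apply: (le_trans hJ); apply: (@le_trans _ _
      (n%:R^-1 * ((2 * C + 1) * 2 ^+ J) + n%:R^-1 / 2 ^+ J * X J w ^+ 2)).
    have -> : n%:R^-1 * ((2 * C + 1) * 2 ^+ J) + n%:R^-1 / 2 ^+ J * X J w ^+ 2 =
      n%:R^-1 * ((2 * C + 1) * 2 ^+ J + (2 ^+ J)^-1 * X J w ^+ 2).
      by rewrite mulrDr mulrA.
    rewrite ler_wpM2l ?invr_ge0 ?ler0n//.
    have h : X J w <= 2 ^+ J + (2 ^+ J)^-1 * X J w ^+ 2.
      have sq := sqr_ge0 (X J w - 2 ^+ J); have pJ := p20 J.
      rewrite -(ler_pM2l pJ) mulrDr mulrA divff ?gt_eqF// mul1r.
      have := sqr_ge0 (X J w); nra.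
    have := mulr_gt0 C0 (p20 J); lra.
  apply: lerD; first exact: pen.
  rewrite /Z (bigD1_seq J) ?mem_index_iota ?iota_uniq//= lerDl.
  by apply: sumr_ge0 => i _; rewrite mulr_ge0 ?sqr_ge0.
(* The weights [4 ^ - J] make the expectation of the sum bounded, so that by
   Markov's inequality all [X J] are at most of order [2 ^ J] together. *)
pose G w := \sum_(0 <= J < L.+1) (4 ^+ J)^-1 * X J w ^+ 2.
have c0 J : 0 <= (4 ^+ J)^-1 :> R by rewrite invr_ge0 exprn_ge0.
have [mG hG] := integral_weighted_sqr L.+1 mX c0 v.
have G0 w : 0 <= G w.
  by rewrite sumr_ge0// => J _; rewrite mulr_ge0 ?sqr_ge0.
have {}hG : (\int[P]_w (G w)%:E <= (2 * C)%:E)%E.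
  apply: (le_trans hG); rewrite lee_fin.
  rewrite (eq_bigr (fun J => C * 2 ^- J)); last first.
    move=> J _; rewrite (_ : 4 = 2 * 2) ?exprMn; last by ring.
    by field; rewrite ?gt_eqF.
  rewrite -mulr_sumr mulrC ler_wpM2r ?(ltW C0)//.
  have claim m : \sum_(0 <= J < m) 2 ^- J = 2 - 2 * 2 ^- m :> R.
    elim: m => [|m IH]; first by rewrite big_nil expr0 invr1 mulr1 subrr.
    by rewrite big_nat_recr//= IH exprS; field; rewrite gt_eqF.
  by rewrite claim gerBl mulr_ge0// invr_ge0 ltW.
have mGe : measurable_fun setT (fun w => (G w)%:E) by exact/measurable_EFinP.
have C40 : 0 < 4 * C by rewrite mulr_gt0.
pose B := setT `&` [set w | ((4 * C)%:E <= `|(G w)%:E|)%E].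
have mB : measurable B.
  by apply: emeasurable_fun_c_infty => //; exact: measurableT_comp.
have PB : (P B <= (2^-1)%:E)%E.
  rewrite -(@lee_pmul2l _ (4 * C)%:E)// -EFinM (_ : 4 * C / 2 = 2 * C); last by field.
  apply: (le_trans (@le_integral_abse _ _ _ P setT measurableT _ _ mGe C40)).
  apply: le_trans hG; apply: integral_mono => w //.
  by rewrite gee0_abs ?lee_fin.
exists (~` B); split; first exact: measurableC.
  rewrite probability_setC//.
  have /fineK <- : P B \is a fin_num by exact: fin_num_measure.
  have : fine (P B) <= 2^-1 by rewrite -lee_fin fineK// fin_num_measure.
  by rewrite -EFinB lee_fin; lra.
move=> A D w hA Bw; have [J JL [JD hJ]] := key A D w hA.
apply: (le_trans hJ); apply: le_trans (pen J D JD).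
rewrite ler_wpM2l ?invr_ge0 ?ler0n//.
have Gw : G w < 4 * C.
  rewrite ltNge; apply/negP => h; apply: Bw; split=> //=.
  by rewrite lee_fin ger0_norm.
have hX2 : (4 ^+ J)^-1 * X J w ^+ 2 <= 4 * C.
  apply: le_trans (ltW Gw); rewrite /G (bigD1_seq J) ?mem_index_iota ?iota_uniq//=.
  by rewrite lerDl sumr_ge0// => i _; rewrite mulr_ge0 ?sqr_ge0.
have h4 : 4 ^+ J = 2 ^+ J * 2 ^+ J :> R.
  by rewrite -exprMn; congr (_ ^+ _); ring.
have : X J w <= (C + 1) * 2 ^+ J.
  have [X0|X0] := leP 0 (X J w); last first.
    by apply: (le_trans (ltW X0)); rewrite mulr_ge0 ?(ltW (p20 J))// addr_ge0// ltW.
  rewrite -(@ler_pXn2r _ 2)// ?nnegrE//; last first.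
    by rewrite mulr_ge0 ?(ltW (p20 J))// addr_ge0// ltW.
  move: hX2; rewrite mulrC ler_pdivrMr ?exprn_gt0// => hX2.
  apply: (le_trans hX2); rewrite h4 exprMn -expr2 ler_wpM2r ?exprn_ge0//.
  by have := sqr_ge0 (C - 1); lra.
lra.
Qed.

(** Without any structure on the models, each coordinate of the noise has to be
    thresholded separately, which is why the penalty needs a logarithm. *)
Lemma large_noise d (T : measurableType d) (P : probability T R)
    (W : (R -> R) -> T -> R) (n : nat) (j0 : int) (lam : R) :
  white_noise P W -> (0 < n)%N -> 48 <= lam ->
  exists Z : T -> R, [/\ measurable_fun setT Z, forall w, 0 <= Z w,
     (\int[P]_w (Z w)%:E <=
        (12 * 2 ^+ top_level j0 * expR (- (lam / 32)) / n%:R)%:E)%E &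
     forall A D w, large_label j0 A D ->
       noise_energy phi psi W n (top_level j0) A w <= lam / n%:R * D / 12 + Z w].
Proof.
move=> hW n0 hlam; set L := top_level j0.
(* the threshold [4 t ^ 2] is the share [lam / 12] of the penalty *)
pose t := Num.sqrt (lam / 48).
have n1 : 0 < n%:R :> R by rewrite ltr0n.
have t2 : t ^+ 2 = lam / 48 by rewrite sqr_sqrtr//; lra.
have t1 : 1 <= t by rewrite -[leLHS]sqrtr1 ler_sqrt//; lra.
pose c : R := n%:R^-1 * (6 * expR (- 2 * t ^+ 2)).
have c0 : 0 <= c by rewrite mulr_ge0 ?invr_ge0 ?ler0n// mulr_ge0 ?expR_ge0.
pose f i w := if i \in levels L then c * exp2 t (W (e i) w) else 0.
have mf i : measurable_fun setT (f i).
  rewrite /f; case: (boolP (i \in levels L)) => [/levels_dyadic Di|_]; last first.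
    exact: measurable_cst.
  apply: measurable_funM => //; apply: measurable_exp2.
  exact: wn_coord_meas hW (@wavelet_L2 _ _ _ hb) _ Di.
have f0 i w : 0 <= f i w.
  by rewrite /f; case: ifP => // _; rewrite mulr_ge0// ltW// exp2_gt0.
exists (fun w => \sum_(i <- levels L) f i w); split.
- exact: measurable_sum.
- by move=> w; apply: sumr_ge0.
- under eq_integral => w _ do rewrite -sumEFin.
  rewrite ge0_integral_sum//; last 2 first.
  + by move=> i; apply/measurable_EFinP.
  + by move=> i w _; rewrite lee_fin.
  rewrite (eq_big_seq (fun=> (c * (2 * expR (t ^+ 2 / 2)))%:E)); last first.
    move=> i iL; rewrite /f iL; under eq_integral => w _ do rewrite EFinM.
    have Di := levels_dyadic iL.
    have mi : measurable_fun setT (fun w => (exp2 t (W (e i) w))%:E).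
      apply/measurable_EFinP; apply: measurable_exp2.
      exact: wn_coord_meas hW (@wavelet_L2 _ _ _ hb) _ Di.
    have i0 w : setT w -> (0 <= (exp2 t (W (e i) w))%:E)%E.
      by rewrite lee_fin ltW// exp2_gt0.
    rewrite ge0_integralZl// ?lee_fin//.
    by rewrite (wn_coord_exp2 hW (@wavelet_L2 _ _ _ hb)
      (@wavelet_orthonormal _ _ _ hb)).
  rewrite sumEFin big_const_seq count_predT size_levels iter_addr_0 lee_fin.
  rewrite -[_ *+ (2 ^ L)%N]mulr_natr natrX /c.
  have -> : expR (- (lam / 32)) = expR (- 2 * t ^+ 2) * expR (t ^+ 2 / 2).
    by rewrite -expRD t2; congr expR; field.
  by rewrite le_eqVlt; apply/orP; left; apply/eqP; field; rewrite gt_eqF.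
move=> A D w [S [_ _ ->]]; rewrite noise_energyE.
have -> : lam / n%:R * (size (coefs L A))%:R / 12 =
    \sum_(i <- levels L | i \in A) n%:R^-1 * (4 * t ^+ 2).
  rewrite size_coefs natr_sum mulr_sumr mulr_suml; apply: eq_bigr => i _.
  by rewrite t2; field; rewrite gt_eqF.
rewrite mulr_sumr; apply: (@le_trans _ _ (\sum_(i <- levels L | i \in A)
   (n%:R^-1 * (4 * t ^+ 2) + f i w))).
  rewrite big_seq_cond [leRHS]big_seq_cond; apply: ler_sum => i /andP[iL _].
  rewrite /f iL /c -!mulrA -mulrDr ler_wpM2l ?invr_ge0 ?ler0n//.
  by have := sqr_le_exp2 (W (e i) w) t1; rewrite -!mulrA.
rewrite big_split lerD2l /= big_mkcond; apply: ler_sum => i _.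
by case: ifP.
Qed.

End noise_of_models.

(** * From the bias to the penalized bias *)

(** From a bound on the bias of nearly optimal models to a bound on their
    penalized bias: the optimal model for the larger penalty [p m] competes for
    the smaller penalty [p n], and the term [p n * d] is only a fraction of
    [p m * d]; the exponent [gamma < 1] makes the recursion contract. *)
Lemma penalized_bias_of_bias (R : realType) (Val : nat -> Prop) (p : nat -> R)
    (Phi : nat -> R -> R -> Prop) (gamma pmax pmin S d0 C1 : R) :
  0 < gamma < 1 -> 0 < pmin -> 0 <= C1 ->
  (forall n, Val n -> 0 < p n <= pmax) ->
  (forall n b d, Phi n b d -> 0 <= b /\ 0 <= d) ->
  (forall n, Val n -> exists b d, [/\ Phi n b d, b <= S & d <= d0]) ->
  (forall n, Val n -> pmin <= p n \/
     exists m, [/\ (m < n)%N, Val m, p n <= 5 / 8 * p m & p m <= 4 * p n]) ->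
  (forall n m b d, Val n -> Val m -> p n <= p m -> Phi m b d ->
     exists b' d', [/\ Phi n b' d', b' <= b & d' <= d]) ->
  (forall n b d, Val n -> Phi n b d ->
     (forall b' d', Phi n b' d' ->
        b + p n / 16 * d <= b' + p n / 16 * d' + p n `^ gamma) ->
     b <= C1 * p n `^ gamma) ->
  exists K, forall n, Val n ->
    exists b d, Phi n b d /\ b + p n * d <= K * p n `^ gamma.
Proof.
move=> /andP[g0 g1] pmin0 C10 hp Phi0 hbase hdesc htrans hbias.
pose q : R := (5 / 8) `^ (1 - gamma).
have q0 : 0 <= q by exact: powR_ge0.
have q1 : q < 1.
  have e1 : 1 `^ (1 - gamma) = 1 :> R by rewrite powR1.
  by rewrite /q -[ltRHS]e1 gt0_ltr_powR ?subr_gt0 ?nnegrE//; lra.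
pose c0 : R := (`|S| + pmax * `|d0|) / pmin `^ gamma.
have pg0 : 0 < pmin `^ gamma by rewrite powR_gt0.
(* [4 C1 + q (K + 1) <= K] closes the induction *)
pose K : R := Num.max c0 ((4 * C1 + q) / (1 - q)).
suff main n : Val n -> exists b d, Phi n b d /\ b + p n / 16 * d <= K * p n `^ gamma.
  exists (16 * K) => n Vn; have [b [d [hPhi h]]] := main n Vn.
  exists b, d; split=> //; have [b0 _] := Phi0 _ _ _ hPhi.
  have : b <= 16 * b by lra.
  rewrite -mulrA; lra.
elim/ltn_ind: n => n IH Vn.
have /andP[pn0 pnM] := hp n Vn.
have [pmin_le|[m [mn Vm le58 le4]]] := hdesc n Vn.
  have [b [d [hPhi bS dd0]]] := hbase n Vn; exists b, d; split=> //.
  have [b0 dge0] := Phi0 _ _ _ hPhi.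
  have h1 : b + p n / 16 * d <= `|S| + pmax * `|d0|.
    apply: lerD; first by apply: (le_trans bS); exact: ler_norm.
    apply: ler_pM => //; first by rewrite divr_ge0// ltW.
      by apply: le_trans pnM; lra.
    by apply: (le_trans dd0); exact: ler_norm.
  apply: (le_trans h1); have h2 : pmin `^ gamma <= p n `^ gamma.
    by rewrite ge0_ler_powR ?nnegrE ?(ltW g0) ?(ltW pmin0)// ltW.
  have hc : 0 <= c0.
    rewrite divr_ge0 ?powR_ge0// addr_ge0// mulr_ge0//.
    by apply: le_trans pnM; exact: ltW.
  apply: (@le_trans _ _ (c0 * p n `^ gamma)).
    rewrite -[leLHS](@divfK _ (pmin `^ gamma)) ?gt_eqF//.
    by rewrite ler_wpM2l.
  by rewrite ler_wpM2r ?powR_ge0// le_max lexx.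
have /andP[pm0 _] := hp m Vm.
have pmg0 : 0 < p m `^ gamma by rewrite powR_gt0.
(* a nearly optimal model for the index [m] *)
have [b [d [hPhi hmin]]] : exists b d, Phi m b d /\ forall b' d', Phi m b' d' ->
    b + p m / 16 * d <= b' + p m / 16 * d' + p m `^ gamma.
  pose E := [set x : R | exists b d, Phi m b d /\ x = b + p m / 16 * d].
  have E0 : E !=set0.
    by have [b [d [hPhi _ _]]] := hbase m Vm; exists (b + p m / 16 * d), b, d.
  have lE : lbound E 0.
    move=> _ [b [d [/Phi0[b0 d0'] ->]]]; rewrite addr_ge0// mulr_ge0// divr_ge0//.
    exact: ltW.
  have hE : has_inf E by split=> //; exists 0.
  have [_ [b [d [hPhi ->]]] hlt] := inf_adherent pmg0 hE.
  exists b, d; split=> // b' d' hPhi'; apply: (le_trans (ltW hlt)).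
  by rewrite lerD2r ge_inf//; [exists 0|exists b', d'].
have hb := hbias m b d Vm hPhi hmin.
have [b1 [d1 [hPhi1 h1]]] := IH m mn Vm.
have h2 := le_trans (hmin _ _ hPhi1) (lerD h1 (lexx _)).
have pnm : p n <= p m by apply: (le_trans le58); lra.
have [b' [d' [hPhi' b'b d'd]]] := htrans n m b d Vn Vm pnm hPhi.
exists b', d'; split=> //.
have [b0 dge0] := Phi0 _ _ _ hPhi.
pose r := p n / p m; have r0 : 0 < r by rewrite divr_gt0.
have pnE : p n = r * p m by rewrite /r divfK// gt_eqF.
have r1 : r <= 5 / 8 by rewrite /r ler_pdivrMr.
(* comparison of the rates at [n] and [m] *)
have hr4 : p m `^ gamma <= 4 * p n `^ gamma.
  apply: (@le_trans _ _ ((4 * p n) `^ gamma)).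
    by rewrite ge0_ler_powR ?nnegrE ?(ltW g0) ?(ltW pm0)// mulr_ge0// ltW.
  rewrite powRM ?(ltW pn0)// ler_wpM2r ?powR_ge0//.
  by apply: ler1_powR; lra.
have hrq : r * p m `^ gamma <= q * p n `^ gamma.
  have -> : r * p m `^ gamma = r `^ (1 - gamma) * p n `^ gamma.
    rewrite pnE powRM ?(ltW r0) ?(ltW pm0)// mulrA -powRD; last first.
      by rewrite (gt_eqF r0) implybT.
    by rewrite subrK powRr1// ltW.
  have g2 : 0 <= 1 - gamma by rewrite subr_ge0 ltW.
  by rewrite ler_wpM2r ?powR_ge0// ge0_ler_powR ?nnegrE ?(ltW r0).
have h3 : p n / 16 * d' <= r * (p m / 16 * d).
  have -> : r * (p m / 16 * d) = p n / 16 * d by rewrite [in RHS]pnE; ring.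
  by rewrite ler_wpM2l// divr_ge0// ltW.
have h4 : r * (p m / 16 * d) <= r * ((K + 1) * p m `^ gamma - b).
  by rewrite ler_wpM2l ?(ltW r0)//; lra.
have hK : (4 * C1 + q) / (1 - q) <= K by rewrite le_max lexx orbT.
have K0 : 0 <= K.
  by apply: le_trans hK; rewrite divr_ge0 ?subr_ge0 ?(ltW q1)// addr_ge0// mulr_ge0.
have h5 : 4 * C1 + q * (K + 1) <= K.
  by move: hK; rewrite ler_pdivrMr ?subr_gt0//; lra.
have h6 : b' + p n / 16 * d' <= C1 * p m `^ gamma + (K + 1) * (r * p m `^ gamma).
  have : 0 <= r * b by rewrite mulr_ge0// ltW.
  rewrite mulrCA; lra.
apply: (le_trans h6); apply: (@le_trans _ _ ((4 * C1 + q * (K + 1)) * p n `^ gamma)).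
  have e1 := ler_wpM2l C10 hr4.
  have K1 : 0 <= K + 1 by lra.
  have e2 := ler_wpM2l K1 hrq; lra.
by rewrite ler_wpM2r ?powR_ge0.
Qed.

(** * Rates and penalties *)

Section maxisets.
Variable R : realType.

Definition unit_penalty (lambda : nat -> R) (n : nat) : R := lambda n / n%:R.

(** The properties of the penalties [lambda n / n] shared by the two choices of
    [lambda]: along sample sizes multiplied by four they decrease at least, and
    at most, geometrically. *)
Record regime (N : set nat) (lambda : nat -> R) (lmin pmin pmax : R) : Prop :=
  Regime {
    regime_gt0 : forall n, N n -> (0 < n)%N ;
    regime_lmin0 : 0 < lmin ;
    regime_lmin : forall n, N n -> lmin <= lambda n ;
    regime_pmin0 : 0 < pmin ;
    regime_pmax1 : 1 <= pmax ;
    regime_pmax : forall n, N n -> unit_penalty lambda n <= pmax ;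
    regime_descent : forall n, N n -> pmin <= unit_penalty lambda n \/
      exists m, [/\ (m < n)%N, N m,
        unit_penalty lambda n <= 5 / 8 * unit_penalty lambda m &
        unit_penalty lambda m <= 4 * unit_penalty lambda n] }.

Definition sqr_rate (lambda : nat -> R) (alpha : R) (n : nat) : R :=
  unit_penalty lambda n `^ (2 * alpha / (1 + 2 * alpha)).

Lemma rate_sqr lambda alpha n : rate lambda alpha n ^+ 2 = sqr_rate lambda alpha n.
Proof.
rewrite /rate /sqr_rate -powR_mulrn ?powR_ge0// -powRrM; congr (_ `^ _); ring.
Qed.

(** The rates are positive, hence the supremum is finite if and only if the risk
    is at most a constant times the squared rate. *)
Lemma maxisetP d (T : measurableType d) (P : probability T R) W (N : set nat)
    sh lambda alpha s :
  (forall n, N n -> 0 < unit_penalty lambda n) ->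
  maxiset P W N sh (rate lambda alpha) s <->
  L2 (mu01 R) s /\ exists C : R, forall n, N n ->
    (risk P W sh n s <= (C * sqr_rate lambda alpha n)%:E)%E.
Proof.
move=> p0.
have r0 n : N n -> 0 < rate lambda alpha n ^+ 2.
  by move=> Nn; rewrite rate_sqr powR_gt0// p0.
have risk0 n : (0 <= risk P W sh n s)%E.
  by rewrite /risk unlock; apply: integral_ge0 => w _; rewrite lee_fin sqr_ge0.
split=> [[sL]|[sL [C hC]]]; last first.
  split=> //; apply: (@le_lt_trans _ _ C%:E); last by rewrite ltry.
  apply: ge_ereal_sup => _ [n Nn <-].
  rewrite muleC lee_pdivrMr ?r0//.
  by rewrite -EFinM rate_sqr; exact: hC.
set M := ereal_sup _ => Mlt; split=> //; exists (fine M) => n Nn.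
have hM : ((rate lambda alpha n ^- 2)%:E * risk P W sh n s <= M)%E.
  by apply: ereal_sup_ubound; exists n.
have M0 : (0 <= M)%E.
  by apply: le_trans hM; rewrite mule_ge0// lee_fin invr_ge0 ltW// r0.
rewrite EFinM fineK; last by rewrite ge0_fin_numE.
by rewrite -rate_sqr -lee_pdivrMr ?r0// muleC.
Qed.

Section regime_facts.
Variables (N : set nat) (lambda : nat -> R) (lmin pmin pmax : R).
Hypothesis hreg : regime N lambda lmin pmin pmax.
Variable j0 : nat -> int.
Hypothesis hj0 : maximal_level N lambda j0.

Let p := unit_penalty lambda.

Lemma unit_penalty_gt0 n : N n -> 0 < p n.
Proof.
move=> Nn; rewrite divr_gt0 ?ltr0n ?(regime_gt0 hreg Nn)//.
exact: lt_le_trans (regime_lmin0 hreg) (regime_lmin hreg Nn).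
Qed.

Lemma unit_penaltyV n : N n -> n%:R / lambda n = (p n)^-1.
Proof. by move=> Nn; rewrite /p /unit_penalty invf_div. Qed.

Lemma top_level_le n : N n -> 2 ^+ top_level (j0 n) <= pmax / p n.
Proof.
move=> Nn; have p0 := unit_penalty_gt0 Nn.
have [] := andP (hj0 Nn); rewrite unit_penaltyV// => h _.
rewrite ler_pdivlMr//; have := regime_pmax1 hreg.
case: (j0 n) h => l /=.
  move=> h p1; apply: le_trans p1.
  by rewrite -ler_pdivlMr// mul1r.
by move=> _ _; rewrite expr0 mul1r; exact: (regime_pmax hreg Nn).
Qed.

Lemma top_level_gt n : N n -> (p n)^-1 < 2 * 2 ^+ top_level (j0 n).
Proof.
move=> Nn; have [] := andP (hj0 Nn); rewrite unit_penaltyV// => _ h.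
apply: (lt_le_trans h); case: (j0 n) => l /=.
  by rewrite -PoszD addn1 -exprS.
have -> : Negz l + 1 = - l%:Z by rewrite NegzE -addn1 PoszD opprD addrNK.
rewrite expr0 mulr1 -exprnN; apply: (@le_trans _ _ 1); last by rewrite ler1n.
by rewrite invf_le1 ?exprn_gt0// exprn_ege1// ler1n.
Qed.

End regime_facts.

End maxisets.

(** * Maxisets as approximation classes *)

(** The number of levels is negligible with respect to any power of the number of
    coefficients. *)
Lemma level_count_le (R : realType) (eps : R) : 0 < eps ->
  exists2 c : R, 0 < c & forall L : nat, L.+1%:R <= c * (2 ^+ L) `^ eps.
Proof.
move=> e0; have l2 : 0 < ln 2 :> R by rewrite ln_gt0// ltr1n.
exists (1 + (eps * ln 2)^-1); first by rewrite addr_gt0// invr_gt0 mulr_gt0.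
move=> L; have d0 : 0 < eps * ln 2 by rewrite mulr_gt0.
have -> : (2 ^+ L) `^ eps = expR (eps * ln 2 * L%:R) :> R.
  rewrite /powR gt_eqF ?exprn_gt0// lnXn//; congr expR.
  by rewrite -[ln 2 *+ L]mulr_natr mulrA.
have h := expR_ge1Dx (eps * ln 2 * L%:R).
have c0 : 0 <= 1 + (eps * ln 2)^-1 by rewrite addr_ge0// invr_ge0 ltW.
apply: le_trans (ler_wpM2l c0 h).
move: (eps * ln 2) d0 c0 h => a a0 _ _.
have -> : (1 + a^-1) * (1 + a * L%:R) = 1 + a * L%:R + a^-1 + L%:R.
  by field; rewrite gt_eqF.
have : 0 <= a * L%:R by rewrite mulr_ge0// ltW.
have : 0 < a^-1 by rewrite invr_gt0.
rewrite -natr1; lra.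
Qed.

Section approximation.
Variables (R : realType) (phi psi : R -> R).
Hypothesis hb : wavelet_basis phi psi.
Variables (N : set nat) (lambda : nat -> R) (lmin pmin pmax : R).
Hypothesis hreg : regime N lambda lmin pmin pmax.
Variable j0 : nat -> int.
Hypothesis hj0 : maximal_level N lambda j0.
Variable alpha : R.
Hypothesis alpha0 : 0 < alpha.

Let p := unit_penalty lambda.
Let gamma : R := 2 * alpha / (1 + 2 * alpha).
Let L n := top_level (j0 n).
Let rho2 := sqr_rate lambda alpha.

(** The deterministic counterpart of the maxiset: at each sample size some model
    balances bias and penalty at the rate. *)
Definition approximated (Val : set nat)
    (Lab : nat -> set coef_index -> R -> Prop) (s : R -> R) :=
  exists K, forall n, Val n -> exists A D, Lab n A D /\
    bias phi psi s (L n) A + p n * D <= K * rho2 n.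

Lemma gamma01 : 0 < gamma < 1.
Proof.
have a1 : 0 < 1 + 2 * alpha by rewrite addr_gt0// mulr_gt0.
apply/andP; split; first by rewrite divr_gt0// mulr_gt0.
by rewrite ltr_pdivrMr// mul1r ltrDr ltr01.
Qed.

Lemma rho2_gt0 n : N n -> 0 < rho2 n.
Proof. by move=> Nn; rewrite powR_gt0// (unit_penalty_gt0 hreg Nn). Qed.

(** The parametric rate [1 / n] is below the squared rate, even with one factor
    per level ([level_count_size]), since [gamma < 1]. *)
Lemma inv_size_le n : N n -> n%:R^-1 <= pmax / lmin * rho2 n.
Proof.
move=> Nn; have p0 := unit_penalty_gt0 hreg Nn.
have n0 : 0 < n%:R :> R by rewrite ltr0n (regime_gt0 hreg).
have lm := regime_lmin hreg Nn; have lm0 := regime_lmin0 hreg.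
have [g0 g1] := andP gamma01.
have h1 : p n <= pmax * rho2 n.
  have -> : p n = p n `^ (1 - gamma) * rho2 n.
    rewrite /rho2 /sqr_rate -/gamma -/(p n) -powRD; last by rewrite (gt_eqF p0) implybT.
    by rewrite subrK powRr1// ltW.
  rewrite ler_wpM2r ?(ltW (rho2_gt0 Nn))//.
  apply: (@le_trans _ _ (pmax `^ (1 - gamma))).
    rewrite ge0_ler_powR ?nnegrE ?subr_ge0 ?(ltW g1) ?(ltW p0)//.
      by rewrite (le_trans ler01)// (regime_pmax1 hreg).
    exact: (regime_pmax hreg Nn).
  apply: ler1_powR; first exact: (regime_pmax1 hreg).
  by rewrite gerBl ltW.
have l0 : 0 < lambda n by exact: lt_le_trans lm0 lm.
have -> : n%:R^-1 = p n / lambda n.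
  by rewrite /p /unit_penalty; field; rewrite !gt_eqF.
rewrite [leRHS]mulrAC ler_pM// ?invr_ge0 ?(ltW p0) ?(ltW l0)//.
by rewrite lef_pV2 ?posrE.
Qed.

Lemma level_count_size : exists2 c : R, 0 < c & forall n, N n ->
  (L n).+1%:R / n%:R <= c * rho2 n.
Proof.
have [g0 g1] := andP gamma01.
have [c c0 hc] := @level_count_le R (1 - gamma) ltac:(by rewrite subr_gt0).
have lm0 := regime_lmin0 hreg; have pm1 := regime_pmax1 hreg.
exists (c * pmax `^ (1 - gamma) / lmin).
  by rewrite divr_gt0// mulr_gt0// powR_gt0// (lt_le_trans ltr01).
move=> n Nn; have p0 := unit_penalty_gt0 hreg Nn.
have n0 : 0 < n%:R :> R by rewrite ltr0n (regime_gt0 hreg).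
have lm := regime_lmin hreg Nn.
have hp : (p n)^-1 `^ (1 - gamma) * p n = rho2 n.
  rewrite -powR_inv1 ?(ltW p0)// -powRrM -[X in _ * X](powRr1 (ltW p0)) -powRD.
    by congr (_ `^ _); rewrite -/gamma; ring.
  by rewrite (gt_eqF p0) implybT.
have h1 : (L n).+1%:R <= c * (pmax `^ (1 - gamma) * (p n)^-1 `^ (1 - gamma)).
  apply: (le_trans (hc _)); rewrite ler_wpM2l ?(ltW c0)//.
  rewrite -powRM ?invr_ge0 ?(ltW p0)//; last by rewrite (le_trans ler01).
  have tl : 2 ^+ L n <= pmax / p n by exact: (top_level_le hreg hj0 Nn).
  have pp : 0 <= pmax / p n by rewrite divr_ge0 ?(ltW p0)// (le_trans ler01).
  by rewrite ge0_ler_powR ?nnegrE ?subr_ge0 ?(ltW g1) ?exprn_ge0.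
have l0 : 0 < lambda n by exact: lt_le_trans lm0 lm.
have -> : (L n).+1%:R / n%:R = (L n).+1%:R * p n / lambda n.
  by rewrite /p /unit_penalty; field; rewrite !gt_eqF.
have h2 := ler_wpM2r (ltW p0) h1.
apply: (@le_trans _ _ (c * pmax `^ (1 - gamma) * rho2 n / lambda n)).
  rewrite ler_wpM2r ?invr_ge0 ?(ltW l0)//.
  by apply: (le_trans h2); rewrite -hp !mulrA.
rewrite mulrAC; apply: ler_wpM2r; first exact: (ltW (rho2_gt0 Nn)).
apply: ler_wpM2l; first by rewrite mulr_ge0 ?(ltW c0)// powR_ge0.
by rewrite lef_pV2 ?posrE.
Qed.

Lemma bias_mono s l1 l2 (A B : set coef_index) : (l1 <= l2)%N ->
  (forall i, i \in levels l1 -> A i -> B i) ->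
  bias phi psi s l2 B <= bias phi psi s l1 A.
Proof.
move=> l12 AB; rewrite /bias lerD2l lerN2 /coefs_energy.
pose F i := inner (mu01 R) (wavelet phi psi i) s ^+ 2.
have F0 i : 0 <= F i by exact: sqr_ge0.
have sub i : i \in levels l1 -> i \in levels l2.
  rewrite !mem_levels; case: i => [[j k]|]// /andP[jl ->].
  by rewrite (leq_trans jl l12).
have pe : perm_eq (levels l1) [seq i <- levels l2 | i \in levels l1].
  apply: uniq_perm; rewrite ?filter_uniq ?levels_uniq// => i.
  by rewrite mem_filter; apply/idP/andP => [il|[]//]; split=> //; exact: sub.
rewrite (perm_big _ pe) big_filter_cond [leLHS]big_mkcond [leRHS]big_mkcond.
apply: ler_sum => i _; case: ifP => [/andP[il /set_mem Ai]|_].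
  by rewrite mem_set//; exact: AB.
by case: ifP => _; rewrite ?sqr_ge0.
Qed.

Lemma top_level_mono n m : N n -> N m -> p n <= p m -> (L m <= L n)%N.
Proof.
move=> Nn Nm pnm; have pn0 := unit_penalty_gt0 hreg Nn.
have pm0 := unit_penalty_gt0 hreg Nm.
have hn := top_level_gt hj0 Nn.
case Lm : (L m) => [//|l].
have : 2 ^+ L m <= (p m)^-1.
  have [] := andP (hj0 Nm); rewrite (unit_penaltyV _ Nm) => h _.
  by move: Lm h; rewrite /L /top_level; case: (j0 m).
have : (p m)^-1 <= (p n)^-1 by rewrite lef_pV2 ?posrE.
move=> h1 h2; have : 2 ^+ L m < 2 ^+ (L n).+1 :> R.
  by rewrite exprS; apply: le_lt_trans hn; exact: le_trans h1.
by rewrite ltr_eXn2l ?ltr1n// Lm ltnS.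
Qed.

Section estimator.
Context d (T : measurableType d) (P : probability T R).
Variables (W : (R -> R) -> T -> R).
Hypothesis hW : white_noise P W.
Variables (Lab : nat -> set coef_index -> R -> Prop) (sh : estimator R).
Hypothesis Lab0 : forall n A D, Lab n A D -> 0 <= D.
Variable Val : set nat.
Hypothesis ValN : forall n, Val n -> N n.
Hypothesis hsel : forall n y, Val n -> linear_on_L2 y ->
  exists A D, selected (L n) (Lab n) (p n) (y \o wavelet phi psi) A D /\
    sh n y = \sum_(i <- levels (L n) | i \in A) y (wavelet phi psi i) *: wavelet phi psi i.

Let p0 n : Val n -> 0 < p n.
Proof. by move=> /ValN; exact: unit_penalty_gt0 hreg _. Qed.

(** The risk is at most a multiple of the penalized bias of the best model, plus
    the expectation of the noise that the penalty does not cover. *)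
Lemma maxiset_of_approximated (c : R) s : L2 (mu01 R) s ->
  (forall n, Val n -> exists Z : T -> R, [/\ measurable_fun setT Z, forall w, 0 <= Z w,
     (\int[P]_w (Z w)%:E <= (c * rho2 n)%:E)%E &
     forall A D w, Lab n A D ->
       noise_energy phi psi W n (L n) A w <= p n * D / 12 + Z w]) ->
  approximated Val Lab s -> maxiset P W Val sh (rate lambda alpha) s.
Proof.
move=> sL hZ [K hK]; apply/(maxisetP _ _ _ _ _ p0); split=> //.
exists (2 * K + 13 * c) => n Vn.
have [Z [mZ Z0 Zc hZn]] := hZ n Vn.
have [A [D [hA hAD]]] := hK n Vn.
have := risk_upper hb hW sL (ltW (p0 Vn)) (@Lab0 n) (fun y => hsel Vn) mZ Z0 Zc hZn hA.
rewrite /risk unlock => h; apply: (le_trans h); rewrite lee_fin.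
have -> : (2 * K + 13 * c) * rho2 n = 2 * (K * rho2 n) + 13 * (c * rho2 n) by ring.
by apply: lerD => //; exact: ler_wpM2l.
Qed.

(** [risk_lower] bounds the bias of nearly optimal models at each sample size;
    [penalized_bias_of_bias] converts this into a bound on the penalized bias. *)
Lemma approximated_of_maxiset (qmin : R) s : 0 < qmin ->
  (forall n, Val n -> exists E : set T, [/\ measurable E, ((2^-1)%:E <= P E)%E &
     forall A D w, Lab n A D -> E w ->
       noise_energy phi psi W n (L n) A w <= p n * D / 12]) ->
  (forall n A D A' D', Lab n A D -> Lab n A' D' -> D' <= D \/ 2 * D <= D') ->
  (forall n, Val n -> exists A D, Lab n A D /\ D <= 2) ->
  (forall n m A D, Val n -> Val m -> (L m <= L n)%N -> Lab m A D -> Lab n A D) ->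
  (forall n, Val n -> qmin <= p n \/
     exists m, [/\ (m < n)%N, Val m, p n <= 5 / 8 * p m & p m <= 4 * p n]) ->
  maxiset P W Val sh (rate lambda alpha) s -> approximated Val Lab s.
Proof.
move=> q0 hE hgap hbase htrans hdesc /(maxisetP _ _ _ _ _ p0)[sL [C hC]].
pose Phi n b D := exists A, Lab n A D /\ b = bias phi psi s (L n) A.
have Cn n : Val n -> (risk P W sh n s <= (`|C| * rho2 n)%:E)%E.
  move=> Vn; apply: (le_trans (hC n Vn)); rewrite lee_fin ler_wpM2r ?ler_norm//.
  exact: powR_ge0.
have [K hK] := @penalized_bias_of_bias R Val p Phi gamma pmax qmin
  (inner (mu01 R) s s) 2 (4 * `|C| + 2) gamma01 q0
  ltac:(by rewrite addr_ge0// mulr_ge0)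
  (fun n Vn => introT andP (conj (p0 Vn) (regime_pmax hreg (ValN Vn))))
  ltac:(by move=> n b D [A [hA ->]]; split; [exact: bias_ge0|exact: Lab0 hA])
  ltac:(by move=> n Vn; have [A [D [hA D2]]] := hbase n Vn;
     exists (bias phi psi s (L n) A), D; split=> //; [exists A|
       rewrite gerBl; apply: sumr_ge0 => i _; exact: sqr_ge0])
  hdesc
  ltac:(by move=> n m b D Vn Vm pnm [A [hA ->]];
     have Lmn := top_level_mono (ValN Vn) (ValN Vm) pnm;
     exists (bias phi psi s (L n) A), D; split=> //;
     [exists A; split=> //; exact: htrans hA|exact: bias_mono])
  ltac:(move=> n b D Vn [A [hA ->]] hmin;
     have [E [mE PE hEn]] := hE n Vn;
     have hr := Cn n Vn; rewrite /risk unlock in hr;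
     have := risk_lower hb hW sL (ltW (p0 Vn)) (@Lab0 n) (fun y => hsel Vn)
       mE PE hEn (@hgap n) (powR_ge0 (p n) gamma) hA
       (fun A' D' hA' => hmin _ _ (ex_intro _ A' (conj hA' erefl))) hr;
     move=> h; apply: (le_trans h);
     rewrite le_eqVlt; apply/orP; left; apply/eqP;
     rewrite -[rho2 n]/(p n `^ gamma); ring).
exists K => n Vn; have [b [D [[A [hA ->]] h]]] := hK n Vn.
by exists A, D.
Qed.

End estimator.

End approximation.

(** * The two regimes of the penalty *)

Section regimes.
Variable R : realType.

Lemma quarter_size n : (16 <= n)%N ->
  [/\ (4 <= (n + 3) %/ 4)%N, ((n + 3) %/ 4 < n)%N, (n <= 4 * ((n + 3) %/ 4))%N &
      (16 * ((n + 3) %/ 4) <= 5 * n)%N].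
Proof. by move=> n16; split; lia. Qed.

(** From [n] the descent passes to the integer next to [n / 4]. *)
Lemma regime_log (lambda0 : R) : 1 <= lambda0 ->
  regime [set n : nat | (2 <= n)%N] (fun n => lambda0 * ln n%:R)
    (lambda0 * ln 2) (lambda0 * ln 2 / 16) lambda0.
Proof.
move=> l1; have l0 : 0 < lambda0 by lra.
have ln20 : 0 < ln 2 :> R by rewrite ln_gt0// ltr1n.
have ln_mono (a b : nat) : (0 < a)%N -> (a <= b)%N -> ln a%:R <= ln b%:R :> R.
  by move=> a0 ab; rewrite ler_ln ?posrE ?ltr0n ?ler_nat// (leq_trans a0).
split=> //=.
- by move=> n /ltnW.
- by rewrite mulr_gt0.
- by move=> n n2; rewrite ler_wpM2l ?(ltW l0)//; exact: (ln_mono 2).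
- by rewrite divr_gt0// mulr_gt0.
- move=> n n2; have n0 : 0 < n%:R :> R by rewrite ltr0n ltnW.
  rewrite /unit_penalty ler_pdivrMr// ler_wpM2l ?(ltW l0)//.
  by apply: ltW; exact: ln_sublinear.
move=> n n2; have n0 : 0 < n%:R :> R by rewrite ltr0n ltnW.
have lnn : ln 2 <= ln n%:R :> R by exact: (ln_mono 2).
have [n16|n16] := ltnP n 16.
  left; rewrite /unit_penalty; apply: ler_pM => //.
  - by rewrite mulr_ge0 ?ltW.
  - by rewrite ler_wpM2l// ltW.
  - by rewrite lef_pV2 ?posrE// ler_nat ltnW.
right; have [m4 mn nm m5] := quarter_size n16; set m := ((n + 3) %/ 4)%N in m4 mn nm m5 *.
have m0 : 0 < m%:R :> R by rewrite ltr0n (leq_trans _ m4).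
exists m; split=> //; first by rewrite (leq_trans _ m4).
- have h1 : ln n%:R <= 2 * ln m%:R :> R.
    apply: (@le_trans _ _ (ln (m * m)%:R)).
      apply: ln_mono; first exact: ltnW.
      by apply: (leq_trans nm); rewrite leq_mul2r m4 orbT.
    by rewrite natrM lnM ?posrE// mulr2n mulrDl !mul1r.
  have y0 : 0 <= ln m%:R :> R by rewrite ln_ge0// ler1n (leq_trans _ m4).
  rewrite /unit_penalty -subr_ge0.
  have -> : 5 / 8 * (lambda0 * ln m%:R / m%:R) - lambda0 * ln n%:R / n%:R =
      lambda0 * (ln m%:R * (5 * n%:R) - ln n%:R * (8 * m%:R)) / (8 * m%:R * n%:R) :> R.
    by field; rewrite !gt_eqF.
  have h2 : 16 * m%:R <= 5 * n%:R :> R by rewrite -!natrM ler_nat.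
  rewrite divr_ge0 ?mulr_ge0 ?(ltW l0) ?ler0n// subr_ge0.
  apply: (@le_trans _ _ (ln m%:R * (16 * m%:R))); last exact: ler_wpM2l.
  have -> : ln m%:R * (16 * m%:R) = 2 * ln m%:R * (8 * m%:R) :> R by ring.
  by rewrite ler_wpM2r// mulr_ge0 ?ler0n.
- have h1 : ln m%:R <= ln n%:R :> R by rewrite ln_mono ?(leq_trans _ m4) ?(ltnW mn).
  have x0 : 0 <= ln n%:R :> R by rewrite ln_ge0// ler1n ltnW.
  rewrite /unit_penalty -subr_ge0.
  have -> : 4 * (lambda0 * ln n%:R / n%:R) - lambda0 * ln m%:R / m%:R =
      lambda0 * (ln n%:R * (4 * m%:R) - ln m%:R * n%:R) / (m%:R * n%:R) :> R.
    by field; rewrite !gt_eqF.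
  have h2 : n%:R <= 4 * m%:R :> R by rewrite -natrM ler_nat.
  rewrite divr_ge0 ?mulr_ge0 ?(ltW l0) ?ler0n// subr_ge0.
  apply: (@le_trans _ _ (ln n%:R * n%:R)); last exact: ler_wpM2l.
  by rewrite ler_wpM2r// ler0n.
Qed.

Lemma regime_const (lambda0 : R) : 1 <= lambda0 ->
  regime [set n : nat | (1 <= n)%N] (fun=> lambda0) lambda0 (lambda0 / 16) lambda0.
Proof.
move=> l1; have l0 : 0 < lambda0 by lra.
split=> //=; first by rewrite divr_gt0.
  move=> n n1; have n0 : 0 < n%:R :> R by rewrite ltr0n.
  by rewrite /unit_penalty ler_pdivrMr// ler_peMr ?ler1n// ltW.
move=> n n1; have n0 : 0 < n%:R :> R by rewrite ltr0n.
have [n16|n16] := ltnP n 16.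
  left; rewrite /unit_penalty ler_wpM2l ?(ltW l0)//.
  by rewrite lef_pV2 ?posrE// ler_nat ltnW.
right; have [m4 mn nm m5] := quarter_size n16; set m := ((n + 3) %/ 4)%N in m4 mn nm m5 *.
have m0 : 0 < m%:R :> R by rewrite ltr0n (leq_trans _ m4).
have h2 : 16 * m%:R <= 5 * n%:R :> R by rewrite -!natrM ler_nat.
have h3 : n%:R <= 4 * m%:R :> R by rewrite -natrM ler_nat.
exists m; split=> //; first by rewrite (leq_trans _ m4).
- rewrite /unit_penalty -subr_ge0.
  have -> : 5 / 8 * (lambda0 / m%:R) - lambda0 / n%:R =
      lambda0 * (5 * n%:R - 8 * m%:R) / (8 * m%:R * n%:R) :> R.
    by field; rewrite !gt_eqF.
  by rewrite divr_ge0 ?mulr_ge0 ?(ltW l0) ?ler0n// subr_ge0; lra.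
rewrite /unit_penalty -subr_ge0.
have -> : 4 * (lambda0 / n%:R) - lambda0 / m%:R =
    lambda0 * (4 * m%:R - n%:R) / (m%:R * n%:R) :> R.
  by field; rewrite !gt_eqF.
by rewrite divr_ge0 ?mulr_ge0 ?(ltW l0) ?ler0n// subr_ge0; lra.
Qed.

End regimes.

(** * Inclusions *)

Section hybrid_example_sets.
Variables (R : realType) (theta : R).
Hypothesis th2 : 2 < theta.

Lemma hybrid_card_bound J j : (J <= j)%N -> (hybrid_card theta J j <= 2 ^ J)%N.
Proof.
move=> Jj; have := hybrid_card_le theta J j.
rewrite -(ler_nat R) natrX => h; apply: (le_trans h).
rewrite ler_piMr ?exprn_ge0// addn1 powRN invf_le1 ?powR_gt0 ?ltr0n//.
by rewrite -[leLHS](powRr0 (j - J).+1%:R) ler_powR ?ler1n//; have := th2; lra.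
Qed.

(** One witness among the hybrid sets of base level [J] suffices for functions
    whose coefficients sit at known positions. *)
Definition low_hybrid_set (J : nat) : set (nat * nat) :=
  (sieve_set J) `|`
  \bigcup_(j in [set j | (J <= j)%N]) [set (j, k) | k in `I_(hybrid_card theta J j)].

Lemma low_hybrid_setP J : hybrid_sets theta J (low_hybrid_set J).
Proof.
exists (fun j => `I_(hybrid_card theta J j)); split=> // j Jj; split; last first.
  exact: card_eqxx.
move=> k /= hk; apply: (leq_trans hk); apply: (leq_trans (hybrid_card_bound Jj)).
by rewrite leq_exp2l.
Qed.

Lemma hybrid_size0 : hybrid_size theta 0 = 2%N.
Proof.
rewrite /hybrid_size expn0 big_nat1 /hybrid_card addn0 subnn add0n.
by rewrite powR1 expr0 mulr1 truncn1.
Qed.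

End hybrid_example_sets.

Section families.
Variables (R : realType) (phi psi : R -> R).
Hypothesis hb : wavelet_basis phi psi.
Variables (theta alpha : R).
Hypothesis th2 : 2 < theta.
Hypothesis alpha0 : 0 < alpha.

Lemma hybrid_label_gt0 A D : hybrid_label theta A D -> 0 <= D.
Proof. by move=> [J [S [_ _ ->]]]; rewrite ler0n. Qed.

Lemma sieve_label_gt0 j0 A D : sieve_label j0 A D -> 0 <= D :> R.
Proof. by move=> [N [_ _ ->]]; rewrite exprn_ge0. Qed.

Lemma large_label_gt0 j0 A D : large_label j0 A D -> 0 <= D :> R.
Proof. by move=> [S [_ _ ->]]; rewrite ler0n. Qed.

Section size_regime.
Variables (N : set nat) (lambda : nat -> R) (lmin pmin pmax : R).
Hypothesis hreg : regime N lambda lmin pmin pmax.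
Variable j0 : nat -> int.
Hypothesis hj0 : maximal_level N lambda j0.

Let p := unit_penalty lambda.
Let Val := nonempty_sizes N (sieve_models phi psi j0).

Let p_size n : N n -> p n * n%:R = lambda n.
Proof.
by move=> Nn; rewrite /p /unit_penalty divfK// pnatr_eq0 -lt0n (regime_gt0 hreg).
Qed.

(** Where the descent leaves the sample sizes with a sieve model, the maximal
    level is not positive, so that [n] is comparable to [lambda n]. *)
Lemma sieve_descent n : Val n ->
  Num.min pmin (8%:R^-1) <= p n \/
  exists m, [/\ (m < n)%N, Val m, p n <= 5 / 8 * p m & p m <= 4 * p n].
Proof.
move=> /nonempty_sieve[Nn jn].
have [le|[m [mn Nm h1 h2]]] := regime_descent hreg Nn.
  by left; rewrite ge_min le.
have [jm|jm] := ltP 0 (j0 m).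
  by right; exists m; split=> //; apply/nonempty_sieve.
left; have := top_level_gt hj0 Nm.
have -> : top_level (j0 m) = 0%N by case: (j0 m) jm => // -[].
rewrite expr0 mulr1 => h; have pm0 := unit_penalty_gt0 hreg Nm.
have : 2^-1 < unit_penalty lambda m.
  by rewrite -[ltRHS]invrK ltf_pV2 ?posrE ?invr_gt0.
rewrite ge_min => h3; apply/orP; right; rewrite /p; lra.
Qed.

Lemma sieve_label_mono n m A D : (top_level (j0 m) <= top_level (j0 n))%N ->
  @sieve_label R (j0 m) A D -> sieve_label (j0 n) A D.
Proof.
move=> mn [k [km AE DE]]; exists k; split=> //.
move: mn km; case: (j0 m) => // a; case: (j0 n) => [b|b] /=.
  by move=> ab; rewrite !ltz_nat => /leq_trans; apply.
by rewrite leqn0 => /eqP ->; rewrite ltz_nat.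
Qed.

Section noise.
Variable C : R.
Hypothesis C0 : 0 < C.
Hypothesis hC : noise_constant phi psi theta C.
Hypothesis C_lmin : C <= lmin.

Let C_size n : N n -> C <= p n * n%:R.
Proof.
by move=> Nn; rewrite p_size//; apply: (le_trans C_lmin); exact: (regime_lmin hreg Nn).
Qed.

Context d (T : measurableType d) (P : probability T R).
Variables (W : (R -> R) -> T -> R).
Hypothesis hW : white_noise P W.

Lemma sieve_maxiset_approximated sh s :
  sieve_estimator phi psi N lambda j0 sh ->
  maxiset P W Val sh (rate lambda alpha) s ->
  approximated phi psi lambda j0 alpha Val (fun n => sieve_label (j0 n)) s.
Proof.
move=> hsh; apply: (approximated_of_maxiset hb hreg hj0 alpha0 hW
  (Lab := fun n => sieve_label (j0 n)) _ _ _ (qmin := Num.min pmin (8%:R^-1))).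
- by move=> n A D; exact: sieve_label_gt0.
- by move=> n /nonempty_sieve[].
- by move=> n y /nonempty_sieve[Nn jn] ly; exact: (sieve_selected hb hsh Nn jn ly).
- by rewrite lt_min (regime_pmin0 hreg) invr_gt0 ltr0n.
- move=> n /nonempty_sieve[Nn jn]; have [_] := hC hW (regime_gt0 hreg Nn) (C_size Nn)
    (@sieve_label_profile R theta (top_level (j0 n)) (j0 n)).
  exact.
- move=> n A D A' D' [k [_ _ ->]] [k' [_ _ ->]].
  have [le|lt] := leqP k' k; [left|right].
    by rewrite ler_weXn2l// ler1n.
  by rewrite -exprS ler_weXn2l// ler1n.
- move=> n /nonempty_sieve[Nn jn].
  exists (with_scaling (sieve_set 0)), 1; split; last by lra.
  by exists 0%N.
- by move=> n m A D _ _; exact: sieve_label_mono.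
- exact: sieve_descent.
Qed.

Lemma hybrid_maxiset_approximated sh s :
  hybrid_estimator theta phi psi N lambda j0 sh ->
  maxiset P W N sh (rate lambda alpha) s ->
  approximated phi psi lambda j0 alpha N (fun=> hybrid_label theta) s.
Proof.
move=> hsh; apply: (approximated_of_maxiset hb hreg hj0 alpha0 hW
  (Lab := fun=> hybrid_label theta) _ _ _ (qmin := pmin)) => //.
- by move=> n A D; exact: hybrid_label_gt0.
- move=> n y Nn ly.
  exact: (hybrid_selected hb th2 hsh Nn (ltW (unit_penalty_gt0 hreg Nn)) ly).
- exact: (regime_pmin0 hreg).
- move=> n Nn; have [_] := hC hW (regime_gt0 hreg Nn) (C_size Nn)
    (@hybrid_label_profile R theta (top_level (j0 n))).
  exact.
- move=> n A D A' D' [J [S [_ _ ->]]] [J' [S' [_ _ ->]]].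
  by have [h|h] := @hybrid_size_gap R theta J J'; [left|right]; rewrite -?natrM ler_nat.
- move=> n Nn; exists (with_scaling (low_hybrid_set theta 0)), 2%:R; split=> //.
  exists 0%N, (low_hybrid_set theta 0); split=> //; first exact: low_hybrid_setP.
  by rewrite hybrid_size0.
- exact: (regime_descent hreg).
Qed.

Lemma hybrid_approximated_maxiset sh s : L2 (mu01 R) s ->
  hybrid_estimator theta phi psi N lambda j0 sh ->
  approximated phi psi lambda j0 alpha N (fun=> hybrid_label theta) s ->
  maxiset P W N sh (rate lambda alpha) s.
Proof.
move=> sL hsh; have [c c0 hc] := level_count_size hreg hj0 alpha0.
apply: (maxiset_of_approximated hb hreg hW (Lab := fun=> hybrid_label theta)
  _ _ _ (c := C * c)) => //.
- by move=> n A D; exact: hybrid_label_gt0.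
- move=> n y Nn ly.
  exact: (hybrid_selected hb th2 hsh Nn (ltW (unit_penalty_gt0 hreg Nn)) ly).
move=> n Nn; have [[Z [mZ Z0 hZ hN]] _] := hC hW (regime_gt0 hreg Nn) (C_size Nn)
    (@hybrid_label_profile R theta (top_level (j0 n))).
exists Z; split=> //; apply: (le_trans hZ); rewrite lee_fin -!mulrA.
by rewrite ler_wpM2l ?(ltW C0)// hc.
Qed.

End noise.

Lemma large_approximated_maxiset d (T : measurableType d) (P : probability T R)
    (W : (R -> R) -> T -> R) sh s :
  48 <= lmin -> (forall n, N n -> 32 * ln n%:R <= lambda n) ->
  white_noise P W -> L2 (mu01 R) s ->
  large_estimator phi psi N lambda j0 sh ->
  approximated phi psi lambda j0 alpha N (fun n => large_label (j0 n)) s ->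
  maxiset P W N sh (rate lambda alpha) s.
Proof.
move=> l48 l32 hW sL hsh; have lm0 := regime_lmin0 hreg.
have pm1 := regime_pmax1 hreg.
apply: (maxiset_of_approximated hb hreg hW (Lab := fun n => large_label (j0 n))
  _ _ _ (c := 12 * (pmax / lmin) * (pmax / lmin))) => //.
- by move=> n A D; exact: large_label_gt0.
- by move=> n y Nn ly; exact: (large_selected hb hsh Nn ly).
move=> n Nn; have n0 : 0 < n%:R :> R by rewrite ltr0n (regime_gt0 hreg).
have lm := regime_lmin hreg Nn.
have [Z [mZ Z0 hZ hN]] := large_noise hb (j0 n) hW (regime_gt0 hreg Nn)
  (le_trans l48 lm).
exists Z; split=> //; apply: (le_trans hZ); rewrite lee_fin.
have h1 : expR (- (lambda n / 32)) <= n%:R^-1.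
  rewrite -[leRHS](lnK (x := n%:R^-1)) ?posrE ?invr_gt0// ler_expR lnV ?posrE//.
  by rewrite lerN2 ler_pdivlMr// mulrC l32.
have l0 : 0 < lambda n by exact: lt_le_trans lm0 lm.
have h2 : 2 ^+ top_level (j0 n) / n%:R <= pmax / lmin.
  have := top_level_le hreg hj0 Nn.
  rewrite -(ler_pM2r (x := n%:R^-1)) ?invr_gt0// => h; apply: (le_trans h).
  have -> : pmax / unit_penalty lambda n / n%:R = pmax / lambda n.
    by rewrite /unit_penalty; field; rewrite !gt_eqF.
  by rewrite ler_wpM2l ?(le_trans ler01)// lef_pV2 ?posrE.
have h3 := inv_size_le hreg alpha0 Nn.
have -> : 12 * 2 ^+ top_level (j0 n) * expR (- (lambda n / 32)) / n%:R =
    12 * ((2 ^+ top_level (j0 n) / n%:R) * expR (- (lambda n / 32))) by ring.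
have h4 : 2 ^+ top_level (j0 n) / n%:R * expR (- (lambda n / 32)) <=
    pmax / lmin * (pmax / lmin * sqr_rate lambda alpha n).
  have a0 : 0 <= 2 ^+ top_level (j0 n) / n%:R :> R.
    by rewrite divr_ge0 ?exprn_ge0// ltW.
  exact: (ler_pM a0 (expR_ge0 _) h2 (le_trans h1 h3)).
have -> : 12 * (pmax / lmin) * (pmax / lmin) * sqr_rate lambda alpha n =
    12 * (pmax / lmin * (pmax / lmin * sqr_rate lambda alpha n)) by ring.
by rewrite ler_wpM2l.
Qed.

(** The hybrid set with base level [k] contains the sieve below [k], at the cost
    of a constant factor in the dimension.  At the sample sizes without a sieve
    model the rate is bounded below, and the smallest hybrid model is enough. *)
Lemma sieve_hybrid_approximated s : L2 (mu01 R) s ->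
  approximated phi psi lambda j0 alpha Val (fun n => sieve_label (j0 n)) s ->
  approximated phi psi lambda j0 alpha N (fun=> hybrid_label theta) s.
Proof.
move=> sL [K hK]; pose c : R := 2 + (theta - 1)^-1.
have c1 : 1 <= c.
  have : 0 <= (theta - 1)^-1 by rewrite invr_ge0; have := th2; lra.
  rewrite /c; lra.
have [g0 g1] := andP (gamma01 alpha0).
have pm1 := regime_pmax1 hreg.
pose S2 := inner (mu01 R) s s.
have lab J : hybrid_label theta (with_scaling (low_hybrid_set theta J))
    ((hybrid_size theta J)%:R).
  by exists J, (low_hybrid_set theta J); split=> //; exact: low_hybrid_setP.
exists (Num.max (c * K) (2 * (S2 + pmax * 2))) => n Nn.
have r0 := rho2_gt0 hreg alpha Nn.
have p0 := unit_penalty_gt0 hreg Nn.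
have [jn|jn] := ltP 0 (j0 n).
  have [A [D [[k [kj -> ->]] h]]] := hK n ((nonempty_sieve _ _ _ _ _).2 (conj Nn jn)).
  exists (with_scaling (low_hybrid_set theta k)), (hybrid_size theta k)%:R; split=> //.
  have hd := hybrid_size_le th2 k; rewrite -/c in hd.
  set A1 := with_scaling _ in h; set A2 := with_scaling _.
  have hbias : bias phi psi s (top_level (j0 n)) A2 <= bias phi psi s (top_level (j0 n)) A1.
    apply: bias_mono => // i _ [->|[jk hjk <-]]; first by left.
    by right; exists jk => //; left.
  have b0 := bias_ge0 hb sL (top_level (j0 n)) A1.
  apply: (@le_trans _ _ (c * K * sqr_rate lambda alpha n)); last first.
    by rewrite ler_wpM2r ?(ltW r0)// le_max lexx.
  apply: (@le_trans _ _ (c * (bias phi psi s (top_level (j0 n)) A1 +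
      unit_penalty lambda n * 2 ^+ k))); last first.
    by rewrite -mulrA ler_wpM2l//; lra.
  rewrite mulrDr; apply: lerD.
    by apply: (le_trans hbias); rewrite ler_peMl.
  by rewrite mulrCA ler_wpM2l// ltW.
exists (with_scaling (low_hybrid_set theta 0)), (hybrid_size theta 0)%:R; split=> //.
rewrite hybrid_size0.
have r2 : 2^-1 <= sqr_rate lambda alpha n.
  have hp : 2^-1 <= unit_penalty lambda n.
    have := top_level_gt hj0 Nn.
    have -> : top_level (j0 n) = 0%N by case: (j0 n) jn => // -[].
    rewrite expr0 mulr1 => h; apply: ltW.
    by rewrite -[ltRHS]invrK ltf_pV2 ?posrE ?invr_gt0.
  apply: (@le_trans _ _ (2^-1 `^ (2 * alpha / (1 + 2 * alpha)))).
    by apply: ger1_powR; [lra|exact: ltW].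
  by rewrite ge0_ler_powR ?nnegrE ?(ltW g0) ?(ltW p0)// invr_ge0.
have S20 : 0 <= S2 by exact: dotf_ge0.
have hb2 : bias phi psi s (top_level (j0 n)) (with_scaling (low_hybrid_set theta 0)) <= S2.
  by rewrite gerBl; apply: sumr_ge0 => i _; exact: sqr_ge0.
have hp := regime_pmax hreg Nn.
apply: (@le_trans _ _ (S2 + pmax * 2)).
  by apply: lerD => //; rewrite ler_wpM2r.
apply: (@le_trans _ _ (2 * (S2 + pmax * 2) * sqr_rate lambda alpha n)).
  have q0 : 0 <= 2 * (S2 + pmax * 2) by lra.
  by have := ler_wpM2l q0 r2; lra.
by rewrite ler_wpM2r ?(ltW r0)// le_max lexx orbT.
Qed.

(** A truncated hybrid model belongs to the large family, in which it is penalized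
    for its truncated dimension only. *)
Lemma hybrid_large_approximated s :
  approximated phi psi lambda j0 alpha N (fun=> hybrid_label theta) s ->
  approximated phi psi lambda j0 alpha N (fun n => large_label (j0 n)) s.
Proof.
move=> [K hK]; exists K => n Nn; have [A [D [[J [S [hS -> ->]]] h]]] := hK n Nn.
have p0 := unit_penalty_gt0 hreg Nn.
have Sd := hybrid_sets_dyadic hS.
pose S' := S `&` below_level (j0 n).
have S'd : S' `<=` dyadic `&` below_level (j0 n).
  by move=> jk [Sjk bjk]; split=> //; exact: Sd.
exists (with_scaling S'), (size (coefs (top_level (j0 n)) (with_scaling S')))%:R.
split; first by exists S'.
apply: le_trans h; apply: lerD.
  apply: bias_mono => // i il [->|[jk hjk ijk]]; first by left.
  right; exists jk => //; split=> //; rewrite below_levelE /=.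
  by move: il; rewrite -ijk mem_levels; case: (jk) => j k /andP[].
rewrite ler_wpM2l ?(ltW p0)// ler_nat.
pose L' := maxn (top_level (j0 n)) (J + 2 ^ J).
rewrite -(size_coefs_hybrid th2 hS (leq_maxr (top_level (j0 n)) (J + 2 ^ J)) ).
apply: uniq_leq_size; first exact: coefs_uniq.
move=> i; rewrite !mem_filter => /andP[/set_mem iS' il].
apply/andP; split.
  apply/mem_set; case: iS' => [->|[jk [Sjk _] <-]]; first by left.
  by right; exists jk.
move: il; rewrite !mem_levels; case: (i) => [[j k]|]// /andP[jl ->].
by rewrite (leq_trans jl (leq_maxl _ _)).
Qed.

End size_regime.
End families.

(** * Series of square-integrable functions *)

Section square_integrable_series.
Context d (T : measurableType d) (R : realType).
Variable mu : {measure set T -> \bar R}.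
Local Notation L2f f := (f \in Lfun mu 2%:E).

(** Cauchy-Schwarz with the weights [a]. *)
Lemma sqr_sum_le (f a : nat -> R) : (forall j, 0 < a j) -> forall n,
  (\sum_(0 <= j < n) f j) ^+ 2 <=
  (\sum_(0 <= j < n) a j) * \sum_(0 <= j < n) f j ^+ 2 / a j.
Proof.
move=> a0; elim=> [|n IH]; first by rewrite !big_nil expr0n mul0r.
rewrite !big_nat_recr//=.
have A0 : 0 <= \sum_(0 <= j < n) a j by apply: sumr_ge0 => j _; exact: ltW.
have G0 : 0 <= \sum_(0 <= j < n) f j ^+ 2 / a j.
  by apply: sumr_ge0 => j _; rewrite divr_ge0 ?sqr_ge0 ?ltW.
move: (\sum_(0 <= j < n) f j) (\sum_(0 <= j < n) a j)
  (\sum_(0 <= j < n) f j ^+ 2 / a j) IH A0 G0 => S A G IH A0 G0.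
have u0 : 0 <= f n ^+ 2 / a n by rewrite divr_ge0 ?sqr_ge0 ?ltW.
have fE : f n ^+ 2 = a n * (f n ^+ 2 / a n) by field; rewrite gt_eqF.
move: (f n) (a n) (a0 n) (f n ^+ 2 / a n) u0 fE => x b b0 u u0 xE.
have key : 2 * (S * x) <= b * G + A * u.
  have r0 : 0 <= b * G + A * u by rewrite addr_ge0 ?mulr_ge0 ?(ltW b0).
  apply: (le_trans (ler_norm _)); rewrite -[leRHS]ger0_norm//.
  rewrite -ler_sqr ?nnegrE ?normr_ge0// -!normrX !ger0_norm ?sqr_ge0//.
  have : S ^+ 2 * x ^+ 2 <= (A * G) * (b * u) by rewrite xE ler_wpM2r ?mulr_ge0 ?(ltW b0).
  have := sqr_ge0 (b * G - A * u); nra.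
by rewrite sqrrD xE; move: key; rewrite -mulr_natl; lra.
Qed.

(** Riesz-Fischer for absolutely convergent series of norms.  The weighted sum of
    squares [G = sum (f j) ^ 2 / a j] has integral at most [A]; where it is finite the
    series converges absolutely, and the squares of the partial sums are dominated
    by [A * G], so that dominated convergence passes to the limit in the inner
    products. *)
Lemma Lfun2_series (f : nat -> T -> R) (a : nat -> R) (A : R) :
  (forall j, L2f (f j)) -> (forall j, 0 < a j) ->
  (forall j, dotf mu (f j) (f j) <= a j ^+ 2) ->
  (forall n, \sum_(0 <= j < n) a j <= A) ->
  exists2 s, L2f s &
    (forall h, L2f h ->
      dotf mu h (\sum_(0 <= j < n) f j) @[n --> \oo] --> dotf mu h s) /\
    dotf mu (\sum_(0 <= j < n) f j) (\sum_(0 <= j < n) f j) @[n --> \oo] -->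
      dotf mu s s.
Proof.
move=> fL a0 fa aA.
have A0 : 0 <= A by have := aA 0%N; rewrite big_nil.
pose q j x : \bar R := (f j x ^+ 2 / a j)%:E.
have q0 j x : (0 <= q j x)%E by rewrite lee_fin divr_ge0 ?sqr_ge0 ?ltW.
have mf j : measurable_fun setT (f j) by exact: Lfun2_meas.
have mq j : measurable_fun setT (q j).
  apply/measurable_EFinP; apply: measurable_funM => //.
  exact: measurable_funX.
pose G x := (\sum_(j <oo) q j x)%E.
have G0 x : (0 <= G x)%E by exact: nneseries_ge0.
have mG : measurable_fun setT G.
  by apply: ge0_emeasurable_sum => //.
have hG : (\int[mu]_x G x <= A%:E)%E.
  rewrite integral_nneseries//.
  apply: lime_le.
    by apply: is_cvg_nneseries => j _ _; exact: integral_ge0.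
  apply: nearW => n; apply: le_trans (_ : (\sum_(0 <= j < n) (a j)%:E <= _)%E).
    apply: lee_sum => j _.
    have -> : (\int[mu]_x q j x = (dotf mu (f j) (f j) / a j)%:E)%E.
      rewrite EFinM -dotf_sqrE// -ge0_integralZr//.
      - exact/measurable_EFinP/measurable_funX.
      - by move=> x _; rewrite lee_fin sqr_ge0.
      - by rewrite lee_fin invr_ge0 ltW.
    by rewrite lee_fin ler_pdivrMr// -expr2.
  by rewrite sumEFin lee_fin.
have iG : mu.-integrable setT G.
  apply/integrableP; split=> //.
  under eq_integral do rewrite gee0_abs//.
  by apply: (le_lt_trans hG); rewrite ltry.
have aeG := integrable_ae measurableT iG.
pose S n : T -> R := \sum_(0 <= j < n) f j.
have SE n x : S n x = \sum_(0 <= j < n) f j x by rewrite /S fct_sumE.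
have SL n : L2f (S n) by apply: Lfun2_sum.
have qG n x : ((\sum_(0 <= j < n) f j x ^+ 2 / a j)%:E <= G x)%E.
  by rewrite -sumEFin; apply: nneseries_lim_ge => j _ _; exact: q0.
have S2 n x : ((S n x ^+ 2)%:E <= A%:E * G x)%E.
  have h := sqr_sum_le (f ^~ x) a0 n.
  apply: le_trans (_ : ((A * \sum_(0 <= j < n) f j x ^+ 2 / a j)%:E <= _)%E); last first.
    by rewrite EFinM lee_wpmul2l// lee_fin.
  rewrite lee_fin SE; apply: (le_trans h); apply: ler_wpM2r => //.
  by apply: sumr_ge0 => j _; rewrite divr_ge0 ?sqr_ge0 ?ltW.
have Scvg x : G x \is a fin_num -> cvgn (S ^~ x).
  move=> Gx; have -> : S ^~ x = series (f ^~ x) by apply/funext => n; rewrite SE.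
  apply: normed_cvg.
  apply: (@series_le_cvg _ _ (fun j => a j + f j x ^+ 2 / a j)) => //.
  - by move=> j; exact: normr_ge0.
  - by move=> j; rewrite addr_ge0 ?divr_ge0 ?sqr_ge0 ?(ltW (a0 j)).
  - move=> j /=; have aj := a0 j.
    have -> : a j + f j x ^+ 2 / a j = (a j ^+ 2 + f j x ^+ 2) / a j.
      by field; rewrite gt_eqF.
    rewrite ler_pdivlMr// -[f j x ^+ 2]real_normK ?num_real//.
    have := normr_ge0 (f j x); have := sqr_ge0 (`|f j x| - a j).
    by move: (`|_|) => y; nra.
  apply: nondecreasing_is_cvgn.
    apply: nondecreasing_series => j _ _.
    by rewrite addr_ge0 ?divr_ge0 ?sqr_ge0 ?(ltW (a0 j)).
  exists (A + fine (G x)) => _ [n _ <-].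
  rewrite /series /= big_split /= lerD//.
  by rewrite -lee_fin fineK// qG.
pose E : set T := [set x | G x \is a fin_num].
have mE : measurable E by rewrite -[E]setTI; exact: emeasurable_fin_num.
pose s x : R := if x \in E then limn (S ^~ x) else 0.
have Ss x : G x \is a fin_num -> S ^~ x @ \oo --> s x.
  by move=> Gx; rewrite /s mem_set//; exact: Scvg.
have ms : measurable_fun setT s.
  pose S' n x := if x \in E then S n x else 0.
  apply: (@measurable_fun_cvg _ _ _ _ S').
    move=> n; apply: measurable_fun_ifT => //.
      by apply: (measurable_fun_bool true); rewrite setTI preimage_mem_true.
    exact: Lfun2_meas.
  move=> x _; rewrite /S'; have [/set_mem xE|xE] := boolP (x \in E).
    exact: Ss.
  rewrite /s (negbTE xE); exact: cvg_cst.
have dom (Phi_ : nat -> T -> R) (Phi h : T -> R) :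
    (forall n, measurable_fun setT (Phi_ n)) -> measurable_fun setT Phi ->
    (forall x, G x \is a fin_num -> Phi_ ^~ x @ \oo --> Phi x) -> L2f h ->
    (forall n x, `|Phi_ n x| <= h x ^+ 2 + S n x ^+ 2) ->
    mu.-integrable setT (EFin \o Phi) /\
    \int[mu]_x Phi_ n x @[n --> \oo] --> \int[mu]_x Phi x.
  move=> mPn mP cP hL hP.
  pose g x : \bar R := ((h x ^+ 2)%:E + A%:E * G x)%E.
  have ig : mu.-integrable setT g.
    apply: integrableD => //; last exact: integrableZl.
    exact: Lfun2_integrable_sqr.
  have [||||iP _ cI] := @dominated_convergence _ T R mu setT measurableT
    (fun n => EFin \o Phi_ n) (EFin \o Phi) g _ _ _ ig.
  - by move=> n; exact/measurable_EFinP.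
  - exact/measurable_EFinP.
  - apply: filterS aeG => x Gx _; apply: cvg_EFin; first exact: nearW.
    by apply: cP; exact: Gx.
  - apply: aeW => x n _; apply: le_trans (_ : ((h x ^+ 2 + S n x ^+ 2)%:E <= _)%E).
      by rewrite lee_fin.
    by rewrite EFinD leeD2l.
  split=> //; apply: fine_cvg; rewrite /Rintegral fineK; last exact: integrable_fin_num.
  exact: cI.
have [iss cSS] : mu.-integrable setT (EFin \o (fun x => s x * s x)) /\
    dotf mu (S n) (S n) @[n --> \oo] --> dotf mu s s.
  apply: (dom (fun n x => S n x * S n x) _ 0).
  - by move=> n; apply: measurable_funM; exact: Lfun2_meas.
  - exact: measurable_funM.
  - by move=> x Gx; apply: cvgM; exact: Ss.
  - exact: Lfun2_0.
  - by move=> n x; rewrite expr0n /= add0r -expr2 ger0_norm ?sqr_ge0.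
have sL : L2f s.
  apply/Lfun2P; split=> //; move/integrableP: iss => [_].
  apply: le_lt_trans; rewrite le_eqVlt; apply/orP; left; apply/eqP.
  by apply: eq_integral => x _; rewrite /= -expr2 ger0_norm ?sqr_ge0.
exists s => //; split=> // h hL.
have [] // := dom (fun n x => h x * S n x) (fun x => h x * s x) h.
- by move=> n; apply: measurable_funM => //; [exact: (Lfun2_meas hL)|exact: (Lfun2_meas (SL n))].
- by apply: measurable_funM => //; exact: (Lfun2_meas hL).
- by move=> x Gx; apply: cvgM; [exact: cvg_cst|exact: Ss].
- move=> n x; rewrite normrM -[h x ^+ 2]real_normK ?num_real//.
  rewrite -[S n x ^+ 2]real_normK ?num_real//.
  have := sqr_ge0 (`|h x| - `|S n x|); have := sqr_ge0 (`|h x| + `|S n x|).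
  by move: (`|h x|) (`|S n x|) => y z; nra.
Qed.

End square_integrable_series.

(** * Functions with prescribed sparsity *)

Lemma geometric_sum_nat (R : fieldType) (w : R) n : w != 1 ->
  \sum_(0 <= j < n) w ^+ j = (1 - w ^+ n) / (1 - w).
Proof.
move=> w1; have w1' : 1 - w != 0 by rewrite subr_eq0 eq_sym.
apply: (mulIf w1'); rewrite divfK// big_mkord -[1 - w ^+ n]opprB subrX1; ring.
Qed.

Section sparse.
Variables (R : realType) (phi psi : R -> R).
Hypothesis hb : wavelet_basis phi psi.
Let e := wavelet phi psi.

Variables (w : R) (M : nat -> nat).
Hypothesis w0 : 0 < w.
Hypothesis w1 : w < 1.
Hypothesis M1 : forall j, (1 <= M j)%N.
Hypothesis M2 : forall j, (M j <= 2 ^ j)%N.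

(** The first [M j] coefficients of each level [j] share equally the energy
    [w ^+ j] of the level. *)
Definition sparse_coef (i : coef_index) : R :=
  if i is Some (j, k) then (if (k < M j)%N then Num.sqrt (w ^+ j / (M j)%:R) else 0)
  else 0.

Definition sparse (s : R -> R) : Prop :=
  [/\ L2 (mu01 R) s, inner (mu01 R) s s = (1 - w)^-1 &
    forall i, with_scaling dyadic i -> inner (mu01 R) (e i) s = sparse_coef i].

Let dyad j k : (k < M j)%N -> with_scaling dyadic (Some (j, k)).
Proof. by move=> h; right; exists (j, k) => //; apply: leq_trans h (M2 j). Qed.

Lemma sparse_exists : exists s, sparse s.
Proof.
pose L n := levels n.
pose f j : R -> R := \sum_(0 <= k < M j) sparse_coef (Some (j, k)) *: e (Some (j, k)).
have eL i : with_scaling dyadic i -> e i \in Lfun (mu01 R) 2%:E.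
  by move=> hi; exact: (wavelet_L2 hb hi).
have fL j : f j \in Lfun (mu01 R) 2%:E.
  rewrite /f big_nat; apply: Lfun2_sum => k /andP[_ kM].
  by apply: Lfun2Z; apply: eL; exact: dyad.
have M0 j : 0 < (M j)%:R :> R by rewrite ltr0n.
have efE i j : with_scaling dyadic i -> dotf (mu01 R) (e i) (f j) =
    if i is Some (j', k) then (if j' == j then sparse_coef i else 0) else 0.
  move=> hi; rewrite /f big_nat dotf_sumr//; last 2 first.
    by move=> k /andP[_ kM]; apply: Lfun2Z; apply: eL; exact: dyad.
    exact: eL.
  have hk k : (0 <= k < M j)%N -> dotf (mu01 R) (e i)
      (sparse_coef (Some (j, k)) *: e (Some (j, k))) =
      (i == Some (j, k))%:R * sparse_coef (Some (j, k)).
    move=> /andP[_ kM]; rewrite dotfZr; [|exact: eL (dyad kM)|exact: eL].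
    by have := wavelet_orthonormal hb hi (dyad kM); rewrite /inner /dotf => ->; rewrite mulrC.
  rewrite (eq_bigr _ hk) -big_nat /=.
  case: i hi {hk} => [[j' k']|] hi; last first.
    by rewrite big1// => k _; rewrite mul0r.
  have [jj|jj] := eqVneq j' j; last first.
    rewrite big1// => k _; rewrite (_ : _ == _ = false) ?mul0r//.
    by apply/negP => /eqP [/eqP]; rewrite (negbTE jj).
  rewrite {}jj /=; case: ifP => kM.
    rewrite (bigD1_seq k') ?iota_uniq//= ?mem_index_iota// eqxx mul1r kM.
    rewrite big1 ?addr0// => k kk; rewrite (_ : _ == _ = false) ?mul0r//.
    by apply/negP => /eqP [/esym/eqP]; rewrite (negbTE kk).
  rewrite big_nat big1// => k /andP[_ km]; rewrite (_ : _ == _ = false) ?mul0r//.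
  by apply/negP => /eqP [kk]; move: kM; rewrite kk km.
have ffE i j : dotf (mu01 R) (f i) (f j) = (i == j)%:R * w ^+ j.
  rewrite {1}/f big_nat dotf_suml//; last first.
    by move=> k /andP[_ kM]; apply: Lfun2Z; apply: eL; exact: dyad.
  rewrite (eq_bigr (fun k => (i == j)%:R * (w ^+ j / (M j)%:R))); last first.
    move=> k /andP[_ kM]; rewrite dotfZl//; last by apply: eL; exact: dyad.
    rewrite efE; last exact: dyad.
    have [ij|_] := eqVneq i j; last by rewrite mulr0 mul0r.
    by rewrite /= kM -ij mul1r -expr2 sqr_sqrtr// divr_ge0 ?exprn_ge0 ?(ltW w0) ?(ltW (M0 _)).
  rewrite -big_nat sumr_const_nat subn0 -[LHS]mulr_natr.
  have [->|_] := eqVneq i j; last by rewrite !mul0r.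
  by rewrite !mul1r divfK// gt_eqF.
pose v := Num.sqrt w; have v0 : 0 < v by rewrite sqrtr_gt0.
have v1 : v < 1 by rewrite -sqrtr1 ltr_sqrt.
have [||||s sL [hs ss]] := @Lfun2_series _ _ _ (mu01 R) f (fun j => v ^+ j) (1 - v)^-1.
  - exact: fL.
  - by move=> j; rewrite exprn_gt0.
  - by move=> j; rewrite ffE eqxx mul1r exprAC sqr_sqrtr// ltW.
  - move=> n; rewrite geometric_sum_nat ?lt_eqF// ler_piMl ?invr_ge0 ?subr_ge0 ?(ltW v1)//.
    by rewrite gerBl exprn_ge0// ltW.
exists s; split=> //.
- have hSS n : dotf (mu01 R) (\sum_(0 <= j < n) f j) (\sum_(0 <= j < n) f j) =
      (1 - w ^+ n) / (1 - w).
    rewrite -geometric_sum_nat ?lt_eqF// dotf_suml//; last exact: Lfun2_sum.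
    apply: eq_big_nat => i /andP[_ iN]; rewrite dotf_sumr//.
    rewrite (bigD1_seq i) ?iota_uniq//= ?mem_index_iota// ffE eqxx mul1r.
    by rewrite big1 ?addr0// => j ji; rewrite ffE eq_sym (negbTE ji) mul0r.
  apply: (eq_trans (esym (cvg_lim (@Rhausdorff R) ss))); apply: (cvg_lim (@Rhausdorff R)).
  have : (1 - w ^+ n) / (1 - w) @[n --> \oo] --> (1 - 0) / (1 - w).
    apply: cvgM; last exact: cvg_cst.
    apply: cvgB; first exact: cvg_cst.
    by apply: cvg_expr; rewrite ger0_norm// ltW.
  rewrite subr0 mul1r; apply: cvg_trans; apply: near_eq_cvg.
  by apply: nearW => n; rewrite -hSS.
- move=> i hi; have ci := hs _ (eL i hi).
  apply: (eq_trans (esym (cvg_lim (@Rhausdorff R) ci))); apply: (cvg_lim (@Rhausdorff R)).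
  pose l := if i is Some (j, _) then j.+1 else 0%N.
  apply: cvg_near_cst.
  exists l => // n /= ln; rewrite dotf_sumr//; last exact: eL.
  under eq_bigr => j _ do rewrite efE//.
  case: i hi {ci} @l ln => [[j k]|] hi l ln; last by rewrite big1.
  rewrite (bigD1_seq j) ?iota_uniq//= ?mem_index_iota// eqxx big1 ?addr0//.
  by move=> i; rewrite eq_sym => /negbTE ->.
Qed.

(** The energy missed by [A]: each level [j < L] carries the energy [w ^+ j],
    spread evenly over [M j] coefficients. *)
Lemma sparse_bias s L A : sparse s -> bias phi psi s L A =
  w ^+ L / (1 - w) + \sum_(0 <= j < L)
    w ^+ j / (M j)%:R * (\sum_(0 <= k < M j | Some (j, k) \notin A) 1)%N%:R.
Proof.
move=> [_ ss hs]; rewrite /bias ss /coefs_energy.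
rewrite [X in X - _](_ : _ = w ^+ L / (1 - w) + \sum_(0 <= j < L) w ^+ j); last first.
  rewrite geometric_sum_nat ?lt_eqF//; field.
  by rewrite subr_eq0 gt_eqF.
rewrite -addrA; congr (_ + _).
transitivity (\sum_(0 <= j < L) w ^+ j -
    \sum_(i <- levels L | i \in A) sparse_coef i ^+ 2).
  congr (_ - _); rewrite big_seq_cond [RHS]big_seq_cond; apply: eq_bigr => i /andP[il _].
  by rewrite hs//; exact: levels_dyadic il.
rewrite big_levels /= expr0n /= if_same add0r -sumrB.
apply: eq_bigr => j _; have M0 : (M j)%:R != 0 :> R by rewrite pnatr_eq0 -lt0n.
have hM : ((\sum_(0 <= k < M j | Some (j, k) \in A) 1) +
    \sum_(0 <= k < M j | Some (j, k) \notin A) 1 = M j)%N.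
  by rewrite -(bigID (fun k => Some (j, k) \in A) xpredT) /= sum_nat_const_nat muln1 subn0.
have {}hM : (\sum_(0 <= k < M j | Some (j, k) \notin A) 1)%N%:R =
    (M j)%:R - (\sum_(0 <= k < M j | Some (j, k) \in A) 1)%N%:R :> R.
  by rewrite -{2}hM natrD addrAC subrr add0r.
rewrite hM mulrBr divfK//; congr (_ - _).
rewrite (@big_cat_nat _ _ _ (M j))//= [X in _ + X]big_nat_cond [X in _ + X]big1 ?addr0; last first.
  by move=> k /andP[/andP[Mk _] _]; rewrite ltnNge Mk /= expr0n.
rewrite natr_sum mulr_sumr [LHS]big_nat_cond [RHS]big_nat_cond.
apply: eq_bigr => k /andP[/andP[_ kM] _].
by rewrite kM sqr_sqrtr ?mulr1// divr_ge0// exprn_ge0// ltW.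
Qed.

End sparse.

(** * Separation of the approximation classes *)

Section dyadic_powers.
Variable R : realType.

Lemma exp2_powR j (e : R) : (2 ^+ j) `^ e = (2 `^ e) ^+ j.
Proof. by rewrite -(powR_mulrn j (powR_ge0 2 e)) -(powR_mulrn j (ler0n R 2)) -!powRrM mulrC. Qed.

Lemma small_power (w K : R) : 0 < w -> w < 1 -> exists q, K * w ^+ q < 2^-1.
Proof.
move=> w0 w1.
have : K * w ^+ n @[n --> \oo] --> K * 0.
  by apply: cvgM; [exact: cvg_cst|apply: cvg_expr; rewrite ger0_norm// ltW].
rewrite mulr0 => /cvgr0_norm_lt/(_ (2^-1)) []; first by rewrite invr_gt0.
by move=> q _ /(_ q (leqnn _)) /= h; exists q; apply: le_lt_trans h; exact: ler_norm.
Qed.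

Lemma geometric_tail (w : R) m L : 0 < w -> w < 1 ->
  \sum_(0 <= j < L) (if (j < m)%N then 0 else w ^+ j) <= w ^+ m / (1 - w).
Proof.
move=> w0 w1; have wd : 0 < 1 - w by rewrite subr_gt0.
have [mL|/ltnW Lm] := leqP m L; last first.
  rewrite big_nat big1 ?divr_ge0 ?exprn_ge0 ?(ltW w0) ?(ltW wd)// => j /andP[_ jL].
  by rewrite (leq_trans jL Lm).
have := geometric_sum_nat L (negbT (lt_eqF w1)).
rewrite !(@big_cat_nat _ _ _ m 0 L)//= geometric_sum_nat ?lt_eqF// => h.
rewrite [X in X + _]big_nat big1 ?add0r; last by move=> j /andP[_ ->].
rewrite (eq_big_nat _ _ (F2 := fun j => w ^+ j)); last first.
  by move=> j /andP[mj _]; rewrite ltnNge mj.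
have -> : \sum_(m <= j < L) w ^+ j = w ^+ m / (1 - w) - w ^+ L / (1 - w).
  apply: (addrI ((1 - w ^+ m) / (1 - w))); rewrite h; ring.
by rewrite gerBl divr_ge0 ?exprn_ge0 ?(ltW w0) ?(ltW wd).
Qed.

(** Beyond the level [J] a hybrid model keeps at least one coefficient on a
    number of levels which is exponential in [J]. *)
Lemma hybrid_reach (theta a : R) : 0 < theta -> 0 < a ->
  exists q, forall L, exists J m, [/\ m%:R `^ theta <= 2 ^+ J :> R,
    2 ^+ J <= (2 ^+ L) `^ a & (L <= m + q)%N].
Proof.
move=> t0 a0.
have [c c0 hc] := @level_count_le R (2 * theta)^-1 ltac:(by rewrite invr_gt0 mulr_gt0).
(* [y ^ 2] is the reach; [L] is at most of order [J], which is logarithmic in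
   [y], hence at most [c / a * y <= y ^ 2 + kappa]. *)
pose kappa := (c / a) ^+ 2 / 4.
exists (Num.truncn kappa).+2 => L; pose J := Num.truncn (a * L%:R).
have aL0 : 0 <= a * L%:R by rewrite mulr_ge0 ?(ltW a0).
pose y : R := (2 ^+ J) `^ (2 * theta)^-1.
have y2 : y ^+ 2 = (2 ^+ J) `^ theta^-1.
  by rewrite -powR_mulrn ?powR_ge0// -powRrM; congr (_ `^ _); field; rewrite gt_eqF.
pose m := Num.truncn (y ^+ 2); exists J, m; split.
- apply: (@le_trans _ _ ((y ^+ 2) `^ theta)).
    by rewrite ge0_ler_powR ?nnegrE ?(ltW t0) ?sqr_ge0// truncn_le ?sqr_ge0.
  by rewrite y2 -powRrM mulVf ?gt_eqF// powRr1// exprn_ge0.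
- rewrite -(powR_mulrn _ (ler0n R 2)) -(powR_mulrn L (ler0n R 2)) -powRrM.
  by rewrite ler_powR ?ler1n// mulrC truncn_le.
- have h1 : a * L%:R < J.+1%:R by exact: truncnS_gt.
  have h2 := hc J; rewrite -/y in h2.
  have h3 : y ^+ 2 < m.+1%:R by exact: truncnS_gt.
  have h4 : kappa < (Num.truncn kappa).+1%:R by exact: truncnS_gt.
  have h5 : L%:R <= c / a * y.
    have -> : c / a * y = c * y / a by ring.
    by rewrite ler_pdivlMr// mulrC (le_trans (ltW h1)).
  have h6 : c / a * y <= y ^+ 2 + kappa.
    rewrite /kappa; move: (c / a) => b; have := sqr_ge0 (y - b / 2); nra.
  have : L%:R < (m + (Num.truncn kappa).+2)%:R :> R.
    by rewrite addnS -addSn natrD; lra.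
  by rewrite ltr_nat => /ltnW.
Qed.

End dyadic_powers.

Section separation.
Variables (R : realType) (phi psi : R -> R).
Hypothesis hb : wavelet_basis phi psi.
Variables (theta alpha : R).
Hypothesis th2 : 2 < theta.
Hypothesis alpha0 : 0 < alpha.
Variables (N : set nat) (lambda : nat -> R) (lmin pmin pmax : R).
Hypothesis hreg : regime N lambda lmin pmin pmax.
Variable j0 : nat -> int.
Hypothesis hj0 : maximal_level N lambda j0.
Hypothesis vanishing : forall eps : R, 0 < eps ->
  exists2 n, N n & unit_penalty lambda n < eps.

Let p := unit_penalty lambda.
Let gamma : R := 2 * alpha / (1 + 2 * alpha).
Let a : R := 1 - gamma.
Let w : R := 2 `^ (- gamma).
Let L n := top_level (j0 n).
Let rho2 := sqr_rate lambda alpha.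

Let g01 : 0 < gamma < 1 := gamma01 alpha0.
Let g0 : 0 < gamma. Proof. by have /andP[] := g01. Qed.
Let a0 : 0 < a. Proof. by have /andP[_] := g01; rewrite subr_gt0. Qed.
Let a1 : a < 1. Proof. by rewrite ltrBlDr ltrDl g0. Qed.
Let w0 : 0 < w. Proof. exact: powR_gt0. Qed.
Let w1 : w < 1.
Proof.
rewrite /w powRN invf_lt1 ?powR_gt0//.
rewrite /powR gt_eqF// expR_gt1 mulr_gt0 ?g0// ln_gt0// ltr1n//.
Qed.
Let wL l : w ^+ l = (2 ^+ l) `^ (- gamma).
Proof. by rewrite exp2_powR. Qed.

Let pmax1 := regime_pmax1 hreg.
Let pmax0 : 0 < pmax. Proof. exact: lt_le_trans pmax1. Qed.
Let p0 n : N n -> 0 < p n. Proof. exact: (unit_penalty_gt0 hreg). Qed.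

(** The maximal level [L n] is the one where [2 ^ L] is comparable to [1 / p n].
    This and the next three estimates express the squared rate, and the dimension
    that it allows, in terms of [L n]. *)
Lemma top_energy_le n : N n -> w ^+ L n <= 2 * rho2 n.
Proof.
move=> Nn; have pn := p0 Nn; have h := top_level_gt hj0 Nn.
rewrite wL powRN -/(L n).
have h1 : (p n)^-1 `^ gamma <= (2 * 2 ^+ L n) `^ gamma.
  by rewrite ge0_ler_powR ?nnegrE ?(ltW g0) ?invr_ge0 ?(ltW pn) ?mulr_ge0 ?exprn_ge0 ?(ltW h).
have h2 : 2 `^ gamma <= 2 :> R.
  by rewrite -[leRHS](powRr1 (ler0n R 2)) ler_powR ?ler1n//; have /andP[_ /ltW] := g01.
have x0 : 0 < (2 ^+ L n) `^ gamma by rewrite powR_gt0 ?exprn_gt0.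
have r0 : 0 < rho2 n by exact: (rho2_gt0 hreg).
have rE : (p n)^-1 `^ gamma = (rho2 n)^-1.
  by rewrite -powR_inv1 ?(ltW pn)// -powRrM mulN1r powRN.
rewrite powRM ?exprn_ge0// rE in h1.
rewrite -[leRHS]invrK invfM lef_pV2 ?posrE ?mulr_gt0 ?invr_gt0//.
rewrite mulrC ler_pdivrMr// mulrC; apply: (le_trans h1).
by rewrite ler_wpM2r// ltW.
Qed.

Lemma rate_top_le n : N n -> rho2 n <= pmax * w ^+ L n.
Proof.
move=> Nn; have pn := p0 Nn; have h := top_level_le hreg hj0 Nn.
have x0 : 0 < 2 ^+ L n :> R by rewrite exprn_gt0.
have h1 : p n <= pmax * (2 ^+ L n)^-1.
  by rewrite ler_pdivlMr// mulrC -ler_pdivlMr.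
have h2 : pmax `^ gamma <= pmax.
  by rewrite -[leRHS](powRr1 (ltW pmax0)) ler_powR ?pmax1//; have /andP[_ /ltW] := g01.
apply: (@le_trans _ _ ((pmax * (2 ^+ L n)^-1) `^ gamma)).
  by rewrite ge0_ler_powR ?nnegrE ?(ltW g0) ?(ltW pn) ?mulr_ge0 ?invr_ge0 ?(ltW x0) ?(ltW pmax0).
rewrite powRM ?invr_ge0 ?(ltW x0) ?(ltW pmax0)//.
rewrite -powR_inv1 ?(ltW x0)// -powRrM mulN1r -wL.
by rewrite ler_wpM2r// exprn_ge0// ltW.
Qed.

Let p_rho n : N n -> p n * (p n)^-1 `^ a = rho2 n.
Proof.
move=> Nn; have pn := p0 Nn.
rewrite -powR_inv1 ?(ltW pn)// -powRrM -{1}[p n](powRr1 (ltW pn)) -powRD.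
  by congr (_ `^ _); rewrite /a /gamma; ring.
by rewrite (gt_eqF pn) implybT.
Qed.

Lemma top_dimension_le n : N n -> p n * (2 ^+ L n) `^ a <= pmax * rho2 n.
Proof.
move=> Nn; have pn := p0 Nn; have h := top_level_le hreg hj0 Nn.
have h2 : pmax `^ a <= pmax.
  by rewrite -[leRHS](powRr1 (ltW pmax0)) ler_powR ?pmax1// ltW.
have h3 : (2 ^+ L n) `^ a <= pmax * (p n)^-1 `^ a.
  apply: (@le_trans _ _ ((pmax / p n) `^ a)).
    by rewrite ge0_ler_powR ?nnegrE ?(ltW a0) ?exprn_ge0// divr_ge0 ?(ltW pn) ?(ltW pmax0).
  rewrite powRM ?invr_ge0 ?(ltW pn) ?(ltW pmax0)//.
  by rewrite ler_wpM2r ?powR_ge0.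
by have := ler_wpM2l (ltW pn) h3; rewrite mulrCA p_rho.
Qed.

Lemma dimension_top_le n K D : N n -> p n * D <= K * rho2 n -> 0 <= K ->
  D <= 2 * K * (2 ^+ L n) `^ a.
Proof.
move=> Nn h K0; have pn := p0 Nn; have t := top_level_gt hj0 Nn.
rewrite -p_rho// mulrCA ler_pM2l// in h; apply: (le_trans h).
rewrite [2 * K]mulrC -mulrA ler_wpM2l//.
apply: (@le_trans _ _ ((2 * 2 ^+ L n) `^ a)).
  by rewrite ge0_ler_powR ?nnegrE ?(ltW a0) ?invr_ge0 ?(ltW pn) ?mulr_ge0 ?exprn_ge0 ?(ltW t).
rewrite powRM ?exprn_ge0// ler_wpM2r ?powR_ge0//.
by rewrite -[leRHS](powRr1 (ler0n R 2)) ler_powR ?ler1n// ltW.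
Qed.

(** Since [a < 1] and the penalties vanish, dimensions of order [(2 ^ L) `^ a]
    are eventually smaller than any fraction of [2 ^ L]. *)
Lemma top_level_unbounded Z : exists n, N n /\ Z * (2 ^+ L n) `^ a < 2 ^+ L n.
Proof.
pose Y : R := `|Z| + 1; have Y0 : 0 < Y by rewrite ltr_wpDl.
pose y := Y `^ gamma^-1; have y0 : 0 < y by exact: powR_gt0.
have [n Nn pn] := vanishing (eps := (2 * y)^-1) ltac:(by rewrite invr_gt0 mulr_gt0).
exists n; split=> //; have pn0 := p0 Nn; rewrite -/(p n) in pn.
have t : (p n)^-1 < 2 * 2 ^+ L n := top_level_gt hj0 Nn.
have x0 : 0 < 2 ^+ L n :> R by rewrite exprn_gt0.
have yx : y <= 2 ^+ L n.
  rewrite -(ler_pM2l (x := 2))//; apply: le_trans (ltW t).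
  by rewrite -[leLHS]invrK lef_pV2 ?posrE ?invr_gt0// ?mulr_gt0//; exact: ltW.
have xE : 2 ^+ L n = (2 ^+ L n) `^ gamma * (2 ^+ L n) `^ a :> R.
  rewrite -powRD; last by rewrite (gt_eqF x0) implybT.
  by rewrite /a addrC subrK powRr1// ltW.
rewrite [ltRHS]xE ltr_pM2r ?powR_gt0//.
apply: (@lt_le_trans _ _ Y); first by rewrite ltr_pwDr// ler_norm.
have -> : Y = y `^ gamma by rewrite -powRrM mulVf ?gt_eqF// powRr1// ltW.
by rewrite ge0_ler_powR ?nnegrE ?(ltW g0) ?(ltW x0) ?(ltW y0).
Qed.

(** Energies within a constant factor lie a bounded number of levels apart. *)
Lemma energy_gap K : exists q, forall k n, N n -> (k <= L n)%N ->
  w ^+ k <= K * rho2 n -> 2 ^+ L n <= 2 ^+ q * 2 ^+ k :> R.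
Proof.
have [q hq] := small_power (`|K| * pmax) w0 w1; exists q => k n Nn kL h.
rewrite -exprD ler_weXn2l ?ler1n// addnC leqNgt; apply/negP => kq.
have h1 : w ^+ k <= `|K| * pmax * w ^+ L n.
  apply: (le_trans h); rewrite -mulrA; apply: (@le_trans _ _ (`|K| * rho2 n)).
    by rewrite ler_wpM2r ?ler_norm// ltW// (rho2_gt0 hreg).
  by rewrite ler_wpM2l// rate_top_le.
have h2 : w ^+ L n <= w ^+ q * w ^+ k.
  by rewrite -exprD ler_wiXn2l ?(ltW w0) ?(ltW w1)// addnC ltnW.
have wk : 0 < w ^+ k by rewrite exprn_gt0.
have K0 : 0 <= `|K| * pmax by rewrite mulr_ge0// ltW.
have h3 := le_trans h1 (ler_wpM2l K0 h2).
move: h3; rewrite mulrA -[X in X <= _]mul1r ler_pM2r//; lra.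
Qed.

(** One coefficient per level: a sieve needs all the levels up to a level of
    small energy, whereas hybrid models reach that level with few coefficients. *)
Lemma sieve_separation : exists s, [/\ L2 (mu01 R) s,
  approximated phi psi lambda j0 alpha N (fun=> hybrid_label theta) s &
  ~ approximated phi psi lambda j0 alpha
      (nonempty_sizes N (sieve_models phi psi j0)) (fun n => sieve_label (j0 n)) s].
Proof.
pose M (j : nat) := 1%N.
have M1 j : (1 <= M j)%N by [].
have M2 j : (M j <= 2 ^ j)%N by rewrite expn_gt0.
have [s hs] := sparse_exists hb w0 w1 M1 M2.
have [sL _ _] := hs.
exists s; split=> //.
  have t0 : 0 < theta by have := th2; lra.
  have [q hq] := hybrid_reach t0 a0.
  pose c := 2 + (theta - 1)^-1.
  have c0 : 0 <= c by rewrite addr_ge0// invr_ge0; have := th2; lra.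
  have wq : 0 < w ^+ q by rewrite exprn_gt0.
  have wd : 0 < 1 - w by rewrite subr_gt0.
  exists (2 * (1 + (w ^+ q)^-1) / (1 - w) + c * pmax) => n Nn.
  have [J [m [mJ JL Lm]]] := hq (L n).
  exists (with_scaling (low_hybrid_set theta J)), (hybrid_size theta J)%:R; split.
    by exists J, (low_hybrid_set theta J); split=> //; exact: low_hybrid_setP.
  rewrite mulrDl; apply: lerD.
    rewrite (sparse_bias w0 w1 M1 M2 _ _ hs).
    apply: (@le_trans _ _ (w ^+ L n / (1 - w) + w ^+ m / (1 - w))).
      rewrite lerD2l; apply: le_trans (geometric_tail m (L n) w0 w1).
      apply: ler_sum => j _; rewrite divr1 big_mkcond big_nat1 /=.
      have [jm|_] := ltnP j m; last first.
        by case: ifP; rewrite ?mulr1// mulr0 exprn_ge0// ltW.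
      rewrite mem_set ?mulr0//; right; exists (j, 0%N) => //.
      have [jJ|Jj] := ltnP j J; [left|right].
        by split=> //=; rewrite /dyadic /= expn_gt0.
      exists j => //; exists 0%N => //=; rewrite truncn_gt0 addn1.
      rewrite powRN ler_pdivlMr ?powR_gt0 ?ltr0n// mul1r.
      apply: le_trans mJ; rewrite ge0_ler_powR ?nnegrE ?(ltW t0)// ler_nat.
      by rewrite (leq_trans _ jm)// ltnS leq_subr.
    have h1 : w ^+ m <= w ^+ L n / w ^+ q.
      rewrite ler_pdivlMr// -exprD ler_wiXn2l ?(ltW w0) ?(ltW w1)//.
    have h2 := top_energy_le Nn.
    rewrite -mulrDl mulrAC ler_wpM2r ?invr_ge0 ?(ltW wd)//.
    apply: (@le_trans _ _ (w ^+ L n * (1 + (w ^+ q)^-1))).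
      by rewrite mulrDr mulr1 lerD2l.
    rewrite mulrAC ler_wpM2r//; first by rewrite addr_ge0// invr_ge0 ltW.
  have hD : (hybrid_size theta J)%:R <= c * (2 ^+ L n) `^ a.
    apply: (le_trans (hybrid_size_le th2 J)).
    by rewrite ler_wpM2l.
  apply: (le_trans (ler_wpM2l (ltW (p0 Nn)) hD)).
  rewrite mulrCA -[leRHS]mulrA ler_wpM2l//; exact: top_dimension_le.
move=> [K hK]; have [q hq] := energy_gap K.
have [n [Nn hn]] := top_level_unbounded (2 ^+ q * (2 * `|K|) + 2).
have x1 : 1 <= (2 ^+ L n) `^ a.
  by rewrite -[leLHS](powRr0 (2 ^+ L n)) ler_powR ?(ltW a0)// exprn_ege1// ler1n.
have jn : 0 < j0 n.
  rewrite ltNge; apply/negP => jn.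
  have L0 : L n = 0%N by rewrite /L; case: (j0 n) jn => // -[].
  move: hn x1; rewrite L0 expr0 => hn x1.
  have qk : 0 <= 2 ^+ q * (2 * `|K|) :> R by rewrite mulr_ge0 ?exprn_ge0// mulr_ge0.
  move: hn; have := ler_wpM2l qk x1; lra.
have [A [D [[k [kj -> ->]] h]]] := hK n ((nonempty_sieve _ _ _ _ _).2 (conj Nn jn)).
have r0 : 0 < rho2 n by exact: (rho2_gt0 hreg).
have h' : bias phi psi s (L n) (with_scaling (sieve_set k)) +
    p n * 2 ^+ k <= `|K| * rho2 n.
  by apply: (le_trans h); rewrite ler_wpM2r ?(ltW r0)// ler_norm.
have kL : (k < L n)%N by move: kj; rewrite /L; case: (j0 n).
have pk : 0 <= p n * 2 ^+ k by rewrite mulr_ge0 ?exprn_ge0// ltW// p0.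
have b0 := bias_ge0 hb sL (L n) (with_scaling (sieve_set k)).
have hw : w ^+ k <= K * rho2 n.
  apply: le_trans h; rewrite (sparse_bias w0 w1 M1 M2 _ _ hs) -[leLHS]addr0 lerD//.
  rewrite (bigD1_seq k) ?iota_uniq ?mem_index_iota//= divr1 big_mkcond big_nat1 /=.
  have -> : Some (k, 0%N) \notin with_scaling (sieve_set k).
    apply/negP => /set_mem[//|[[j' k'] [_ /= jkk] [e1 _]]].
    by move: jkk; rewrite e1 ltnn.
  rewrite mulr1 addrCA lerDl addr_ge0//.
    by rewrite divr_ge0 ?exprn_ge0 ?subr_ge0 ?(ltW w0) ?(ltW w1).
  by apply: sumr_ge0 => j _; rewrite mulr_ge0// divr_ge0// exprn_ge0// ltW.
have h1 := hq k n Nn (ltnW kL) hw.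
have h2 : p n * 2 ^+ k <= `|K| * rho2 n by apply: le_trans h'; rewrite lerDr.
have h3 := dimension_top_le Nn h2 (normr_ge0 K).
have h4 := le_trans h1 (ler_wpM2l (exprn_ge0 q (ler0n R 2)) h3).
move: hn; rewrite mulrDl; move: h4; rewrite mulrA => h4; lra.
Qed.

(** About [2 ^ (a j)] coefficients on each level [j]: any choice of the
    positions is available to the large family, whereas a hybrid model of the
    right dimension misses half of the coefficients of some level. *)
Lemma hybrid_separation : exists s, [/\ L2 (mu01 R) s,
  approximated phi psi lambda j0 alpha N (fun n => large_label (j0 n)) s &
  ~ approximated phi psi lambda j0 alpha N (fun=> hybrid_label theta) s].
Proof.
pose M j := Num.truncn ((2 ^+ j) `^ a : R).
have X1 l : 1 <= (2 ^+ l) `^ a :> R.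
  by rewrite -[leLHS](powRr0 (2 ^+ l)) ler_powR ?(ltW a0)// exprn_ege1// ler1n.
have M1 j : (1 <= M j)%N by rewrite truncn_gt0.
have Mle j : (M j)%:R <= (2 ^+ j) `^ a :> R by rewrite truncn_le powR_ge0.
have M2 j : (M j <= 2 ^ j)%N.
  rewrite -(ler_nat R) natrX; apply: (le_trans (Mle j)).
  by rewrite -[leRHS]powRr1 ?exprn_ge0// ler_powR ?(ltW a1)// exprn_ege1// ler1n.
have [s hs] := sparse_exists hb w0 w1 M1 M2.
have [sL _ _] := hs; exists s; split=> //.
  have wd : 0 < 1 - w by rewrite subr_gt0.
  pose b : R := 2 `^ a.
  have b1 : 1 < b by rewrite /b /powR gt_eqF// expR_gt1 mulr_gt0 ?a0// ln_gt0// ltr1n//.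
  have bd : 0 < b - 1 by rewrite subr_gt0.
  exists (2 / (1 - w) + (1 + (b - 1)^-1) * pmax) => n Nn.
  pose S : set (nat * nat) := [set jk | (jk.1 < L n)%N /\ (jk.2 < M jk.1)%N].
  have SE j k : (j < L n)%N -> (k < M j)%N -> Some (j, k) \in with_scaling S.
    by move=> jL kM; apply/mem_set; right; exists (j, k).
  exists (with_scaling S), (size (coefs (L n) (with_scaling S)))%:R; split.
    exists S; split=> // -[j k] [/= jL kM]; split.
      exact: (leq_trans kM (M2 j)).
    by rewrite below_levelE.
  rewrite mulrDl; apply: lerD.
    rewrite (sparse_bias w0 w1 M1 M2 _ _ hs) [X in _ + X]big_nat big1 ?addr0; last first.
      move=> j /andP[_ jL]; rewrite [X in _ * X%:R](_ : _ = 0%N) ?mulr0//.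
      by rewrite big_nat_cond big1// => k /andP[/andP[_ kM]]; rewrite SE.
    by rewrite mulrAC ler_wpM2r ?invr_ge0 ?(ltW wd)// top_energy_le.
  have hD : (size (coefs (L n) (with_scaling S)))%:R <=
      (1 + (b - 1)^-1) * (2 ^+ L n) `^ a.
    rewrite size_coefs natr_sum (big_levels _ _ (fun=> 1%:R)) mulrDl mul1r.
    apply: lerD; first by case: ifP => // _; exact: le_trans (X1 0%N).
    apply: (@le_trans _ _ (\sum_(0 <= j < L n) b ^+ j)).
      rewrite big_nat [leRHS]big_nat; apply: ler_sum => j /andP[_ jL].
      rewrite -exp2_powR; apply: le_trans (Mle j).
      rewrite -natr_sum ler_nat (@big_cat_nat _ _ _ (M j))//=.
      rewrite [X in (_ + X)%N]big_nat_cond [X in (_ + X)%N]big1 ?addn0; last first.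
        move=> k /andP[/andP[Mk _] /set_mem[//|[[j' k'] [/= _ kM] [ej ek]]]].
        by move: kM; rewrite ej ek ltnNge Mk.
      rewrite big_mkcond /= -[leqRHS]subn0 -[leqRHS]muln1 -sum_nat_const_nat.
      by apply: leq_sum => k _; case: ifP.
    rewrite geometric_sum_nat ?gt_eqF// exp2_powR -/b.
    have -> : (1 - b ^+ L n) / (1 - b) = (b - 1)^-1 * (b ^+ L n - 1).
      by field; rewrite !subr_eq0 (gt_eqF b1) (lt_eqF b1).
    by rewrite ler_wpM2l ?invr_ge0 ?(ltW bd)// gerBl.
  apply: (le_trans (ler_wpM2l (ltW (p0 Nn)) hD)).
  rewrite mulrCA -[leRHS]mulrA ler_wpM2l//; last exact: top_dimension_le.
  by rewrite addr_ge0// invr_ge0 ltW.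
move=> [K hK]; have [q0 hq0] := small_power (`|K| * pmax) w0 w1.
have K0 : 0 <= `|K| * pmax by rewrite mulr_ge0// ltW.
pose q := q0.+1.
(* at the level [L n - q] half of the energy exceeds the rate *)
have hq : `|K| * pmax * w ^+ q < 2^-1.
  by apply: le_lt_trans hq0; rewrite ler_wpM2l// ler_wiXn2l ?(ltW w0) ?(ltW w1).
(* bounds the distance from the base level to the level [L n - q] *)
pose B := Num.truncn (8 * `|K| * 2 ^+ q).
have [n [Nn hn]] := top_level_unbounded (2 ^+ (q + B) * (2 * `|K|) + 2 ^+ q).
set X := (2 ^+ L n) `^ a in hn; have X1' : 1 <= X by exact: X1.
have [A [D [[J [S [hS AE DE]]] h]]] := hK n Nn.
have r0 : 0 < rho2 n by exact: (rho2_gt0 hreg).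
have hJ0 : (2 ^+ J : R) <= D by rewrite DE -natrX ler_nat hybrid_size_ge.
have pD : 0 <= p n * D.
  by rewrite mulr_ge0 ?(ltW (p0 Nn))// (le_trans _ hJ0)// exprn_ge0.
have h' : bias phi psi s (L n) A + p n * D <= `|K| * rho2 n.
  by apply: (le_trans h); rewrite ler_wpM2r ?(ltW r0)// ler_norm.
have b0 := bias_ge0 hb sL (L n) A.
have hJ : 2 ^+ J <= 2 * `|K| * X.
  apply: (le_trans hJ0); apply: (dimension_top_le Nn) => //.
  by apply: le_trans h'; rewrite lerDr.
have KX : 0 <= 2 * `|K| * X by rewrite mulr_ge0 ?mulr_ge0// ltW// (lt_le_trans ltr01).
have qL : (q <= L n)%N.
  rewrite leqNgt; apply/negP => Lq.
  have h1 : 2 ^+ L n <= 2 ^+ q :> R by rewrite ler_weXn2l ?ler1n// ltnW.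
  have h2 : 0 <= 2 ^+ (q + B) * (2 * `|K|) * X.
    by rewrite -mulrA mulr_ge0 ?exprn_ge0.
  have h3 : 2 ^+ q * 1 <= 2 ^+ q * X by rewrite ler_wpM2l ?exprn_ge0.
  by move: hn; rewrite mulrDl ltNge; apply/negP/negPn; lra.
pose j := (L n - q)%N; have jq : (j + q = L n)%N by rewrite subnK.
have contra : (j <= J + B)%N -> False.
  move=> jJ; have h1 : 2 ^+ L n <= 2 ^+ (q + B) * 2 ^+ J :> R.
    rewrite -exprD ler_weXn2l ?ler1n//.
    by rewrite -jq addnC -addnA leq_add2l addnC.
  have h2 := le_trans h1 (ler_wpM2l (exprn_ge0 (q + B) (ler0n R 2)) hJ).
  have h3 : 0 <= 2 ^+ q * X by rewrite mulr_ge0 ?exprn_ge0// (le_trans ler01).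
  by move: hn; rewrite mulrDl -mulrA ltNge => /negP; apply; rewrite (le_trans h2)// lerDl.
have [Jj|jJ] := leqP J j; last by apply: contra; rewrite (leq_trans (ltnW jJ))// leq_addr.
pose inA := (\sum_(0 <= k < M j | Some (j, k) \in A) 1)%N.
pose out := (\sum_(0 <= k < M j | Some (j, k) \notin A) 1)%N.
have inout : (inA + out = M j)%N.
  by rewrite -(bigID (fun k => Some (j, k) \in A) xpredT) /= sum_nat_const_nat muln1 subn0.
have Mj0 : 0 < (M j)%:R :> R by rewrite ltr0n.
have hout : w ^+ j / (M j)%:R * out%:R < w ^+ j / 2.
  apply: (@le_lt_trans _ _ (bias phi psi s (L n) A)).
    rewrite (sparse_bias w0 w1 M1 M2 _ _ hs).
    rewrite (bigD1_seq j) ?iota_uniq ?mem_index_iota//=; last first.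
      by rewrite -jq -addn1 leq_add2l.
    rewrite addrCA lerDl addr_ge0//.
      by rewrite divr_ge0 ?exprn_ge0 ?subr_ge0 ?(ltW w0) ?(ltW w1).
    by apply: sumr_ge0 => l _; rewrite mulr_ge0// divr_ge0// exprn_ge0// ltW.
  apply: (@le_lt_trans _ _ (`|K| * pmax * w ^+ q * w ^+ j)).
    apply: (@le_trans _ _ (`|K| * rho2 n)).
      by apply: le_trans h'; rewrite lerDl.
    by rewrite -!mulrA ler_wpM2l// -exprD [(q + j)%N]addnC jq rate_top_le.
  by rewrite mulrC ltr_pM2l// exprn_gt0.
have hin : (M j <= 2 * inA)%N.
  have : out%:R < (M j)%:R / 2 :> R.
    move: hout; rewrite -mulrA ltr_pM2l ?exprn_gt0// mulrC ltr_pdivrMr//.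
    by rewrite mulrC.
  rewrite ltr_pdivlMr// -natrM ltr_nat -inout muln2 mul2n -!addnn leq_add2l.
  by rewrite ltn_add2r => /ltnW.
have inJ : (inA <= hybrid_card theta J j)%N.
  rewrite -(hybrid_sets_card hS Jj) -AE.
  by rewrite [leqRHS](@big_cat_nat _ _ _ (M j))//= leq_addr.
have hX : (2 ^+ j) `^ a <= 4 * (inA%:R : R).
  apply: ltW; apply: (@lt_le_trans _ _ (M j).+1%:R); first exact: truncnS_gt.
  rewrite -natrM ler_nat -[4%N]/(2 * 2)%N -mulnA; apply: leq_trans (leq_mul (leqnn 2) hin).
  by rewrite mul2n -addnn -add1n leq_add2r.
have hl : (j - J).+1%:R * (inA%:R : R) <= 2 ^+ J.
  apply: (@le_trans _ _ ((j - J).+1%:R * (hybrid_card theta J j)%:R)).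
    by rewrite ler_wpM2l// ler_nat.
  apply: (@le_trans _ _ ((j - J).+1%:R * (2 ^+ J / (j - J).+1%:R))); last first.
    by rewrite mulrC divfK// pnatr_eq0.
  rewrite ler_wpM2l//; apply: (le_trans (hybrid_card_le theta J j)).
  rewrite ler_wpM2l ?exprn_ge0// addn1 powRN lef_pV2 ?posrE ?powR_gt0 ?ltr0n//.
  by apply: le1r_powR; rewrite ?ler1n//; have := th2; lra.
have XE : X <= 2 ^+ q * (2 ^+ j) `^ a.
  rewrite /X -jq exprD powRM ?exprn_ge0// mulrC ler_wpM2r ?powR_ge0//.
  by rewrite -[leRHS]powRr1 ?exprn_ge0// ler_powR ?(ltW a1)// exprn_ege1// ler1n.
apply: contra; rewrite -leq_subLR truncn_ge_nat; last first.
  by rewrite mulr_ge0 ?exprn_ge0// mulr_ge0.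
apply: (@le_trans _ _ (j - J).+1%:R); first by rewrite ler_nat.
have y0 : 0 < (2 ^+ j) `^ a :> R by rewrite powR_gt0// exprn_gt0.
rewrite -(ler_pM2r y0).
have h1 := ler_wpM2l (ler0n R (j - J).+1) hX.
have h2 := ler_wpM2l (mulr_ge0 (ler0n R 2) (normr_ge0 K)) XE.
apply: (le_trans h1); rewrite mulrCA; apply: (@le_trans _ _ (4 * (2 * `|K| * X))).
  by rewrite ler_wpM2l// (le_trans hl).
have -> : 8 * `|K| * 2 ^+ q * (2 ^+ j) `^ a = 4 * (2 * `|K| * (2 ^+ q * (2 ^+ j) `^ a)) by ring.
by rewrite ler_wpM2l.
Qed.

End separation.

(** * Strict inclusions of the maxisets *)

Section vanishing_penalties.
Variable R : realType.

Lemma vanishing_log (lambda0 : R) : 1 <= lambda0 ->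
  forall eps : R, 0 < eps -> exists2 n, [set n : nat | (2 <= n)%N] n &
    unit_penalty (fun n => lambda0 * ln n%:R) n < eps.
Proof.
move=> l1 eps e0; have l0 : 0 < lambda0 by exact: lt_le_trans l1.
(* [ln (m ^ 2) <= 2 m] *)
pose m := (Num.truncn (2 * lambda0 / eps)).+2.
have m0 : 0 < m%:R :> R by rewrite ltr0n.
exists (m * m)%N; first by rewrite /= (leq_trans (_ : 2 <= 2 * 2)%N)// leq_mul.
rewrite /unit_penalty natrM lnM ?posrE//.
have h := ln_sublinear m0.
have hm : 2 * lambda0 / eps < m%:R.
  by apply: lt_trans (truncnS_gt _) _; rewrite ltr_nat.
rewrite ltr_pdivrMr// in hm.
rewrite ltr_pdivrMr ?mulr_gt0//.
apply: (@lt_trans _ _ (lambda0 * (2 * m%:R))).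
  by rewrite ltr_pM2l// mulr2n mulrDl !mul1r ltrD.
have -> : lambda0 * (2 * m%:R) = 2 * lambda0 * m%:R by ring.
have -> : eps * (m%:R * m%:R) = m%:R * eps * m%:R by ring.
by rewrite ltr_pM2r.
Qed.

Lemma vanishing_const (lambda0 : R) : 1 <= lambda0 ->
  forall eps : R, 0 < eps -> exists2 n, [set n : nat | (1 <= n)%N] n &
    unit_penalty (fun=> lambda0) n < eps.
Proof.
move=> l1 eps e0; have l0 : 0 < lambda0 by exact: lt_le_trans l1.
exists (Num.truncn (lambda0 / eps)).+1 => //.
rewrite /unit_penalty ltr_pdivrMr ?ltr0n// mulrC -ltr_pdivrMr//.
exact: truncnS_gt.
Qed.

End vanishing_penalties.

Theorem proposition7 (R : realType) (r : nat) (V : int -> set (R -> R))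
    (phi psi : R -> R) (theta alpha : R)
    (hr : (1 <= r)%N) (hwav : wavelet_system r V phi psi)
    (htheta : 2 < theta) (halpha0 : 0 < alpha) (halphar : alpha < r%:R) :
  (exists L : R, 0 < L /\ forall lambda0 : R, L <= lambda0 ->
     let N := [set n : nat | (2 <= n)%N] in
     let lambda := fun n : nat => lambda0 * ln (n%:R : R) in
     forall (j0 : nat -> int) (d : measure_display) (T : measurableType d)
       (P : probability T R) (W : (R -> R) -> T -> R)
       (s_st s_ht s_l : estimator R),
     maximal_level N lambda j0 ->
     white_noise P W ->
     sieve_estimator phi psi N lambda j0 s_st ->
     hybrid_estimator theta phi psi N lambda j0 s_ht ->
     large_estimator phi psi N lambda j0 s_l ->
     let MS_st := maxiset P W (nonempty_sizes N (sieve_models phi psi j0))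
                    s_st (rate lambda alpha) in
     let MS_ht := maxiset P W N s_ht (rate lambda alpha) in
     let MS_l := maxiset P W N s_l (rate lambda alpha) in
     MS_st `<` MS_ht /\ MS_ht `<` MS_l) /\
  (exists L : R, 0 < L /\ forall lambda0 : R, L <= lambda0 ->
     let N := [set n : nat | (1 <= n)%N] in
     let lambda := fun _ : nat => lambda0 in
     forall (j0 : nat -> int) (d : measure_display) (T : measurableType d)
       (P : probability T R) (W : (R -> R) -> T -> R)
       (s_st s_ht : estimator R),
     maximal_level N lambda j0 ->
     white_noise P W ->
     sieve_estimator phi psi N lambda j0 s_st ->
     hybrid_estimator theta phi psi N lambda j0 s_ht ->
     let MS_st := maxiset P W (nonempty_sizes N (sieve_models phi psi j0))
                    s_st (rate lambda alpha) in
     let MS_ht := maxiset P W N s_ht (rate lambda alpha) in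
     MS_st `<` MS_ht).
Proof.
have hb := ws_basis hwav.
have [C C0 hC] := profile_noise hb htheta.
have sieve_hybrid (N : set nat) lambda lmin pmin pmax j0 d (T : measurableType d)
    (P : probability T R) W s_st s_ht :
    regime N lambda lmin pmin pmax -> maximal_level N lambda j0 ->
    (forall eps : R, 0 < eps -> exists2 n, N n & unit_penalty lambda n < eps) ->
    C <= lmin -> white_noise P W ->
    sieve_estimator phi psi N lambda j0 s_st ->
    hybrid_estimator theta phi psi N lambda j0 s_ht ->
    maxiset P W (nonempty_sizes N (sieve_models phi psi j0)) s_st (rate lambda alpha)
      `<` maxiset P W N s_ht (rate lambda alpha).
  move=> hreg hj0 van Cl hW hst hht; split.
    move=> s hs; have [sL _] := hs.
    apply: (hybrid_approximated_maxiset hb htheta halpha0 hreg hj0 C0 hC Cl hW sL hht).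
    apply: (sieve_hybrid_approximated hb htheta halpha0 hreg hj0 sL).
    exact: (sieve_maxiset_approximated hb halpha0 hreg hj0 hC Cl hW hst hs).
  have [s [sL hs ns]] := sieve_separation hb htheta halpha0 hreg hj0 van.
  move=> /(_ s (hybrid_approximated_maxiset hb htheta halpha0 hreg hj0 C0 hC Cl hW sL hht hs)).
  move=> hst'; apply: ns.
  exact: (sieve_maxiset_approximated hb halpha0 hreg hj0 hC Cl hW hst hst').
split; last first.
  exists (C + 1); split; first by rewrite addr_gt0.
  move=> lambda0 hl N lambda j0 d T P W s_st s_ht hj0 hW hst hht /=.
  have l1 : 1 <= lambda0 by move: C0; lra.
  have Cl : C <= lambda0 by lra.
  exact: (sieve_hybrid _ _ _ _ _ _ _ _ _ _ _ _ (regime_const l1) hj0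
    (vanishing_const l1) Cl hW hst hht).
exists (2 * C + 128); split; first by rewrite addr_gt0 ?mulr_gt0.
move=> lambda0 hl N lambda j0 d T P W s_st s_ht s_l hj0 hW hst hht hlarge /=.
have l1 : 1 <= lambda0 by move: C0; lra.
have ln2 : 2^-1 <= ln 2 :> R.
  have : ln (2^-1) <= 2^-1 - 1 :> R.
    rewrite -[X in ln X](_ : 1 + (2^-1 - 1) = _ :> R); last by field.
    apply: le_ln1Dx; lra.
  rewrite lnV ?posrE//; lra.
have hln : lambda0 / 2 <= lambda0 * ln 2 by rewrite ler_wpM2l// (le_trans ler01).
have Cl : C <= lambda0 * ln 2 by apply: le_trans hln; lra.
have hreg := regime_log l1; have van := vanishing_log l1.
split.
  exact: (sieve_hybrid _ _ _ _ _ _ _ _ _ _ _ _ hreg hj0 van Cl hW hst hht).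
have l48 : 48 <= lambda0 * ln 2 by apply: le_trans hln; move: C0; lra.
have l32 n : N n -> 32 * ln n%:R <= lambda n.
  move=> Nn; apply: ler_wpM2r; last by move: C0; lra.
  by rewrite ln_ge0// ler1n ltnW.
split.
  move=> s hs; have [sL _] := hs.
  apply: (large_approximated_maxiset hb halpha0 hreg hj0 l48 l32 hW sL hlarge).
  apply: (hybrid_large_approximated htheta hreg).
  exact: (hybrid_maxiset_approximated hb htheta halpha0 hreg hj0 hC Cl hW hht hs).
have [s [sL hs ns]] := hybrid_separation hb htheta halpha0 hreg hj0 van.
move=> /(_ s (large_approximated_maxiset hb halpha0 hreg hj0 l48 l32 hW sL hlarge hs)).
move=> hht'; apply: ns.
exact: (hybrid_maxiset_approximated hb htheta halpha0 hreg hj0 hC Cl hW hht hht').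
Qed.
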